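(* Let $R > r > 0$ and $R' > r' > 0$ be real numbers, let $p, q \geq 0$ be integers, and let $s, c, c', t \in \mathbb{R}^3$. Assume $|s| \leq r$, $|c| = R' + r = R + r'$, and $|t - c'| \leq r' - |c - c'|$ (i.e. $t$ lies in the closed ball of radius $r'-|c-c'|$ centered at $c'$, which is contained in the closed ball of radius $r'$ centered at $c$). Let $\phi_s(x) = 1/|x-s|$. Let $\mathcal{M}_{0}^{p}[\phi_s]$ be the $p$-th order multipole expansion of $\phi_s$ centered at the origin, let $\mathcal{L}_{c}^{p}[\mathcal{M}_{0}^{p}[\phi_s]]$ be the $p$-th order local expansion of that function centered at $c$, and let $\mathcal{L}_{c'}^{q}[\mathcal{L}_{c}^{p}[\mathcal{M}_{0}^{p}[\phi_s]]]$ be the $q$-th order local expansion of the latter function centered at $c'$. Let $\mathcal{L}_{c'}^{q}[\phi_s]$ be the $q$-th order local expansion of $\phi_s$ centered at $c'$. Then $$\left| \mathcal{L}_{c'}^{q}[\phi_s](t) - \mathcal{L}_{c'}^{q}[\mathcal{L}_{c}^{p}[\mathcal{M}_{0}^{p}[\phi_s]]](t) \right| \leq \frac{1}{R-r}\left(\frac{r}{R}\right)^{p+1} + \frac{1}{R'-r'}\left(\frac{r'}{R'}\right)^{p+1}.$$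
   Context: $|\cdot|$ is the Euclidean norm on $\mathbb{R}^3$ (and the modulus on $\mathbb{C}$); for $x \neq 0$, $\hat{x} = x/|x|$; $\mathbb{S}^2$ is the unit sphere in $\mathbb{R}^3$ with surface measure $dS$; $B(c,\rho)$ and $\bar B(c,\rho)$ are the open and closed Euclidean balls. Spherical harmonics: for integers $n \geq 0$, $-n \leq m \leq n$, and $\xi = (\sin\theta\cos\varphi, \sin\theta\sin\varphi, \cos\theta)\in\mathbb{S}^2$, $$Y_n^m(\xi) = \sqrt{\frac{2n+1}{4\pi}\frac{(n-m)!}{(n+m)!}}\, e^{im\varphi} P_n^m(\cos\theta),$$ where $P_n^m$ is the associated Legendre function of degree $n$ and order $m$ (with the usual convention for negative order $P_n^{-m} = (-1)^m \frac{(n-m)!}{(n+m)!}P_n^m$). They form an orthonormal basis of $L^2(\mathbb{S}^2)$ (complex inner product $\int_{\mathbb{S}^2} f\overline{g}\,dS$). Solid harmonics: $R_n^m(x) = |x|^n Y_n^m(\hat x)$ (with $R_n^m(0)=0$ for $n>0$ and $R_0^0 \equiv 1/\sqrt{4\pi}$), and $I_n^m(x) = |x|^{-(n+1)}Y_n^m(\hat x)$ for $x\neq 0$. Local expansion: let $\rho>0$, $c\in\mathbb{R}^3$, and let $f$ be harmonic in $B(c,\rho)$ and continuous on $\bar B(c,\rho)$. Its local coefficients are $L_n^m = \rho^{-n}\int_{\mathbb{S}^2} f(c+\rho\xi)\overline{Y_n^m(\xi)}\,dS(\xi)$, and its $p$-th order local expansion centered at $c$ is $$\mathcal{L}_c^p[f](x)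 = \sum_{n=0}^p\sum_{m=-n}^n L_n^m R_n^m(x-c).$$ Multipole expansion: let $\rho>0$, $c\in\mathbb{R}^3$, and let $f$ be harmonic in the exterior of $B(c,\rho)$, continuous on $\mathbb{R}^3\setminus B(c,\rho)$, with $|f(x)|\to 0$ as $|x|\to\infty$. Its multipole coefficients are $M_n^m = \rho^{n+1}\int_{\mathbb{S}^2} f(c+\rho\xi)\overline{Y_n^m(\xi)}\,dS(\xi)$, and its $p$-th order multipole expansion centered at $c$ is $$\mathcal{M}_c^p[f](x) = \sum_{n=0}^p\sum_{m=-n}^n M_n^m I_n^m(x-c).$$ In both cases the coefficients do not depend on the admissible choice of $\rho$; the expansions are understood using any $\rho>0$ for which the hypotheses hold, and the resulting formulas define functions on all of $\mathbb{R}^3$ (local) or $\mathbb{R}^3\setminus\{c\}$ (multipole). *)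

(* Defs.v *)
From Stdlib Require Import Reals ZArith ClassicalEpsilon.
From Coquelicot Require Import Coquelicot.

Open Scope R_scope.

Definition R3 : Type := (R * R * R)%type.

Definition crd1 (x : R3) : R := fst (fst x).
Definition crd2 (x : R3) : R := snd (fst x).
Definition crd3 (x : R3) : R := snd x.

Definition zero3 : R3 := (0, 0, 0).
Definition add3 (x y : R3) : R3 :=
  (crd1 x + crd1 y, crd2 x + crd2 y, crd3 x + crd3 y).
Definition sub3 (x y : R3) : R3 :=
  (crd1 x - crd1 y, crd2 x - crd2 y, crd3 x - crd3 y).
Definition scal3 (a : R) (x : R3) : R3 :=
  (a * crd1 x, a * crd2 x, a * crd3 x).

Definition norm3 (x : R3) : R :=
  sqrt (crd1 x ^ 2 + crd2 x ^ 2 + crd3 x ^ 2).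

(* x / |x|, with the harmless value 0 at x = 0 *)
Definition unit3 (x : R3) : R3 := scal3 (/ norm3 x) x.

(** * Harmonic functions *)

Inductive axis : Set := ax1 | ax2 | ax3.

Definition basis3 (i : axis) : R3 :=
  match i with ax1 => (1, 0, 0) | ax2 => (0, 1, 0) | ax3 => (0, 0, 1) end.

Definition slice (i : axis) (u : R3 -> R) (x : R3) (h : R) : R :=
  u (add3 x (scal3 h (basis3 i))).

Definition partial (i : axis) (u : R3 -> R) (x : R3) : R :=
  Derive (slice i u x) 0.

(* C^1 and C^2 on an open set D; topologically [R3] is Coquelicot's product
   uniform space, whose topology is the Euclidean one. *)
Definition C1_on (D : R3 -> Prop) (u : R3 -> R) : Prop :=
  forall (i : axis) (x : R3), D x ->
    ex_derive (slice i u x) 0 /\ continuous (partial i u) x.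

Definition C2_on (D : R3 -> Prop) (u : R3 -> R) : Prop :=
  C1_on D u /\ forall i : axis, C1_on D (partial i u).

Definition laplacian (u : R3 -> R) (x : R3) : R :=
  partial ax1 (partial ax1 u) x + partial ax2 (partial ax2 u) x
  + partial ax3 (partial ax3 u) x.

Definition real_harmonic_on (D : R3 -> Prop) (u : R3 -> R) : Prop :=
  C2_on D u /\ forall x : R3, D x -> laplacian u x = 0.

Definition harmonic_on (D : R3 -> Prop) (f : R3 -> C) : Prop :=
  real_harmonic_on D (fun x => Re (f x)) /\
  real_harmonic_on D (fun x => Im (f x)).

Definition vanishes_at_infinity (f : R3 -> C) : Prop :=
  forall eps : R, 0 < eps ->
    exists A : R, forall x : R3, A < norm3 x -> Cmod (f x) < eps.

(** * Spherical harmonics *)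

Definition legendre (n : nat) (x : R) : R :=
  / (2 ^ n * INR (fact n)) * Derive_n (fun u => (u ^ 2 - 1) ^ n) n x.

(* Order m >= 0, with the Condon-Shortley phase (-1)^m. *)
Definition assoc_legendre_nonneg (n m : nat) (x : R) : R :=
  (-1) ^ m * sqrt (1 - x ^ 2) ^ m * Derive_n (legendre n) m x.

Definition assoc_legendre (n : nat) (m : Z) (x : R) : R :=
  let k := Z.abs_nat m in
  if Z.leb 0 m then assoc_legendre_nonneg n k x
  else (-1) ^ k * (INR (fact (n - k)) / INR (fact (n + k)))
       * assoc_legendre_nonneg n k x.

Definition cis (a : R) : C := (cos a, sin a).

(* The formula defining Y_n^m in terms of the angles, for |m| <= n. *)
Definition sph_harm_angles (n : nat) (m : Z) (theta phi : R) : C :=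
  Cmult
    (RtoC (sqrt ((2 * INR n + 1) / (4 * PI)
                 * (INR (fact (Z.to_nat (Z.of_nat n - m)))
                    / INR (fact (Z.to_nat (Z.of_nat n + m)))))))
    (Cmult (cis (IZR m * phi)) (RtoC (assoc_legendre n m (cos theta)))).

Definition sphere_point (theta phi : R) : R3 :=
  (sin theta * cos phi, sin theta * sin phi, cos theta).

(* Inverse of [sphere_point] on the unit sphere: theta in [0, PI] and phi in
   (-PI, PI].  At the two poles phi is arbitrary, and Y_n^m does not depend
   on it there. *)
Definition polar_angle (xi : R3) : R := acos (crd3 xi).

Definition azimuth (xi : R3) : R :=
  let a := acos (crd1 xi / sqrt (crd1 xi ^ 2 + crd2 xi ^ 2)) in
  if Rle_dec 0 (crd2 xi) then a else - a.

Definition sph_harm (n : nat) (m : Z) (xi : R3) : C :=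
  sph_harm_angles n m (polar_angle xi) (azimuth xi).

(* Integral over the unit sphere with respect to surface measure
   dS = sin theta dtheta dphi. *)
Definition sphere_integral (g : R3 -> C) : C :=
  RInt (V := C_R_CompleteNormedModule)
    (fun phi : R =>
       RInt (V := C_R_CompleteNormedModule)
         (fun theta : R =>
            Cmult (RtoC (sin theta)) (g (sphere_point theta phi)))
         0 PI)
    0 (2 * PI).

(** * Solid harmonics *)

(* At x = 0 this is 0 for n > 0 (as 0 ^ n = 0), and for n = 0 it is the
   constant 1 / sqrt (4 PI), because Y_0^0 is constant. *)
Definition solid_R (n : nat) (m : Z) (x : R3) : C :=
  Cmult (RtoC (norm3 x ^ n)) (sph_harm n m (unit3 x)).

(* Only meaningful for x <> 0. *)
Definition solid_I (n : nat) (m : Z) (x : R3) : C :=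
  Cmult (RtoC (/ norm3 x ^ (n + 1))) (sph_harm n m (unit3 x)).

(** * Local and multipole expansions *)

(* sum over n = 0, ..., p and m = -n, ..., n *)
Definition degree_order_sum (p : nat) (F : nat -> Z -> C) : C :=
  sum_n (G := C_AbelianMonoid)
    (fun n : nat =>
       sum_n (G := C_AbelianMonoid)
         (fun k : nat => F n (Z.of_nat k - Z.of_nat n)%Z) (2 * n))
    p.

(* <f(c + rho .), Y_n^m> in L^2 of the unit sphere *)
Definition sphere_coeff (c : R3) (rho : R) (f : R3 -> C) (n : nat) (m : Z)
  : C :=
  sphere_integral
    (fun xi => Cmult (f (add3 c (scal3 rho xi))) (Cconj (sph_harm n m xi))).

Definition local_admissible (c : R3) (f : R3 -> C) (rho : R) : Prop :=
  0 < rho /\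
  harmonic_on (fun x => norm3 (sub3 x c) < rho) f /\
  continuous_on (fun x => norm3 (sub3 x c) <= rho) f.

Definition multipole_admissible (c : R3) (f : R3 -> C) (rho : R) : Prop :=
  0 < rho /\
  harmonic_on (fun x => rho < norm3 (sub3 x c)) f /\
  continuous_on (fun x => rho <= norm3 (sub3 x c)) f /\
  vanishes_at_infinity f.

(* The coefficients do not depend on the admissible radius, so an arbitrary
   one is selected; this is only meaningful when an admissible radius
   exists. *)
Definition local_radius (c : R3) (f : R3 -> C) : R :=
  epsilon (inhabits 1) (local_admissible c f).

Definition multipole_radius (c : R3) (f : R3 -> C) : R :=
  epsilon (inhabits 1) (multipole_admissible c f).

Definition local_coeff (c : R3) (f : R3 -> C) (n : nat) (m : Z) : C :=
  let rho := local_radius c f in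
  Cmult (RtoC (/ rho ^ n)) (sphere_coeff c rho f n m).

Definition multipole_coeff (c : R3) (f : R3 -> C) (n : nat) (m : Z) : C :=
  let rho := multipole_radius c f in
  Cmult (RtoC (rho ^ (n + 1))) (sphere_coeff c rho f n m).

Definition local_expansion (p : nat) (c : R3) (f : R3 -> C) (x : R3) : C :=
  degree_order_sum p
    (fun n m => Cmult (local_coeff c f n m) (solid_R n m (sub3 x c))).

Definition multipole_expansion (p : nat) (c : R3) (f : R3 -> C) (x : R3)
  : C :=
  degree_order_sum p
    (fun n m => Cmult (multipole_coeff c f n m) (solid_I n m (sub3 x c))).

(** * The potential of a unit point charge at s *)

Definition point_potential (s x : R3) : C := RtoC (/ norm3 (sub3 x s)).

(* Main.v *)
Require Import Defs.
From Stdlib Require Import Reals ZArith Lra Lia Psatz ClassicalEpsilon.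
From Coquelicot Require Import Coquelicot.
Open Scope R_scope.

(** Let [D = |c|] and take spherical coordinates with pole in the direction of
    [c].  For each angle [t] there is a complex linear form [w] on space, the
    [null_form], whose coefficient vector is null (the sum of the squares of
    its entries is 0) and which satisfies [|w v| <= |v|].  Laplace's integral
    says that, for [|v| < D], the potential [1 / |c + v|] is the average over
    [t] of [1 / (D + w v)] ([circle_avg_far]).

    Since [w] is null, every power of it is a harmonic polynomial
    ([null_power]).  Expanding the integrand therefore produces expansions in
    solid harmonics.  With [v = y - s] and [y = (c' - c) + z], the multipole
    expansion of order [p] retains the powers of [w s] up to [p], the local
    expansion at [c] the powers of [w y] up to [p], and the local expansion at
    [c'] the powers of [w z] up to [q].  The two sides of the theorem become
    averages of explicit rational functions of the three numbers [w s],
    [w (c' - c)] and [w z] ([local_point_value], [local_local_value]), with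
    [|w s| <= r] and [|w (c' - c)| + |w z| <= r'].

    It remains to compare two rational functions of complex numbers
    ([pointwise_error]).  Up to signs, which are moved into the arguments, all
    their Taylor coefficients are positive, so the omitted terms are largest
    at the positive arguments [r] and [r'].  There the terms of degree more
    than [p] in [r] sum to the first bound and those of degree more than [p]
    in [r'] to the second.  Truncation in [w z] leaves out terms of one sign,
    so it cannot increase these sums: the bound is independent of [q].

    The rest connects this computation with the definition of the expansions
    by integrals over a sphere.  The solid harmonics are the coefficients of
    powers of a null form that depends on a parameter; from this come their
    orthonormality ([sph_harm_ortho]), the expansion of arbitrary null powers
    and their harmonicity.  By orthonormality, a series of harmonics that
    converges uniformly on a sphere determines the coefficients
    ([sphere_series_coeff]).  The radius of that sphere is an unspecified
    admissible one.  Hence admissible radii must exist, which follows from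
    harmonicity, and they must not reach a singularity, because a function
    continuous on a closed ball is bounded along segments
    ([point_local_radius], [multipole_local_radius]).  Finally, the frame that
    makes a function expandable at every admissible radius is not always the
    frame at [c]; uniqueness of Taylor coefficients ([multipole_term_far]) and
    of coefficients of harmonics relates the two. *)

(** Normed-module lemmas leave equations between reals at a carrier type that
    [ring] does not recognise. *)
Ltac real_eq := match goal with |- @eq _ ?a ?b => change (@eq R a b) end.

(** * Finite sums *)

Fixpoint Csum (f : nat -> C) (n : nat) : C :=
  match n with O => RtoC 0 | S k => (Csum f k + f k)%C end.

Fixpoint Rsum (f : nat -> R) (n : nat) : R :=
  match n with O => 0 | S k => Rsum f k + f k end.

Lemma sum_n_Csum (f : nat -> C) (n : nat) :
  sum_n (G := C_AbelianMonoid) f n = Csum f (S n).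
Proof.
  induction n as [|n IH].
  - rewrite sum_O; simpl; now rewrite Cplus_0_l.
  - rewrite sum_Sn, IH; reflexivity.
Qed.

Lemma Csum_ext (f g : nat -> C) (n : nat) :
  (forall i, (i < n)%nat -> f i = g i) -> Csum f n = Csum g n.
Proof.
  induction n as [|n IH]; intros H; simpl; [easy|].
  rewrite IH, (H n); auto with arith.
Qed.

Lemma Csum_plus (f g : nat -> C) (n : nat) :
  Csum (fun i => (f i + g i)%C) n = (Csum f n + Csum g n)%C.
Proof. induction n as [|n IH]; simpl; [ring|]. rewrite IH; ring. Qed.

Lemma Csum_minus (f g : nat -> C) (n : nat) :
  Csum (fun i => (f i - g i)%C) n = (Csum f n - Csum g n)%C.
Proof. induction n as [|n IH]; simpl; [ring|]. rewrite IH; ring. Qed.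

Lemma Csum_scal (a : C) (f : nat -> C) (n : nat) :
  Csum (fun i => (a * f i)%C) n = (a * Csum f n)%C.
Proof. induction n as [|n IH]; simpl; [ring|]. rewrite IH; ring. Qed.

Lemma Csum_zero (f : nat -> C) (n : nat) :
  (forall i, (i < n)%nat -> f i = RtoC 0) -> Csum f n = RtoC 0.
Proof.
  induction n as [|n IH]; intros H; simpl; [easy|].
  rewrite IH, (H n); auto with arith; ring.
Qed.

Lemma Csum_first (f : nat -> C) (n : nat) :
  Csum f (S n) = (f O + Csum (fun i => f (S i)) n)%C.
Proof.
  induction n as [|n IH]; [simpl; ring|].
  change (Csum f (S (S n))) with (Csum f (S n) + f (S n))%C.
  rewrite IH; simpl; ring.
Qed.

Lemma Csum_swap (f : nat -> nat -> C) (n m : nat) :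
  Csum (fun i => Csum (f i) m) n = Csum (fun j => Csum (fun i => f i j) n) m.
Proof.
  induction n as [|n IH]; simpl.
  - now rewrite Csum_zero.
  - now rewrite IH, <- Csum_plus.
Qed.

Lemma Csum_single (f : nat -> C) (n i : nat) :
  (i < n)%nat -> (forall j, (j < n)%nat -> j <> i -> f j = RtoC 0) ->
  Csum f n = f i.
Proof.
  induction n as [|n IH]; intros Hi H; [lia|]; simpl.
  destruct (Nat.eq_dec i n) as [->|Hn].
  - rewrite Csum_zero; [ring|]. intros j Hj; apply H; lia.
  - rewrite IH, (H n); [ring|lia|lia|lia|]. intros j Hj; apply H; lia.
Qed.

Lemma Cmod_Csum (f : nat -> C) (g : nat -> R) (n : nat) :
  (forall i, (i < n)%nat -> Cmod (f i) <= g i) -> Cmod (Csum f n) <= Rsum g n.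
Proof.
  induction n as [|n IH]; intros H; simpl.
  - rewrite Cmod_0; lra.
  - eapply Rle_trans; [apply Cmod_triangle|].
    apply Rplus_le_compat; [apply IH; intros; apply H|apply H]; lia.
Qed.

Lemma Rsum_ext (f g : nat -> R) (n : nat) :
  (forall i, (i < n)%nat -> f i = g i) -> Rsum f n = Rsum g n.
Proof.
  induction n as [|n IH]; intros H; simpl; [easy|].
  rewrite IH, (H n); auto with arith.
Qed.

Lemma Rsum_plus (f g : nat -> R) (n : nat) :
  Rsum (fun i => f i + g i) n = Rsum f n + Rsum g n.
Proof. induction n as [|n IH]; simpl; [ring|]. rewrite IH; ring. Qed.

Lemma Rsum_minus (f g : nat -> R) (n : nat) :
  Rsum (fun i => f i - g i) n = Rsum f n - Rsum g n.
Proof. induction n as [|n IH]; simpl; [ring|]. rewrite IH; ring. Qed.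

Lemma Rsum_scal (a : R) (f : nat -> R) (n : nat) :
  Rsum (fun i => a * f i) n = a * Rsum f n.
Proof. induction n as [|n IH]; simpl; [ring|]. rewrite IH; ring. Qed.

Lemma Rsum_swap (f : nat -> nat -> R) (n m : nat) :
  Rsum (fun i => Rsum (f i) m) n = Rsum (fun j => Rsum (fun i => f i j) n) m.
Proof.
  induction n as [|n IH]; simpl.
  - induction m as [|m IHm]; simpl; [easy|]. rewrite <- IHm; ring.
  - now rewrite IH, <- Rsum_plus.
Qed.

Lemma Rsum_pos (f : nat -> R) (n : nat) :
  (forall i, (i < n)%nat -> 0 <= f i) -> 0 <= Rsum f n.
Proof.
  induction n as [|n IH]; intros H; simpl; [lra|].
  apply Rplus_le_le_0_compat; [apply IH; intros; apply H|apply H]; lia.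
Qed.

Lemma Rsum_le_more (f : nat -> R) (n m : nat) :
  (n <= m)%nat -> (forall i, 0 <= f i) -> Rsum f n <= Rsum f m.
Proof.
  intros Hnm Hf; induction Hnm as [|m _ IH]; simpl; [lra|].
  specialize (Hf m); lra.
Qed.

Lemma RtoC_Rsum (f : nat -> R) (n : nat) :
  RtoC (Rsum f n) = Csum (fun i => RtoC (f i)) n.
Proof. induction n as [|n IH]; simpl; [easy|]. now rewrite RtoC_plus, IH. Qed.

(** * Continuity of complex functions *)

Lemma C_ext (x y : C) : Re x = Re y -> Im x = Im y -> x = y.
Proof. destruct x, y; simpl; intros; subst; easy. Qed.

(** Two uniform structures on the complex numbers are in use, and they are not
    convertible; continuity of the two real components avoids choosing. *)
Definition ccont {U : UniformSpace} (f : U -> C) (x : U) : Prop :=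
  continuous (fun t => Re (f t)) x /\ continuous (fun t => Im (f t)) x.

Section Ccont.
Context {U : UniformSpace}.
Implicit Types (f g : U -> C) (x : U).

Lemma continuous_Rmult (f g : U -> R) x :
  continuous f x -> continuous g x -> continuous (fun t => f t * g t) x.
Proof. intros; now apply (continuous_mult (K := R_AbsRing)). Qed.

Lemma continuous_Rplus (f g : U -> R) x :
  continuous f x -> continuous g x -> continuous (fun t => f t + g t) x.
Proof. intros; now apply (continuous_plus (V := R_NormedModule)). Qed.

Lemma continuous_Ropp (f : U -> R) x :
  continuous f x -> continuous (fun t => - f t) x.
Proof. intros; now apply (continuous_opp (V := R_NormedModule)). Qed.

Lemma continuous_Rminus (f g : U -> R) x :
  continuous f x -> continuous g x -> continuous (fun t => f t - g t) x.
Proof. intros; now apply (continuous_minus (V := R_NormedModule)). Qed.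

Lemma continuous_Rinv' (f : U -> R) x :
  f x <> 0 -> continuous f x -> continuous (fun t => / f t) x.
Proof.
  intros H Hf. apply (continuous_comp f Rinv); [easy|].
  now apply continuous_Rinv.
Qed.

Lemma continuous_Rpow (f : U -> R) n x :
  continuous f x -> continuous (fun t => f t ^ n) x.
Proof.
  intros Hf; induction n as [|n IH]; simpl; [apply continuous_const|].
  now apply continuous_Rmult.
Qed.

Lemma ccont_const (a : C) x : ccont (fun _ => a) x.
Proof. split; apply continuous_const. Qed.

Lemma ccont_real (f : U -> R) x : continuous f x -> ccont (fun t => RtoC (f t)) x.
Proof. split; [easy|apply continuous_const]. Qed.

Lemma ccont_pair (f g : U -> R) x :
  continuous f x -> continuous g x -> ccont (fun t => (f t, g t)) x.
Proof. split; easy. Qed.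

Lemma ccont_plus f g x : ccont f x -> ccont g x -> ccont (fun t => (f t + g t)%C) x.
Proof. intros [? ?] [? ?]; split; simpl; now apply continuous_Rplus. Qed.

Lemma ccont_opp f x : ccont f x -> ccont (fun t => (- f t)%C) x.
Proof. intros [? ?]; split; simpl; now apply continuous_Ropp. Qed.

Lemma ccont_minus f g x : ccont f x -> ccont g x -> ccont (fun t => (f t - g t)%C) x.
Proof. intros; apply ccont_plus; [easy|]. now apply ccont_opp. Qed.

Lemma ccont_mult f g x : ccont f x -> ccont g x -> ccont (fun t => (f t * g t)%C) x.
Proof.
  intros [? ?] [? ?]; split; simpl.
  - apply continuous_Rminus; now apply continuous_Rmult.
  - apply continuous_Rplus; now apply continuous_Rmult.
Qed.

Lemma ccont_pow f n x : ccont f x -> ccont (fun t => (f t ^ n)%C) x.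
Proof.
  intros Hf; induction n as [|n IH]; simpl; [apply ccont_const|].
  now apply ccont_mult.
Qed.

Lemma ccont_inv f x : f x <> RtoC 0 -> ccont f x -> ccont (fun t => (/ f t)%C) x.
Proof.
  intros H [Hr Hi].
  assert (Hn : Re (f x) ^ 2 + Im (f x) ^ 2 <> 0).
  { intros H0; apply H; apply C_ext; simpl; nra. }
  split; simpl.
  - apply continuous_Rmult; [easy|]. apply continuous_Rinv'; [easy|].
    apply continuous_Rplus; now apply (continuous_Rpow _ 2).
  - apply continuous_Rmult; [now apply continuous_Ropp|].
    apply continuous_Rinv'; [easy|].
    apply continuous_Rplus; now apply (continuous_Rpow _ 2).
Qed.

Lemma ccont_Csum (f : nat -> U -> C) n x :
  (forall i, (i < n)%nat -> ccont (f i) x) -> ccont (fun t => Csum (fun i => f i t) n) x.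
Proof.
  induction n as [|n IH]; intros H; simpl; [apply ccont_const|].
  apply ccont_plus; [apply IH; intros; apply H|apply H]; lia.
Qed.

Lemma ccont_ext f g x : (forall t, f t = g t) -> ccont f x -> ccont g x.
Proof.
  intros H [Hr Hi]; split;
    [apply (continuous_ext (fun t => Re (f t)))|apply (continuous_ext (fun t => Im (f t)))];
    try easy; intros; now rewrite H.
Qed.

End Ccont.

(** The head operation selects the rule.  Unification alone would also apply
    the rules for sums and products to constants, without end. *)
Ltac ccont_auto :=
  lazymatch goal with
  | |- ccont (fun _ => ?a) _ => apply ccont_const
  | |- ccont (fun t => Cplus (@?f t) (@?g t)) _ => apply (ccont_plus f g); ccont_auto
  | |- ccont (fun t => Cminus (@?f t) (@?g t)) _ => apply (ccont_minus f g); ccont_auto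
  | |- ccont (fun t => Cmult (@?f t) (@?g t)) _ => apply (ccont_mult f g); ccont_auto
  | |- ccont (fun t => Cpow (@?f t) ?n) _ => apply (ccont_pow f n); ccont_auto
  | |- ccont (fun t => Cinv (@?f t)) _ => apply (ccont_inv f); [auto using Cpow_nz|ccont_auto]
  | |- ccont (fun t => Csum (@?f t) ?n) _ =>
      apply (ccont_Csum (fun i t => f t i) n); intros; cbv beta; ccont_auto
  | _ => auto with ccont
  end.

(** * Integrals of complex functions of a real variable *)

Definition is_CInt (f : R -> C) (a b : R) (l : C) : Prop :=
  is_RInt (V := C_R_NormedModule) f a b l.

Lemma is_CInt_pair (f : R -> C) a b (l : C) :
  is_RInt (fun t => Re (f t)) a b (Re l) -> is_RInt (fun t => Im (f t)) a b (Im l) ->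
  is_CInt f a b l.
Proof.
  intros Hr Hi. destruct l as [l1 l2].
  now apply (is_RInt_fct_extend_pair (U := R_NormedModule) (V := R_NormedModule)).
Qed.

Lemma is_CInt_Re (f : R -> C) a b l : is_CInt f a b l -> is_RInt (fun t => Re (f t)) a b (Re l).
Proof. apply (is_RInt_fct_extend_fst (U := R_NormedModule) (V := R_NormedModule)). Qed.

Lemma is_CInt_Im (f : R -> C) a b l : is_CInt f a b l -> is_RInt (fun t => Im (f t)) a b (Im l).
Proof. apply (is_RInt_fct_extend_snd (U := R_NormedModule) (V := R_NormedModule)). Qed.

Lemma is_CInt_unique (f : R -> C) a b l :
  is_CInt f a b l -> RInt (V := C_R_CompleteNormedModule) f a b = l.
Proof. intros H; now apply (is_RInt_unique (V := C_R_CompleteNormedModule)). Qed.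

Lemma is_CInt_RInt (f : R -> C) a b l :
  is_CInt f a b l -> is_CInt f a b (RInt (V := C_R_CompleteNormedModule) f a b).
Proof. intros H; now rewrite (is_CInt_unique _ _ _ _ H). Qed.

Lemma is_CInt_ext (f g : R -> C) a b l :
  (forall x, Rmin a b < x < Rmax a b -> f x = g x) -> is_CInt f a b l -> is_CInt g a b l.
Proof. apply (is_RInt_ext (V := C_R_NormedModule)). Qed.

Lemma is_CInt_plus (f g : R -> C) a b lf lg :
  is_CInt f a b lf -> is_CInt g a b lg -> is_CInt (fun t => (f t + g t)%C) a b (lf + lg)%C.
Proof. apply (is_RInt_plus (V := C_R_NormedModule)). Qed.

Lemma is_CInt_minus (f g : R -> C) a b lf lg :
  is_CInt f a b lf -> is_CInt g a b lg -> is_CInt (fun t => (f t - g t)%C) a b (lf - lg)%C.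
Proof. apply (is_RInt_minus (V := C_R_NormedModule)). Qed.

Lemma is_CInt_scal (c : C) (f : R -> C) a b l :
  is_CInt f a b l -> is_CInt (fun t => (c * f t)%C) a b (c * l)%C.
Proof.
  intros H. pose proof (is_CInt_Re _ _ _ _ H) as Hr. pose proof (is_CInt_Im _ _ _ _ H) as Hi.
  apply is_CInt_pair; simpl.
  - apply (is_RInt_minus (V := R_NormedModule));
      now apply (is_RInt_scal (V := R_NormedModule)).
  - apply (is_RInt_plus (V := R_NormedModule));
      now apply (is_RInt_scal (V := R_NormedModule)).
Qed.

Lemma is_CInt_zero a b : is_CInt (fun _ => RtoC 0) a b (RtoC 0).
Proof.
  assert (H : is_RInt (V := R_NormedModule) (fun _ => 0) a b 0).
  { pose proof (is_RInt_const (V := R_NormedModule) a b 0) as H.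
    change (scal (b - a) 0) with ((b - a) * 0) in H. now rewrite Rmult_0_r in H. }
  apply is_CInt_pair; exact H.
Qed.

Lemma is_CInt_Csum (f : nat -> R -> C) a b (l : nat -> C) n :
  (forall i, (i < n)%nat -> is_CInt (f i) a b (l i)) ->
  is_CInt (fun t => Csum (fun i => f i t) n) a b (Csum l n).
Proof.
  induction n as [|n IH]; intros H; simpl; [apply is_CInt_zero|].
  apply is_CInt_plus; [apply IH; intros; apply H|apply H]; lia.
Qed.

Lemma Cmod_norm (z : C) : norm (V := C_R_NormedModule) z = Cmod z.
Proof.
  destruct z as [x y]. unfold Cmod. simpl.
  unfold norm; simpl. unfold prod_norm, norm; simpl.
  f_equal. unfold abs; simpl. rewrite !Rmult_1_r, <- !Rabs_mult.
  rewrite !Rabs_pos_eq; nra.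
Qed.

Lemma is_CInt_bound (f : R -> C) a b l M :
  a <= b -> (forall x, a <= x <= b -> Cmod (f x) <= M) -> is_CInt f a b l ->
  Cmod l <= (b - a) * M.
Proof.
  intros Hab H Hl. rewrite <- Cmod_norm.
  apply (norm_RInt_le (V := C_R_NormedModule) f (fun _ => M) a b); [easy| |easy|].
  - intros x Hx; rewrite Cmod_norm; auto.
  - apply (is_RInt_const (V := R_NormedModule)).
Qed.

Lemma is_CInt_ccont (f : R -> C) a b :
  (forall x, ccont f x) -> is_CInt f a b (RInt (V := C_R_CompleteNormedModule) f a b).
Proof.
  intros H.
  apply (is_CInt_RInt f a b (RInt (fun t => Re (f t)) a b, RInt (fun t => Im (f t)) a b)).
  apply is_CInt_pair; simpl; apply (RInt_correct (V := R_CompleteNormedModule));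
    apply (ex_RInt_continuous (V := R_CompleteNormedModule)); intros x _;
    [exact (proj1 (H x))|exact (proj2 (H x))].
Qed.

Lemma FTC (f df : R -> R) a b l :
  (forall t, is_derive f t (df t)) -> (forall t, continuous df t) -> f b - f a = l ->
  is_RInt df a b l.
Proof.
  intros Hf Hdf <-.
  apply (is_RInt_derive (V := R_CompleteNormedModule) f df); auto.
Qed.

(** Integrability passes to the uniform limit.  The outer integrand of an
    iterated integral is itself an integral, and its integrability is obtained
    in this way from that of its approximants. *)
Lemma is_CInt_uniform_limit (f : nat -> R -> C) (g : R -> C) (h : nat -> C) a b
  (eps : nat -> R) :
  (forall n, is_CInt (f n) a b (h n)) ->
  (forall n x, Cmod (g x - f n x)%C <= eps n) ->
  is_lim_seq eps 0 ->
  exists l, is_CInt g a b l.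
Proof.
  intros Hf Hg He.
  destruct (filterlim_RInt (U := nat) (V := C_R_CompleteNormedModule) f a b eventually
    eventually_filter g h Hf) as [If [_ HI]]; [|now exists If].
  intros P [e He']. apply is_lim_seq_spec in He.
  destruct (He e) as [N HN]. exists N. intros n Hn. apply He'.
  intros x. specialize (HN n Hn). rewrite Rminus_0_r in HN.
  apply (norm_compat1 (V := C_R_NormedModule)).
  rewrite Cmod_norm. change (minus (f n x) (g x)) with (f n x - g x)%C.
  replace (f n x - g x)%C with (- (g x - f n x))%C by ring.
  rewrite Cmod_opp. eapply Rle_lt_trans; [apply Hg|].
  eapply Rle_lt_trans; [apply Rle_abs|exact HN].
Qed.

Lemma Cmod_le_lim (z : C) (eps : nat -> R) (K : R) :
  is_lim_seq eps 0 -> (forall n, Cmod z <= K * eps n) -> z = RtoC 0.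
Proof.
  intros He H. apply Cmod_eq_0. apply Rle_antisym; [|apply Cmod_ge_0].
  assert (Hlim : is_lim_seq (fun n => K * eps n) 0).
  { replace (Finite 0) with (Rbar_mult K 0) by (simpl; f_equal; ring).
    now apply is_lim_seq_scal_l. }
  apply (is_lim_seq_le (fun _ => Cmod z) _ (Cmod z) 0 H);
    [apply is_lim_seq_const|exact Hlim].
Qed.

(** * Trinomial coefficients *)

(** [tri n m A B D] is the coefficient of [h ^ m] in [(A h + B + D / h) ^ n].
    Letting [m] range over all integers, with value 0 outside [-n, ..., n],
    makes the recursion uniform. *)
Fixpoint tri (n : nat) (m : Z) (A B D : C) : C :=
  match n with
  | O => if Z.eqb m 0 then RtoC 1 else RtoC 0
  | S k => (A * tri k (m - 1) A B D + B * tri k m A B D + D * tri k (m + 1) A B D)%C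
  end.

(** The same coefficient over the reals, where it can be differentiated. *)
Fixpoint triR (n : nat) (m : Z) (A B D : R) : R :=
  match n with
  | O => if Z.eqb m 0 then 1 else 0
  | S k => A * triR k (m - 1) A B D + B * triR k m A B D + D * triR k (m + 1) A B D
  end.

Lemma tri_RtoC n m (A B D : R) :
  tri n m (RtoC A) (RtoC B) (RtoC D) = RtoC (triR n m A B D).
Proof.
  revert m; induction n as [|n IH]; intros m; simpl.
  - now destruct (Z.eqb m 0).
  - now rewrite !IH, !RtoC_plus, !RtoC_mult.
Qed.

Lemma tri_support n m A B D : (Z.of_nat n < Z.abs m)%Z -> tri n m A B D = RtoC 0.
Proof.
  revert m; induction n as [|n IH]; intros m Hm; cbn [tri].
  - destruct (Z.eqb_spec m 0); [lia|easy].
  - rewrite !IH by lia. ring.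
Qed.

Lemma triR_support n m A B D : (Z.of_nat n < Z.abs m)%Z -> triR n m A B D = 0.
Proof. intros H; apply RtoC_inj. now rewrite <- tri_RtoC, tri_support. Qed.

(** A family indexed by [-n, ..., n] and vanishing outside can be summed over
    any of the three windows of length [2 n + 3] that contain this range; the
    three terms of the recursion for [tri] use one window each. *)
Lemma Csum_window (f : Z -> C) n (e : Z) :
  (forall m, (Z.of_nat n < Z.abs m)%Z -> f m = RtoC 0) -> (-1 <= e <= 1)%Z ->
  Csum (fun k => f (Z.of_nat k - Z.of_nat (S n) + e)%Z) (S (2 * S n)) =
  Csum (fun k => f (Z.of_nat k - Z.of_nat n)%Z) (S (2 * n)).
Proof.
  intros Hf He.
  replace (S (2 * S n)) with (S (S (S (2 * n)))) by lia.
  assert (Hc : e = (-1)%Z \/ e = 0%Z \/ e = 1%Z) by lia.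
  destruct Hc as [-> | [-> | ->]].
  - rewrite Csum_first, Csum_first, (Hf (_ + -1)%Z), (Hf (_ + -1)%Z) by lia.
    rewrite !Cplus_0_l. apply Csum_ext; intros; f_equal; lia.
  - rewrite Csum_first, (Hf (_ + 0)%Z) by lia.
    rewrite Cplus_0_l.
    change (Csum ?g (S ?k)) with (Csum g k + g k)%C at 1.
    cbv beta. rewrite (Hf (_ + 0)%Z) by lia. rewrite Cplus_0_r.
    apply Csum_ext; intros; f_equal; lia.
  - change (Csum ?g (S (S ?k))) with (Csum g k + g k + g (S k))%C.
    cbv beta. rewrite (Hf (Z.of_nat (S (S (2 * n))) - _ + 1)%Z) by lia.
    rewrite (Hf (Z.of_nat (S (2 * n)) - _ + 1)%Z) by lia.
    rewrite !Cplus_0_r. apply Csum_ext; intros; f_equal; lia.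
Qed.

Lemma tri_sum n A B D :
  ((A + B + D) ^ n)%C =
  Csum (fun k => tri n (Z.of_nat k - Z.of_nat n) A B D) (S (2 * n)).
Proof.
  induction n as [|n IH]; [simpl; ring|].
  rewrite Cpow_S, IH.
  assert (Hs : forall m, (Z.of_nat n < Z.abs m)%Z -> tri n m A B D = RtoC 0)
    by (intros; now apply tri_support).
  rewrite (Csum_ext (fun k => tri (S n) _ A B D) (fun k => (A * tri n (Z.of_nat k - Z.of_nat (S
      n) + -1) A B D + B * tri n (Z.of_nat k - Z.of_nat (S n) + 0) A B D + D * tri n (Z.of_nat k
      - Z.of_nat (S n) + 1) A B D)%C)).
  2:{ intros k _. cbn [tri]. now rewrite Z.add_0_r. }
  rewrite !Csum_plus, !Csum_scal.
  rewrite !(Csum_window (fun m => tri n m A B D) n) by (easy || lia).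
  ring.
Qed.

Lemma tri_opp n m A B D : tri n (- m) A B D = tri n m D B A.
Proof.
  revert m; induction n as [|n IH]; intros m; cbn [tri].
  - destruct (Z.eqb_spec (- m) 0), (Z.eqb_spec m 0); lia || easy.
  - rewrite IH. replace (- m - 1)%Z with (- (m + 1))%Z by lia.
    replace (- m + 1)%Z with (- (m - 1))%Z by lia. rewrite !IH. ring.
Qed.

(** The weight of [h ^ m] when [A], [B], [D] are multiplied by [p], [l], [q]
    with [l ^ 2 = p q].  The last exponent is a truncated difference, which is
    harmless because [tri n m] vanishes when [n < |m|]. *)
Definition null_weight (n : nat) (m : Z) (p l q : C) : C :=
  (p ^ (Z.to_nat m) * q ^ (Z.to_nat (- m)) * l ^ (n - Z.abs_nat m))%C.

(** For [l <> 0] this is the substitution [h := (p / l) h].  Induction on [n]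
    covers [l = 0] as well, which occurs for null vectors without vertical
    component. *)
Lemma tri_scale n m p l q A B D :
  (l * l)%C = (p * q)%C ->
  tri n m (p * A)%C (l * B)%C (q * D)%C =
  (null_weight n m p l q * tri n m A B D)%C.
Proof.
  intros Hl. revert m; induction n as [|n IH]; intros m.
  - cbn [tri]. destruct (Z.eqb_spec m 0) as [->|]; unfold null_weight; simpl; ring.
  - cbn [tri]. rewrite !IH.
    assert (H1 : (p * (null_weight n (m - 1) p l q * tri n (m - 1) A B D))%C =
                 (null_weight (S n) m p l q * tri n (m - 1) A B D)%C).
    { destruct (Z_lt_ge_dec (Z.of_nat n) (Z.abs (m - 1))) as [Hs|Hs].
      { rewrite tri_support by easy. ring. }
      rewrite Cmult_assoc. f_equal. unfold null_weight.
      destruct (Z_le_gt_dec 1 m) as [Hm|Hm].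
      - replace (Z.to_nat (- (m - 1))) with O by lia.
        replace (Z.to_nat (- m)) with O by lia.
        replace (Z.to_nat m) with (S (Z.to_nat (m - 1))) by lia.
        replace (S n - Z.abs_nat m)%nat with (n - Z.abs_nat (m - 1))%nat by lia.
        rewrite Cpow_S; ring.
      - replace (Z.to_nat (m - 1)) with O by lia.
        replace (Z.to_nat m) with O by lia.
        replace (Z.to_nat (- (m - 1))) with (S (Z.to_nat (- m))) by lia.
        replace (S n - Z.abs_nat m)%nat with (S (S (n - Z.abs_nat (m - 1))))%nat by lia.
        rewrite !Cpow_S.
        transitivity (p * q * (q ^ (Z.to_nat (- m)) * l ^ (n - Z.abs_nat (m - 1))))%C; [simpl;
            ring|].
        rewrite <- Hl; simpl; ring. }
    assert (H2 : (l * (null_weight n m p l q * tri n m A B D))%C =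
                 (null_weight (S n) m p l q * tri n m A B D)%C).
    { destruct (Z_lt_ge_dec (Z.of_nat n) (Z.abs m)) as [Hs|Hs].
      { rewrite tri_support by easy. ring. }
      rewrite Cmult_assoc. f_equal. unfold null_weight.
      replace (S n - Z.abs_nat m)%nat with (S (n - Z.abs_nat m))%nat by lia.
      rewrite Cpow_S; ring. }
    assert (H3 : (q * (null_weight n (m + 1) p l q * tri n (m + 1) A B D))%C =
                 (null_weight (S n) m p l q * tri n (m + 1) A B D)%C).
    { destruct (Z_lt_ge_dec (Z.of_nat n) (Z.abs (m + 1))) as [Hs|Hs].
      { rewrite tri_support by easy. ring. }
      rewrite Cmult_assoc. f_equal. unfold null_weight.
      destruct (Z_le_gt_dec m (-1)) as [Hm|Hm].
      - replace (Z.to_nat (m + 1)) with O by lia.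
        replace (Z.to_nat m) with O by lia.
        replace (Z.to_nat (- m)) with (S (Z.to_nat (- (m + 1)))) by lia.
        replace (S n - Z.abs_nat m)%nat with (n - Z.abs_nat (m + 1))%nat by lia.
        rewrite Cpow_S; ring.
      - replace (Z.to_nat (- (m + 1))) with O by lia.
        replace (Z.to_nat (- m)) with O by lia.
        replace (Z.to_nat (m + 1)) with (S (Z.to_nat m)) by lia.
        replace (S n - Z.abs_nat m)%nat with (S (S (n - Z.abs_nat (m + 1))))%nat by lia.
        rewrite !Cpow_S.
        transitivity (p * q * (p ^ (Z.to_nat m) * l ^ (n - Z.abs_nat (m + 1))))%C; [simpl; ring|].
        rewrite <- Hl; simpl; ring. }
    transitivity (A * (p * (null_weight n (m - 1) p l q * tri n (m - 1) A B D)) + B * (l *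
        (null_weight n m p l q * tri n m A B D)) + D * (q * (null_weight n (m + 1) p l q * tri n
        (m + 1) A B D)))%C.
    { ring. }
    rewrite H1, H2, H3; ring.
Qed.

(** The substitution [h := p h], written without division so that [p = 0] is
    allowed. *)
Lemma tri_transfer n m p A B D :
  (p ^ (Z.to_nat (- m)) * tri n m (p * A) B D)%C =
  (p ^ (Z.to_nat m) * tri n m A B (p * D))%C.
Proof.
  revert m; induction n as [|n IH]; intros m; cbn [tri].
  - destruct (Z.eqb_spec m 0) as [->|]; simpl; ring.
  - pose proof (IH (m - 1)%Z) as H1. pose proof (IH m) as H2. pose proof (IH (m + 1)%Z) as H3.
    destruct (Z_lt_ge_dec 0 m) as [Hm|Hm]; [|destruct (Z.eq_dec m 0) as [->|Hm0]].
    + replace (Z.to_nat (- m)) with O in * by lia.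
      replace (Z.to_nat (- (m - 1))) with O in * by lia.
      replace (Z.to_nat (- (m + 1))) with O in * by lia.
      replace (Z.to_nat (m + 1)) with (S (Z.to_nat m)) in * by lia.
      replace (Z.to_nat m) with (S (Z.to_nat (m - 1))) in * by lia.
      rewrite !Cpow_S in *. simpl (p ^ 0)%C in *. rewrite !Cmult_1_l in *.
      rewrite H1, H2, H3; ring.
    + simpl in *. rewrite !Cmult_1_l, ?Cmult_1_r in *.
      transitivity (A * (p * tri n (-1) (p * A) B D) + B * tri n 0 (p * A) B D + D * tri n 1 (p
          * A) B D)%C; [ring|].
      rewrite H1, H2, H3; ring.
    + replace (Z.to_nat m) with O in * by lia.
      replace (Z.to_nat (m - 1)) with O in * by lia.
      replace (Z.to_nat (m + 1)) with O in * by lia.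
      replace (Z.to_nat (- (m - 1))) with (S (Z.to_nat (- m))) in * by lia.
      replace (Z.to_nat (- m)) with (S (Z.to_nat (- (m + 1)))) in * by lia.
      rewrite !Cpow_S in *. simpl (p ^ 0)%C in *. rewrite !Cmult_1_l in *.
      rewrite <- H1, <- H2, <- H3; ring.
Qed.

(** * Derivatives of [(u ^ 2 - 1) ^ n] *)

(** The coefficient of [h ^ (n + m)] in [((u + h) ^ 2 - 1) ^ n], that is, up to
    a factorial, the derivative of order [n + m] of [(u ^ 2 - 1) ^ n]. *)
Definition rodrigues (n : nat) (m : Z) (u : R) : R := triR n m 1 (2 * u) (u ^ 2 - 1).

Lemma rodrigues_S n m u :
  rodrigues (S n) m u = rodrigues n (m - 1) u + 2 * u * rodrigues n m u + (u ^ 2 - 1) *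
      rodrigues n (m + 1) u.
Proof. unfold rodrigues; cbn [triR]; ring. Qed.

(** Indexing by the distance [m] to the middle derivative, of either sign,
    lets the recursion of [tri] prove this for all orders at once. *)
Lemma rodrigues_derive n m u :
  is_derive (rodrigues n m) u (IZR (Z.of_nat n + m + 1) * rodrigues n (m + 1) u).
Proof.
  revert m u; induction n as [|n IH]; intros m u.
  - unfold rodrigues; cbn [triR].
    destruct (Z.eqb_spec m 0) as [->|Hm];
      (eapply is_derive_ext; [intros; reflexivity|]);
      [|destruct (Z.eqb_spec (m + 1) 0) as [H|H]];
      rewrite ?H; try replace (Z.of_nat 0 + m + 1)%Z with 0%Z by lia;
      simpl; rewrite ?Rmult_0_l, ?Rmult_0_r; apply (is_derive_const (V := R_NormedModule)).
  - remember (Z.of_nat (S n)) as k eqn:Hk.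
    apply (is_derive_ext (fun u => rodrigues n (m - 1) u + 2 * u * rodrigues n m u
        + (u ^ 2 - 1) * rodrigues n (m + 1) u)).
    { intros v. symmetry; apply rodrigues_S. }
    evar_last.
    + apply (is_derive_plus (V := R_NormedModule)); [apply (is_derive_plus (V :=
        R_NormedModule))|].
      * apply IH.
      * apply (is_derive_mult (fun u => 2 * u) (rodrigues n m)); [|apply IH|intros; apply
          Rmult_comm].
        auto_derive; [easy|reflexivity].
      * apply (is_derive_mult (fun u => u ^ 2 - 1) (rodrigues n (m + 1)));
          [|apply IH|intros; apply Rmult_comm].
        auto_derive; [easy|reflexivity].
    + unfold plus, mult; simpl.
      replace (m - 1 + 1)%Z with m by lia.
      rewrite rodrigues_S, Hk, Nat2Z.inj_succ.
      replace (m + 1 - 1)%Z with m by lia.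
      rewrite <- Z.add_1_l, !plus_IZR, minus_IZR. ring.
Qed.

Lemma triR_bottom n A B D : triR n (- Z.of_nat n) A B D = D ^ n.
Proof.
  induction n as [|n IH]; [easy|].
  rewrite Nat2Z.inj_succ. cbn [triR].
  rewrite (triR_support n (_ - 1)), (triR_support n (- Z.succ (Z.of_nat n))) by lia.
  replace (- Z.succ (Z.of_nat n) + 1)%Z with (- Z.of_nat n)%Z by lia.
  rewrite IH; simpl; ring.
Qed.

Lemma triR_top n A B D : triR n (Z.of_nat n) A B D = A ^ n.
Proof.
  induction n as [|n IH]; [easy|].
  rewrite Nat2Z.inj_succ. cbn [triR].
  rewrite (triR_support n (_ + 1)), (triR_support n (Z.succ (Z.of_nat n))) by lia.
  replace (Z.succ (Z.of_nat n) - 1)%Z with (Z.of_nat n)%Z by lia.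
  rewrite IH; simpl; ring.
Qed.

Lemma Derive_n_rodrigues n j u :
  Derive_n (fun v => (v ^ 2 - 1) ^ n) j u =
  INR (fact j) * rodrigues n (Z.of_nat j - Z.of_nat n) u.
Proof.
  revert u; induction j as [|j IH]; intros u.
  - simpl Derive_n. replace (Z.of_nat 0 - Z.of_nat n)%Z with (- Z.of_nat n)%Z by lia.
    unfold rodrigues; rewrite triR_bottom; simpl; ring.
  - simpl Derive_n. rewrite (Derive_ext _ _ _ IH).
    apply is_derive_unique.
    evar_last.
    + apply is_derive_scal, rodrigues_derive.
    + cbv beta.
      replace (Z.of_nat n + (Z.of_nat j - Z.of_nat n) + 1)%Z with (Z.of_nat (S j)) by lia.
      replace (Z.of_nat j - Z.of_nat n + 1)%Z with (Z.of_nat (S j) - Z.of_nat n)%Z by lia.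
      rewrite <- INR_IZR_INZ.
      replace (fact (S j)) with (S j * fact j)%nat by reflexivity.
      rewrite mult_INR. ring.
Qed.

Lemma Derive_n_legendre n k u :
  Derive_n (legendre n) k u =
  INR (fact (n + k)) / (2 ^ n * INR (fact n)) * rodrigues n (Z.of_nat k) u.
Proof.
  unfold legendre.
  rewrite (Derive_n_scal_l (Derive_n (fun v => (v ^ 2 - 1) ^ n) n)).
  rewrite Derive_n_comp, Derive_n_rodrigues.
  rewrite (Nat.add_comm k n).
  replace (Z.of_nat (n + k) - Z.of_nat n)%Z with (Z.of_nat k) by lia.
  unfold Rdiv; ring.
Qed.

(** The symmetry [h := (u ^ 2 - 1) / h] exchanges the derivatives of order
    [n + k] and [n - k]; it is what relates the functions [P_n^k] and
    [P_n^(-k)]. *)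
Lemma rodrigues_opp n k u :
  rodrigues n (- Z.of_nat k) u = (u ^ 2 - 1) ^ k * rodrigues n (Z.of_nat k) u.
Proof.
  unfold rodrigues. apply RtoC_inj.
  rewrite RtoC_mult, <- !tri_RtoC, tri_opp, RtoC_pow.
  pose proof (tri_transfer n (Z.of_nat k) (RtoC (u ^ 2 - 1)) (RtoC 1) (RtoC (2 * u)) (RtoC 1))
      as H.
  replace (Z.to_nat (- Z.of_nat k)) with O in H by lia.
  rewrite Nat2Z.id in H; simpl (_ ^ 0)%C in H; rewrite Cmult_1_l, !Cmult_1_r in H. exact H.
Qed.

(** * Solid harmonics as trinomial coefficients *)

Definition dot3 (x y : R3) : R :=
  crd1 x * crd1 y + crd2 x * crd2 y + crd3 x * crd3 y.

Lemma R3_ext (x y : R3) : crd1 x = crd1 y -> crd2 x = crd2 y -> crd3 x = crd3 y -> x = y.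
Proof. destruct x as [[? ?] ?], y as [[? ?] ?]; unfold crd1, crd2, crd3; simpl; congruence. Qed.

Ltac R3_ring :=
  apply R3_ext; unfold add3, sub3, scal3, zero3, crd1, crd2, crd3; simpl; ring.

Lemma norm3_sqr x : norm3 x ^ 2 = crd1 x ^ 2 + crd2 x ^ 2 + crd3 x ^ 2.
Proof. unfold norm3; rewrite pow2_sqrt; nra. Qed.

Lemma norm3_pos x : 0 <= norm3 x.
Proof. apply sqrt_pos. Qed.

Lemma norm3_scal a x : norm3 (scal3 a x) = Rabs a * norm3 x.
Proof.
  unfold norm3. rewrite <- sqrt_Rsqr_abs, <- sqrt_mult_alt by apply Rle_0_sqr.
  f_equal. unfold scal3, crd1, crd2, crd3, Rsqr; simpl; ring.
Qed.

Lemma norm3_eq0 x : norm3 x = 0 -> x = zero3.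
Proof.
  intros H. pose proof (norm3_sqr x) as H2. rewrite H in H2.
  apply R3_ext; change (crd1 zero3) with 0; change (crd2 zero3) with 0;
    change (crd3 zero3) with 0; nra.
Qed.

Lemma norm3_dot x y : dot3 x y <= norm3 x * norm3 y.
Proof.
  destruct (Rle_dec (dot3 x y) 0) as [H|H].
  - pose proof (norm3_pos x); pose proof (norm3_pos y); nra.
  - apply Rsqr_incr_0_var; [|apply Rmult_le_pos; apply norm3_pos].
    rewrite !Rsqr_pow2, Rpow_mult_distr, !norm3_sqr. unfold dot3.
    assert (0 <= (crd1 x * crd2 y - crd2 x * crd1 y) ^ 2) by apply pow2_ge_0.
    assert (0 <= (crd1 x * crd3 y - crd3 x * crd1 y) ^ 2) by apply pow2_ge_0.
    assert (0 <= (crd3 x * crd2 y - crd2 x * crd3 y) ^ 2) by apply pow2_ge_0.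
    nra.
Qed.

Lemma norm3_triangle x y : norm3 (add3 x y) <= norm3 x + norm3 y.
Proof.
  apply Rsqr_incr_0_var; [|apply Rplus_le_le_0_compat; apply norm3_pos].
  rewrite !Rsqr_pow2. pose proof (norm3_dot x y) as H.
  pose proof (norm3_sqr x); pose proof (norm3_sqr y).
  rewrite norm3_sqr. unfold dot3 in H.
  change (crd1 (add3 x y)) with (crd1 x + crd1 y).
  change (crd2 (add3 x y)) with (crd2 x + crd2 y).
  change (crd3 (add3 x y)) with (crd3 x + crd3 y). nra.
Qed.

Lemma norm3_unit x : norm3 x <> 0 -> norm3 (unit3 x) = 1.
Proof.
  intros H. unfold unit3. rewrite norm3_scal, Rabs_inv, Rabs_pos_eq by apply norm3_pos.
  now field.
Qed.

Lemma sphere_point_norm th ph : norm3 (sphere_point th ph) = 1.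
Proof.
  unfold norm3, sphere_point, crd1, crd2, crd3; cbn [fst snd].
  etransitivity; [|apply sqrt_1]. f_equal.
  pose proof (sin2_cos2 th). pose proof (sin2_cos2 ph). unfold Rsqr in *.
  transitivity (sin th * sin th * (sin ph * sin ph + cos ph * cos ph) + cos th * cos th); [ring|].
  rewrite H0; lra.
Qed.

Definition planar (x : R3) : C := (crd1 x, crd2 x).

(** The classical [r ^ n P_n^m (cos theta) e ^ (i m phi)] without its
    normalising factor.  As the coefficient of [h ^ m] in
    [(w h + 2 z - conj w / h) ^ n], with [w = x1 + i x2] and [z = x3], it is
    visibly a polynomial, and the base is a null linear form in [x]. *)
Definition hpoly (n : nat) (m : Z) (x : R3) : C :=
  tri n m (planar x) (RtoC (2 * crd3 x)) (- Cconj (planar x))%C.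

Definition sph_norm (n k : nat) : R :=
  sqrt ((2 * INR n + 1) / (4 * PI) * (INR (fact (n - k)) / INR (fact (n + k)))).

Definition solid_const (n : nat) (m : Z) : R :=
  let k := Z.abs_nat m in
  (-1) ^ k * sph_norm n k * (INR (fact (n + k)) / (2 ^ n * INR (fact n))).

(** Homogeneity: scaling [w] and [z] by [a] scales the base of the power. *)
Lemma hpoly_scal n m a x : (Z.abs m <= Z.of_nat n)%Z ->
  hpoly n m (scal3 a x) = (RtoC (a ^ n) * hpoly n m x)%C.
Proof.
  intros Hm. unfold hpoly.
  replace (planar (scal3 a x)) with (RtoC a * planar x)%C.
  2:{ apply C_ext; unfold planar, scal3, crd1, crd2; simpl; ring. }
  replace (RtoC (2 * crd3 (scal3 a x))) with (RtoC a * RtoC (2 * crd3 x))%C.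
  2:{ rewrite <- RtoC_mult. f_equal. unfold scal3, crd3; simpl; ring. }
  replace (- Cconj (RtoC a * planar x))%C with (RtoC a * - Cconj (planar x))%C.
  2:{ apply C_ext; simpl; ring. }
  rewrite tri_scale by easy. f_equal.
  unfold null_weight. rewrite <- !Cpow_add_r, RtoC_pow. f_equal. lia.
Qed.

Lemma cis_plus a b : cis (a + b) = (cis a * cis b)%C.
Proof. apply C_ext; simpl; rewrite ?cos_plus, ?sin_plus; ring. Qed.

Lemma cis_pow k a : cis (INR k * a) = (cis a ^ k)%C.
Proof.
  induction k as [|k IH].
  - simpl. rewrite Rmult_0_l. unfold cis. now rewrite cos_0, sin_0.
  - rewrite S_INR, Rmult_plus_distr_r, Rmult_1_l, cis_plus, IH, Cpow_S. ring.
Qed.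

Lemma cis_opp a : cis (- a) = Cconj (cis a).
Proof. unfold cis. now rewrite cos_neg, sin_neg. Qed.

(** On the vertical axis both sides vanish, whatever the azimuth. *)
Lemma cis_azimuth x :
  (RtoC (sqrt (crd1 x ^ 2 + crd2 x ^ 2)) * cis (azimuth x))%C = planar x.
Proof.
  unfold azimuth, planar. set (a := crd1 x). set (b := crd2 x).
  set (rho := sqrt (a ^ 2 + b ^ 2)).
  assert (Hr2 : rho ^ 2 = a ^ 2 + b ^ 2) by (unfold rho; rewrite pow2_sqrt; nra).
  assert (Hr : 0 <= rho) by apply sqrt_pos.
  destruct (Req_dec rho 0) as [H0|H0].
  - rewrite H0 in *. assert (Ha : a = 0) by nra. assert (Hb : b = 0) by nra.
    rewrite Cmult_0_l, Ha, Hb; easy.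
  - assert (Hc : cos (acos (a / rho)) = a / rho).
    { apply cos_acos. split.
      - apply Rmult_le_reg_r with rho; [lra|]. replace (a / rho * rho) with a by (field; lra).
          nra.
      - apply Rmult_le_reg_r with rho; [lra|]. replace (a / rho * rho) with a by (field; lra).
          nra. }
    assert (Hs : sin (acos (a / rho)) = Rabs b / rho).
    { rewrite sin_acos.
      - assert (Hb2 : Rabs b * Rabs b = b * b).
        { rewrite <- Rabs_mult. apply Rabs_pos_eq; nra. }
        assert (Heq : Rabs b / rho * (Rabs b / rho) = 1 - (a / rho)²).
        { unfold Rsqr.
          replace (Rabs b / rho * (Rabs b / rho)) with ((Rabs b * Rabs b) / rho ^ 2) by (field;
              lra).
          rewrite Hb2.
          replace (b * b) with (rho ^ 2 - a * a) by nra. field; lra. }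
        apply sqrt_lem_1; [|  |exact Heq].
        + rewrite <- Heq. apply Rle_0_sqr.
        + apply Rmult_le_pos; [apply Rabs_pos|left; apply Rinv_0_lt_compat; lra].
      - rewrite <- Hc. apply COS_bound. }
    apply C_ext; simpl; destruct (Rle_dec 0 b) as [Hb|Hb];
      rewrite ?cos_neg, ?sin_neg, Hc, Hs; ring_simplify.
    + field; easy.
    + field; easy.
    + rewrite Rabs_pos_eq by lra. field; easy.
    + rewrite Rabs_left by lra. field; easy.
Qed.

Lemma hpoly_nonneg n k x : norm3 x = 1 ->
  hpoly n (Z.of_nat k) x = (planar x ^ k * RtoC (rodrigues n (Z.of_nat k) (crd3 x)))%C.
Proof.
  intros Hx. unfold hpoly, rodrigues.
  pose proof (tri_transfer n (Z.of_nat k) (planar x) (RtoC 1) (RtoC (2 * crd3 x))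
    (- Cconj (planar x))%C) as H.
  replace (Z.to_nat (- Z.of_nat k)) with O in H by lia.
  rewrite Nat2Z.id in H. simpl (_ ^ 0)%C in H. rewrite Cmult_1_l, Cmult_1_r in H.
  rewrite H, <- tri_RtoC. do 3 f_equal.
  pose proof (norm3_sqr x) as H2. rewrite Hx in H2.
  apply C_ext; simpl; nra.
Qed.

Lemma hpoly_neg n k x : norm3 x = 1 ->
  hpoly n (- Z.of_nat k) x =
  (RtoC ((-1) ^ k) * (Cconj (planar x) ^ k * RtoC (rodrigues n (Z.of_nat k) (crd3 x))))%C.
Proof.
  intros Hx. unfold hpoly, rodrigues. rewrite tri_opp.
  pose proof (tri_transfer n (Z.of_nat k) (- Cconj (planar x))%C (RtoC 1) (RtoC (2 * crd3 x))
    (planar x)) as H.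
  replace (Z.to_nat (- Z.of_nat k)) with O in H by lia.
  rewrite Nat2Z.id in H. simpl (_ ^ 0)%C in H. rewrite Cmult_1_l, Cmult_1_r in H.
  rewrite H, <- tri_RtoC, Cmult_assoc, RtoC_pow, <- Cpow_mult_l. f_equal.
  - f_equal. apply C_ext; simpl; ring.
  - f_equal. pose proof (norm3_sqr x) as H2. rewrite Hx in H2.
    apply C_ext; simpl; nra.
Qed.

Lemma INR_fact_pos n : 0 < INR (fact n).
Proof. apply lt_0_INR, lt_O_fact. Qed.

Lemma sph_norm_sqr n k : sph_norm n k ^ 2 =
  (2 * INR n + 1) / (4 * PI) * (INR (fact (n - k)) / INR (fact (n + k))).
Proof.
  unfold sph_norm. rewrite pow2_sqrt; [easy|].
  pose proof (INR_fact_pos (n - k)); pose proof (INR_fact_pos (n + k)).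
  pose proof PI_RGT_0; pose proof (pos_INR n).
  apply Rmult_le_pos; apply Rmult_le_pos; try lra; left; apply Rinv_0_lt_compat; lra.
Qed.

Lemma sph_norm_pos n k : 0 < sph_norm n k.
Proof.
  apply sqrt_lt_R0.
  pose proof (INR_fact_pos (n - k)); pose proof (INR_fact_pos (n + k)).
  pose proof PI_RGT_0; pose proof (pos_INR n).
  apply Rmult_lt_0_compat; apply Rmult_lt_0_compat; try lra; apply Rinv_0_lt_compat; lra.
Qed.

Lemma assoc_legendre_k n k u :
  assoc_legendre_nonneg n k u =
  (-1) ^ k * sqrt (1 - u ^ 2) ^ k * (INR (fact (n + k)) / (2 ^ n * INR (fact n))
    * rodrigues n (Z.of_nat k) u).
Proof. unfold assoc_legendre_nonneg. now rewrite Derive_n_legendre. Qed.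

(** The factor [sin theta ^ |m|] of [P_n^m] combines with [e ^ (i m phi)] to a
    power of [w] or of its conjugate; Rodrigues' formula gives the rest.  For
    [m < 0] the conventional factor of [P_n^m] turns the normalisation into
    that of [-m]. *)
Lemma sph_harm_hpoly n m x : norm3 x = 1 -> (Z.abs m <= Z.of_nat n)%Z ->
  sph_harm n m x = (RtoC (solid_const n m) * hpoly n m x)%C.
Proof.
  intros Hx Hm.
  pose proof (norm3_sqr x) as H2. rewrite Hx in H2.
  assert (Hu : -1 <= crd3 x <= 1) by nra.
  set (rho := sqrt (crd1 x ^ 2 + crd2 x ^ 2)).
  assert (Hrho : sqrt (1 - crd3 x ^ 2) = rho) by (unfold rho; f_equal; lra).
  pose proof (cis_azimuth x) as Hw. fold rho in Hw.
  unfold sph_harm, sph_harm_angles, polar_angle. rewrite cos_acos by easy.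
  unfold assoc_legendre, solid_const.
  destruct (Z_le_gt_dec 0 m) as [Hp|Hp].
  - rewrite (proj2 (Z.leb_le 0 m) Hp).
    destruct (Z_of_nat_complete m Hp) as [k ->].
    rewrite Zabs2Nat.id, assoc_legendre_k, Hrho.
    replace (Z.to_nat (Z.of_nat n - Z.of_nat k)) with (n - k)%nat by lia.
    replace (Z.to_nat (Z.of_nat n + Z.of_nat k)) with (n + k)%nat by lia.
    fold (sph_norm n k).
    rewrite hpoly_nonneg, <- INR_IZR_INZ, cis_pow by easy.
    rewrite <- Hw, Cpow_mult_l, <- RtoC_pow, !RtoC_mult. ring.
  - rewrite (proj2 (Z.leb_gt 0 m)) by lia.
    destruct (Z_of_nat_complete (- m)) as [k Hk]; [lia|].
    assert (Em : m = (- Z.of_nat k)%Z) by lia. subst m. clear Hk.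
    replace (Z.abs_nat (- Z.of_nat k)) with k by lia.
    rewrite assoc_legendre_k, Hrho.
    replace (Z.to_nat (Z.of_nat n - - Z.of_nat k)) with (n + k)%nat by lia.
    replace (Z.to_nat (Z.of_nat n + - Z.of_nat k)) with (n - k)%nat by lia.
    rewrite hpoly_neg, opp_IZR, Ropp_mult_distr_l_reverse, <- INR_IZR_INZ, cis_opp, cis_pow by
        easy.
    rewrite <- Hw, Cmult_conj, Cpow_mult_l, Cpow_conj.
    replace (Cconj (RtoC rho)) with (RtoC rho) by (apply C_ext; simpl; ring).
    rewrite <- RtoC_pow.
    assert (Hs : sqrt ((2 * INR n + 1) / (4 * PI) * (INR (fact (n + k)) / INR (fact (n - k)))) *
       (INR (fact (n - k)) / INR (fact (n + k))) = sph_norm n k).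
    { pose proof (INR_fact_pos (n - k)); pose proof (INR_fact_pos (n + k)).
      pose proof PI_RGT_0; pose proof (pos_INR n).
      unfold sph_norm.
      rewrite <- (Rabs_pos_eq (INR (fact (n - k)) / INR (fact (n + k)))) at 1.
      2:{ apply Rmult_le_pos; [lra|]. left; apply Rinv_0_lt_compat; lra. }
      rewrite <- sqrt_Rsqr_abs, <- sqrt_mult_alt.
      2:{ apply Rmult_le_pos; apply Rmult_le_pos; try lra; left; apply Rinv_0_lt_compat; lra. }
      f_equal. unfold Rsqr. field. lra. }
    rewrite <- Hs.
    rewrite !RtoC_mult. ring.
Qed.

Lemma sph_harm_0 x : sph_harm 0 0 x = (RtoC (solid_const 0 0) * hpoly 0 0 x)%C.
Proof.
  unfold sph_harm, sph_harm_angles, solid_const, hpoly, sph_norm, assoc_legendre,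
    assoc_legendre_nonneg, legendre. simpl.
  rewrite Rmult_0_l. unfold cis. rewrite cos_0, sin_0.
  apply C_ext; simpl; field.
Qed.

Lemma unit3_scal x : norm3 x <> 0 -> x = scal3 (norm3 x) (unit3 x).
Proof.
  intros H. unfold unit3, scal3. apply R3_ext; unfold crd1, crd2, crd3; simpl; field; easy.
Qed.

(** At the origin the unit vector is the placeholder 0, but for [n > 0] both
    sides vanish there and for [n = 0] both are constant. *)
Lemma solid_R_hpoly n m x : (Z.abs m <= Z.of_nat n)%Z ->
  solid_R n m x = (RtoC (solid_const n m) * hpoly n m x)%C.
Proof.
  intros Hm. unfold solid_R. destruct (Req_dec (norm3 x) 0) as [H0|H0].
  - destruct n as [|n].
    + replace m with 0%Z by lia. rewrite sph_harm_0. simpl pow. apply Cmult_1_l.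
    + rewrite H0, pow_i, Cmult_0_l by lia. rewrite (norm3_eq0 x H0).
      replace zero3 with (scal3 0 zero3).
      2:{ unfold scal3, zero3; R3_ring. }
      rewrite hpoly_scal, pow_i by (easy || lia). ring.
  - rewrite sph_harm_hpoly by (easy || now apply norm3_unit).
    replace (hpoly n m x) with (hpoly n m (scal3 (norm3 x) (unit3 x))) by now rewrite <-
        unit3_scal.
    rewrite hpoly_scal by easy. ring.
Qed.

Lemma solid_I_hpoly n m x : (Z.abs m <= Z.of_nat n)%Z -> norm3 x <> 0 ->
  solid_I n m x = (RtoC (solid_const n m / norm3 x ^ (2 * n + 1)) * hpoly n m x)%C.
Proof.
  intros Hm H0. unfold solid_I.
  rewrite sph_harm_hpoly by (easy || now apply norm3_unit).
  replace (hpoly n m x) with (hpoly n m (scal3 (norm3 x) (unit3 x))) by now rewrite <- unit3_scal.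
  rewrite hpoly_scal by easy.
  rewrite !Cmult_assoc, <- !RtoC_mult. f_equal. f_equal.
  replace (2 * n + 1)%nat with (n + (n + 1))%nat by lia.
  rewrite (pow_add _ n (n + 1)). field. split; now apply pow_nonzero.
Qed.

Lemma solid_const_neq0 n m : solid_const n m <> 0.
Proof.
  unfold solid_const. pose proof (sph_norm_pos n (Z.abs_nat m)).
  pose proof (INR_fact_pos (n + Z.abs_nat m)). pose proof (INR_fact_pos n).
  pose proof (pow_lt 2 n ltac:(lra)).
  assert ((-1) ^ Z.abs_nat m <> 0) by (apply pow_nonzero; lra).
  apply Rmult_integral_contrapositive_currified;
    [apply Rmult_integral_contrapositive_currified; lra|].
  apply Rmult_integral_contrapositive_currified; [lra|].
  apply Rinv_neq_0_compat. nra.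
Qed.

(** * Factorisation over the two angles *)

(** The dependence of [hpoly n m] on the polar angle, after [e ^ (i m phi)] has
    been split off. *)
Definition polar_part (n : nat) (m : Z) (th : R) : R :=
  triR n m (sin th) (2 * cos th) (- sin th).

Lemma cis_Z m a :
  (cis a ^ (Z.to_nat m) * cis (- a) ^ (Z.to_nat (- m)))%C = cis (IZR m * a).
Proof.
  rewrite <- !cis_pow, <- cis_plus. f_equal.
  destruct (Z_le_gt_dec 0 m) as [H|H].
  - replace (Z.to_nat (- m)) with O by lia.
    rewrite INR_IZR_INZ, Z2Nat.id by easy. simpl; ring.
  - replace (Z.to_nat m) with O by lia.
    rewrite (INR_IZR_INZ (Z.to_nat (- m))), Z2Nat.id by lia. rewrite opp_IZR; simpl; ring.
Qed.

Lemma hpoly_sphere n m th ph :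
  hpoly n m (sphere_point th ph) = (cis (IZR m * ph) * RtoC (polar_part n m th))%C.
Proof.
  unfold hpoly, polar_part. rewrite <- tri_RtoC.
  replace (planar (sphere_point th ph)) with (cis ph * RtoC (sin th))%C.
  2:{ apply C_ext; unfold sphere_point, planar, crd1, crd2; simpl; ring. }
  replace (RtoC (2 * crd3 (sphere_point th ph))) with (RtoC 1 * RtoC (2 * cos th))%C.
  2:{ rewrite Cmult_1_l. easy. }
  replace (- Cconj (cis ph * RtoC (sin th)))%C with
    (cis (- ph) * RtoC (- sin th))%C.
  2:{ apply C_ext; simpl; rewrite ?cos_neg, ?sin_neg; ring. }
  rewrite tri_scale.
  - unfold null_weight. rewrite Cpow_1_l, Cmult_1_r, cis_Z. easy.
  - rewrite <- cis_plus, Rplus_opp_r. unfold cis. rewrite cos_0, sin_0.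
    apply C_ext; simpl; ring.
Qed.

Lemma planar_sphere_0 th : planar (sphere_point th 0) = RtoC (sin th).
Proof.
  unfold planar, sphere_point, crd1, crd2; simpl. rewrite cos_0, sin_0.
  apply C_ext; simpl; ring.
Qed.

Lemma polar_part_nonneg n k th : polar_part n (Z.of_nat k) th = sin th ^ k * rodrigues n
    (Z.of_nat k) (cos th).
Proof.
  apply RtoC_inj. pose proof (hpoly_sphere n (Z.of_nat k) th 0) as H.
  rewrite hpoly_nonneg, planar_sphere_0, Rmult_0_r in H by apply sphere_point_norm.
  unfold cis in H. rewrite cos_0, sin_0 in H. change (1, 0) with (RtoC 1) in H.
  rewrite Cmult_1_l in H. rewrite <- H, RtoC_mult, RtoC_pow. easy.
Qed.

Lemma polar_part_neg n k th :
  polar_part n (- Z.of_nat k) th = (-1) ^ k * (sin th ^ k * rodrigues n (Z.of_nat k) (cos th)).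
Proof.
  apply RtoC_inj. pose proof (hpoly_sphere n (- Z.of_nat k) th 0) as H.
  rewrite hpoly_neg, planar_sphere_0, Rmult_0_r in H by apply sphere_point_norm.
  unfold cis in H. rewrite cos_0, sin_0 in H. change (1, 0) with (RtoC 1) in H.
  rewrite Cmult_1_l in H. rewrite <- H, !RtoC_mult.
  replace (Cconj (RtoC (sin th))) with (RtoC (sin th)) by (apply C_ext; simpl; ring).
  rewrite !RtoC_pow. easy.
Qed.

Lemma sign_square k : (-1) ^ k * (-1) ^ k = 1.
Proof. rewrite <- Rpow_mult_distr. replace (-1 * -1) with 1 by ring. apply pow1. Qed.

(** The weight [sin ^ (2 |m|)] is absorbed into one of the two factors by the
    symmetry [rodrigues_opp], which leaves a plain product of derivatives. *)
Lemma polar_part_mult n l m th :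
  polar_part n m th * polar_part l m th =
  (-1) ^ Z.abs_nat m *
    (rodrigues n (- Z.of_nat (Z.abs_nat m)) (cos th) *
     rodrigues l (Z.of_nat (Z.abs_nat m)) (cos th)).
Proof.
  set (k := Z.abs_nat m).
  set (X := sin th ^ k * sin th ^ k * rodrigues n (Z.of_nat k) (cos th)
    * rodrigues l (Z.of_nat k) (cos th)).
  transitivity X.
  - unfold X. destruct (Z_le_gt_dec 0 m) as [H|H].
    + replace m with (Z.of_nat k) by lia. rewrite !polar_part_nonneg; ring.
    + replace m with (- Z.of_nat k)%Z by lia. rewrite !polar_part_neg.
      transitivity ((-1) ^ k * (-1) ^ k * X); unfold X; [ring|rewrite sign_square; ring].
  - rewrite rodrigues_opp.
    replace (cos th ^ 2 - 1) with (-1 * (sin th * sin th))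
      by (pose proof (sin2_cos2 th); unfold Rsqr in *; nra).
    rewrite !Rpow_mult_distr.
    transitivity ((-1) ^ k * (-1) ^ k * X); unfold X; [rewrite sign_square; ring|ring].
Qed.

(** ** Integrals in the polar angle *)

Definition polar_integral (n l : nat) (j : Z) : R :=
  RInt (fun th => sin th * (rodrigues n (- j) (cos th) * rodrigues l j (cos th))) 0 PI.

Lemma rodrigues_cos_derive n m th : is_derive (fun t => rodrigues n m (cos t)) th
  (- sin th * (IZR (Z.of_nat n + m + 1) * rodrigues n (m + 1) (cos th))).
Proof.
  apply (is_derive_comp (V := R_NormedModule) (rodrigues n m) cos); [apply rodrigues_derive|].
  apply is_derive_cos.
Qed.

Lemma rodrigues_cos_continuous n m th : continuous (fun t => rodrigues n m (cos t)) th.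
Proof. apply (ex_derive_continuous (V := R_NormedModule)). eexists. apply rodrigues_cos_derive.
    Qed.

Lemma sin_continuous th : continuous sin th.
Proof. apply (ex_derive_continuous (V := R_NormedModule)). eexists. apply is_derive_sin. Qed.

Lemma cos_continuous th : continuous cos th.
Proof. apply (ex_derive_continuous (V := R_NormedModule)). eexists. apply is_derive_cos. Qed.

Lemma polar_integral_correct n l j :
  is_RInt (fun th => sin th * (rodrigues n (- j) (cos th) * rodrigues l j (cos th))) 0 PI
    (polar_integral n l j).
Proof.
  apply (RInt_correct (V := R_CompleteNormedModule)).
  apply (ex_RInt_continuous (V := R_CompleteNormedModule)). intros th _.
  apply continuous_Rmult; [apply sin_continuous|].
  apply continuous_Rmult; apply rodrigues_cos_continuous.
Qed.

Lemma rodrigues_boundary n k u : u ^ 2 = 1 -> (0 < k)%Z -> rodrigues n (- k) u = 0.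
Proof.
  intros Hu Hk. replace k with (Z.of_nat (Z.to_nat k)) by lia.
  rewrite rodrigues_opp, Hu, Rminus_diag, pow_i by lia. ring.
Qed.

(** Integration by parts.  The boundary terms vanish because one of the two
    factors has a negative index and so contains [u ^ 2 - 1]. *)
Lemma polar_integral_step n l j :
  IZR (Z.of_nat l + j) * polar_integral n l j =
  - (IZR (Z.of_nat n - j + 1) * polar_integral n l (j - 1)).
Proof.
  set (F := fun th => rodrigues n (- j) (cos th) * rodrigues l (j - 1) (cos th)).
  assert (HF : forall th, is_derive F th
    (- sin th * (IZR (Z.of_nat n - j + 1) * rodrigues n (- (j - 1)) (cos th)) * rodrigues l (j -
        1) (cos th)
     + rodrigues n (- j) (cos th) * (- sin th * (IZR (Z.of_nat l + j) * rodrigues l j (cos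
         th))))).
  { intros th. evar_last.
    - apply (is_derive_mult (fun t => rodrigues n (- j) (cos t)) (fun t => rodrigues l (j - 1)
        (cos t)));
        [apply rodrigues_cos_derive|apply rodrigues_cos_derive|intros; apply Rmult_comm].
    - unfold plus, mult; cbn [AbelianMonoid.plus Ring.mult].
      replace (Z.of_nat n + - j + 1)%Z with (Z.of_nat n - j + 1)%Z by lia.
      replace (- j + 1)%Z with (- (j - 1))%Z by lia.
      replace (Z.of_nat l + (j - 1) + 1)%Z with (Z.of_nat l + j)%Z by lia.
      replace (j - 1 + 1)%Z with j by lia. reflexivity. }
  assert (Hb : forall th, cos th ^ 2 = 1 -> F th = 0).
  { intros th Hth. unfold F. destruct (Z_lt_ge_dec 0 j) as [Hj|Hj].
    - rewrite (rodrigues_boundary n j) by easy. ring.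
    - replace (j - 1)%Z with (- (1 - j))%Z by lia.
      rewrite (rodrigues_boundary l (1 - j)) by (easy || lia). ring. }
  assert (H0 : is_RInt (fun th =>
    - (IZR (Z.of_nat n - j + 1) * (sin th * (rodrigues n (- (j - 1)) (cos th) * rodrigues l (j -
        1) (cos th)))
     + IZR (Z.of_nat l + j) * (sin th * (rodrigues n (- j) (cos th) * rodrigues l j (cos th)))))
         0 PI 0).
  { eapply is_RInt_ext; [|apply (FTC F _ 0 PI 0 HF)].
    - intros th _. cbv beta. real_eq. ring.
    - intros th. apply continuous_Rplus.
      + apply continuous_Rmult; [|apply rodrigues_cos_continuous].
        apply continuous_Rmult; [apply continuous_Ropp, sin_continuous|].
        apply continuous_Rmult; [apply continuous_const|apply rodrigues_cos_continuous].
      + apply continuous_Rmult; [apply rodrigues_cos_continuous|].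
        apply continuous_Rmult; [apply continuous_Ropp, sin_continuous|].
        apply continuous_Rmult; [apply continuous_const|apply rodrigues_cos_continuous].
    - rewrite !Hb by (rewrite ?cos_PI, ?cos_0; ring). ring. }
  assert (H1 : is_RInt (fun th =>
    - (IZR (Z.of_nat n - j + 1) * (sin th * (rodrigues n (- (j - 1)) (cos th) * rodrigues l (j -
        1) (cos th)))
     + IZR (Z.of_nat l + j) * (sin th * (rodrigues n (- j) (cos th) * rodrigues l j (cos th)))))
         0 PI
     (- (IZR (Z.of_nat n - j + 1) * polar_integral n l (j - 1)
         + IZR (Z.of_nat l + j) * polar_integral n l j))).
  { apply (is_RInt_opp (V := R_NormedModule)).
    apply (is_RInt_plus (V := R_NormedModule));
      apply (is_RInt_scal (V := R_NormedModule)); apply polar_integral_correct. }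
  pose proof (is_RInt_unique _ _ _ _ H0) as E0. pose proof (is_RInt_unique _ _ _ _ H1) as E1.
  rewrite E0 in E1. lra.
Qed.

(** Descending to [j = - l] turns the first factor into a derivative of order
    [n + l] of a polynomial of degree [2 n < n + l]. *)
Lemma polar_integral_lt n l i : (n < l)%nat ->
  polar_integral n l (- Z.of_nat l + Z.of_nat i) = 0.
Proof.
  intros Hnl. induction i as [|i IH].
  - unfold polar_integral. apply is_RInt_unique.
    eapply is_RInt_ext; [|evar_last; [apply (is_RInt_const (V := R_NormedModule))|]].
    + intros th _. symmetry. cbv beta.
      replace (- (- Z.of_nat l + Z.of_nat 0))%Z with (Z.of_nat l) by lia.
      unfold rodrigues at 1. rewrite triR_support by lia.
      instantiate (1 := 0). real_eq. ring.
    + apply Rmult_0_r.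
  - pose proof (polar_integral_step n l (- Z.of_nat l + Z.of_nat (S i))) as H.
    replace (- Z.of_nat l + Z.of_nat (S i) - 1)%Z with (- Z.of_nat l + Z.of_nat i)%Z in H by lia.
    rewrite IH, Rmult_0_r, Ropp_0 in H.
    apply Rmult_integral in H. destruct H as [H|H]; [|easy].
    apply eq_IZR in H. lia.
Qed.

Lemma polar_integral_neq n l k : (n <> l)%nat -> (k <= n)%nat ->
  polar_integral n l (Z.of_nat k) = 0.
Proof.
  intros Hnl Hk. destruct (Nat.lt_ge_cases n l) as [H|H].
  - replace (Z.of_nat k) with (- Z.of_nat l + Z.of_nat (l + k))%Z by lia.
    now apply polar_integral_lt.
  - transitivity (polar_integral l n (- Z.of_nat n + Z.of_nat (n - k))).
    2:{ apply polar_integral_lt; lia. }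
    unfold polar_integral. apply RInt_ext. intros th _.
    replace (- (- Z.of_nat n + Z.of_nat (n - k)))%Z with (Z.of_nat k) by lia.
    replace (- Z.of_nat n + Z.of_nat (n - k))%Z with (- Z.of_nat k)%Z by lia.
    real_eq. ring.
Qed.

(** The recursion of [polar_integral_step] is that of the binomial coefficients
    of [2 n] with alternating signs. *)
Lemma polar_integral_diag n i : (i <= 2 * n)%nat ->
  polar_integral n n (- Z.of_nat n + Z.of_nat i) * (INR (fact i) * INR (fact (2 * n - i))) =
  (-1) ^ i * INR (fact (2 * n)) * polar_integral n n (- Z.of_nat n).
Proof.
  induction i as [|i IH]; intros Hi.
  - rewrite Nat.sub_0_r, Z.add_0_r. simpl; ring.
  - specialize (IH ltac:(lia)).
    pose proof (polar_integral_step n n (- Z.of_nat n + Z.of_nat (S i))) as H.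
    replace (- Z.of_nat n + Z.of_nat (S i) - 1)%Z with (- Z.of_nat n + Z.of_nat i)%Z in H by lia.
    replace (Z.of_nat n + (- Z.of_nat n + Z.of_nat (S i)))%Z with (Z.of_nat (S i)) in H by lia.
    replace (Z.of_nat n - (- Z.of_nat n + Z.of_nat (S i)) + 1)%Z
      with (Z.of_nat (2 * n - i)) in H by lia.
    rewrite <- !INR_IZR_INZ in H.
    replace (2 * n - i)%nat with (S (2 * n - S i)) in * by lia.
    rewrite !fact_simpl, !mult_INR in *. change ((-1) ^ S i) with (-1 * (-1) ^ i).
    transitivity (INR (S i) * polar_integral n n (- Z.of_nat n + Z.of_nat (S i))
      * (INR (fact i) * INR (fact (2 * n - S i)))); [ring|].
    rewrite H. transitivity (- (polar_integral n n (- Z.of_nat n + Z.of_nat i) *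
      (INR (fact i) * (INR (S (2 * n - S i)) * INR (fact (2 * n - S i)))))); [ring|].
    rewrite IH. ring.
Qed.

Definition sin_integral (n : nat) : R := RInt (fun th => sin th ^ (2 * n + 1)) 0 PI.

Lemma sin_integral_correct n :
  is_RInt (fun th => sin th ^ (2 * n + 1)) 0 PI (sin_integral n).
Proof.
  apply (RInt_correct (V := R_CompleteNormedModule)).
  apply (ex_RInt_continuous (V := R_CompleteNormedModule)). intros th _.
  apply continuous_Rpow, sin_continuous.
Qed.

Lemma sin_integral_0 : sin_integral 0 = 2.
Proof.
  apply is_RInt_unique. apply (FTC (fun t => - cos t)).
  - intros t. auto_derive; [easy|]. simpl; ring.
  - intros t. apply continuous_Rpow, sin_continuous.
  - rewrite cos_PI, cos_0; ring.
Qed.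

Lemma sin_integral_S n :
  INR (2 * n + 3) * sin_integral (S n) = INR (2 * n + 2) * sin_integral n.
Proof.
  assert (H0 : is_RInt (fun th => INR (2 * n + 2) * sin th ^ (2 * n + 1)
      - INR (2 * n + 3) * sin th ^ (2 * S n + 1)) 0 PI 0).
  { apply (FTC (fun t => cos t * sin t ^ (2 * n + 2))).
    - intros t.
      replace (2 * S n + 1)%nat with (S (S (2 * n + 1))) by lia.
      replace (2 * n + 3)%nat with (S (2 * n + 2)) by lia. rewrite S_INR.
      replace (2 * n + 2)%nat with (S (2 * n + 1)) by lia.
      evar_last.
      + apply (is_derive_mult cos (fun t => sin t ^ S (2 * n + 1)));
          [apply is_derive_cos| |intros; apply Rmult_comm].
        apply is_derive_pow, is_derive_sin.
      + unfold plus, mult; cbn [AbelianMonoid.plus Ring.mult]. cbn [pred].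
        rewrite <- !tech_pow_Rmult.
        pose proof (sin2_cos2 t) as E. unfold Rsqr in E.
        transitivity (- (sin t * sin t) * sin t ^ (2 * n + 1)
          + INR (S (2 * n + 1)) * (cos t * cos t) * sin t ^ (2 * n + 1)).
        { real_eq. simpl. ring. }
        replace (cos t * cos t) with (1 - sin t * sin t) by lra. ring.
    - intros t. apply continuous_Rminus; (apply continuous_Rmult; [apply continuous_const|]);
        apply continuous_Rpow, sin_continuous.
    - rewrite sin_PI, sin_0, pow_i by lia. ring. }
  assert (H1 : is_RInt (fun th => INR (2 * n + 2) * sin th ^ (2 * n + 1)
      - INR (2 * n + 3) * sin th ^ (2 * S n + 1)) 0 PI
      (INR (2 * n + 2) * sin_integral n - INR (2 * n + 3) * sin_integral (S n))).
  { apply (is_RInt_minus (V := R_NormedModule));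
      apply (is_RInt_scal (V := R_NormedModule)); apply sin_integral_correct. }
  pose proof (is_RInt_unique _ _ _ _ H0) as E0. pose proof (is_RInt_unique _ _ _ _ H1) as E1.
  rewrite E0 in E1. lra.
Qed.

(** Wallis' integral of odd order. *)
Lemma sin_integral_value n :
  sin_integral n * INR (fact (2 * n + 1)) = 2 * 4 ^ n * (INR (fact n)) ^ 2.
Proof.
  induction n as [|n IH].
  - rewrite sin_integral_0. simpl; ring.
  - replace (2 * S n + 1)%nat with (S (S (2 * n + 1))) by lia.
    rewrite !fact_simpl, !mult_INR.
    pose proof (sin_integral_S n) as H.
    replace (S (S (2 * n + 1))) with (2 * n + 3)%nat by lia.
    replace (S (2 * n + 1)) with (2 * n + 2)%nat by lia.
    transitivity (INR (2 * n + 3) * sin_integral (S n) * (INR (2 * n + 2) * INR (fact (2 * n +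
        1)))).
    { ring. }
    rewrite H.
    transitivity (INR (2 * n + 2) * INR (2 * n + 2) * (sin_integral n * INR (fact (2 * n + 1)))).
    { ring. }
    rewrite IH. replace (2 * n + 2)%nat with (2 * S n)%nat by lia.
    rewrite mult_INR, <- !tech_pow_Rmult. simpl (INR 2). ring.
Qed.

Lemma polar_integral_bottom n :
  polar_integral n n (- Z.of_nat n) = (-1) ^ n * sin_integral n.
Proof.
  unfold polar_integral. apply is_RInt_unique.
  eapply is_RInt_ext; [|apply (is_RInt_scal (V := R_NormedModule)), sin_integral_correct].
  intros th _. rewrite Z.opp_involutive. unfold rodrigues. rewrite triR_top, triR_bottom, pow1.
  replace (cos th ^ 2 - 1) with (-1 * (sin th * sin th)).
  2:{ pose proof (sin2_cos2 th). unfold Rsqr in *. nra. }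
  rewrite !Rpow_mult_distr, pow_add, pow_mult.
  change (scal ?a ?b) with (a * b). simpl (sin th ^ 1).
  replace (sin th ^ 2) with (sin th * sin th) by ring. rewrite Rpow_mult_distr.
  real_eq. ring.
Qed.

(** The constant in the definition of the spherical harmonics is chosen for
    this: the square of the norm over the sphere is [2 PI] times the polar
    integral. *)
Lemma polar_normalised n k : (k <= n)%nat ->
  2 * PI * (sph_norm n k * (INR (fact (n + k)) / (2 ^ n * INR (fact n)))) ^ 2
    * ((-1) ^ k * polar_integral n n (Z.of_nat k)) = 1.
Proof.
  intros Hk.
  pose proof (polar_integral_diag n (n + k) ltac:(lia)) as H.
  replace (- Z.of_nat n + Z.of_nat (n + k))%Z with (Z.of_nat k) in H by lia.
  replace (2 * n - (n + k))%nat with (n - k)%nat in H by lia.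
  rewrite polar_integral_bottom in H.
  pose proof (sin_integral_value n) as Hs.
  replace (2 * n + 1)%nat with (S (2 * n)) in Hs by lia.
  rewrite fact_simpl, mult_INR, S_INR, mult_INR in Hs. simpl (INR 2) in Hs.
  rewrite Rpow_mult_distr, sph_norm_sqr.
  pose proof (INR_fact_pos (n - k)); pose proof (INR_fact_pos (n + k));
  pose proof (INR_fact_pos n); pose proof (INR_fact_pos (2 * n)).
  pose proof PI_RGT_0; pose proof (pos_INR n). pose proof (pow_lt 2 n ltac:(lra)).
  replace 4 with (2 * 2) in Hs by ring. rewrite Rpow_mult_distr in Hs.
  rewrite pow_add in H.
  assert (H' : (-1) ^ k * polar_integral n n (Z.of_nat k) *
    (INR (fact (n + k)) * INR (fact (n - k))) = INR (fact (2 * n)) * sin_integral n).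
  { transitivity ((-1) ^ k * (polar_integral n n (Z.of_nat k) *
    (INR (fact (n + k)) * INR (fact (n - k))))); [ring|]. rewrite H.
    transitivity (((-1) ^ k * (-1) ^ k) * ((-1) ^ n * (-1) ^ n) * (INR (fact (2 * n)) *
        sin_integral n));
      [ring|]. rewrite !sign_square; ring. }
  set (P := (-1) ^ k * polar_integral n n (Z.of_nat k)) in *.
  assert (HP : P = INR (fact (2 * n)) * sin_integral n / (INR (fact (n + k)) * INR (fact (n -
      k)))).
  { rewrite <- H'. field. lra. }
  assert (HS : sin_integral n = 2 * (2 ^ n * 2 ^ n) * INR (fact n) ^ 2 /
    ((1 + 1) * INR n + 1) / INR (fact (2 * n))).
  { rewrite <- Hs. field. split; lra. }
  rewrite HP, HS. field. repeat split; lra.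
Qed.

(** * Orthonormality of the spherical harmonics *)

(** The relation carries the existence of both iterated integrals, which the
    total function [sphere_integral] does not. *)
Definition is_sphere_int (g : R3 -> C) (v : C) : Prop :=
  exists inner : R -> C,
    (forall ph, is_CInt (fun th => (RtoC (sin th) * g (sphere_point th ph))%C) 0 PI (inner ph)) /\
    is_CInt inner 0 (2 * PI) v.

Lemma is_sphere_int_unique g v : is_sphere_int g v -> sphere_integral g = v.
Proof.
  intros (inner & Hi & Ho). unfold sphere_integral.
  rewrite <- (is_CInt_unique _ _ _ _ Ho).
  apply (RInt_ext (V := C_R_CompleteNormedModule)). intros ph _.
  apply is_CInt_unique, Hi.
Qed.

Lemma is_sphere_int_ext f g v : (forall x, norm3 x = 1 -> f x = g x) -> is_sphere_int f v ->
    is_sphere_int g v.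
Proof.
  intros H (inner & Hi & Ho). exists inner. split; [|easy].
  intros ph. eapply is_CInt_ext; [|apply Hi]. intros th _. cbv beta.
  now rewrite H by apply sphere_point_norm.
Qed.

Lemma is_sphere_int_scal a f v : is_sphere_int f v -> is_sphere_int (fun x => (a * f x)%C) (a *
    v)%C.
Proof.
  intros (inner & Hi & Ho). exists (fun ph => (a * inner ph)%C). split.
  - intros ph. eapply is_CInt_ext; [|apply is_CInt_scal, Hi]. intros th _. simpl. ring.
  - now apply is_CInt_scal.
Qed.

Lemma is_sphere_int_Csum (f : nat -> R3 -> C) (v : nat -> C) n :
  (forall i, (i < n)%nat -> is_sphere_int (f i) (v i)) ->
  is_sphere_int (fun x => Csum (fun i => f i x) n) (Csum v n).
Proof.
  induction n as [|n IH]; intros H; simpl.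
  - exists (fun _ => RtoC 0). split; [|apply is_CInt_zero].
    intros ph. eapply is_CInt_ext; [|apply is_CInt_zero]. intros; simpl; ring.
  - destruct IH as (i1 & Hi1 & Ho1); [intros; apply H; lia|].
    destruct (H n ltac:(lia)) as (i2 & Hi2 & Ho2).
    exists (fun ph => (i1 ph + i2 ph)%C). split; [|now apply is_CInt_plus].
    intros ph. eapply is_CInt_ext; [|apply is_CInt_plus; [apply Hi1|apply Hi2]].
    intros; simpl; ring.
Qed.

(** The integrals of the approximants being all equal to [v] is the case that
    orthogonality produces: from some index on, partial sums of a series of
    harmonics have the same coefficient. *)
Lemma is_sphere_int_uniform_limit (f : nat -> R3 -> C) (g : R3 -> C) (v : C) (eps : nat -> R) :
  (forall n, is_sphere_int (f n) v) ->
  (forall n x, norm3 x = 1 -> Cmod (g x - f n x)%C <= eps n) ->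
  is_lim_seq eps 0 -> is_sphere_int g v.
Proof.
  intros Hf Hg He.
  set (G := fun ph th => (RtoC (sin th) * g (sphere_point th ph))%C).
  set (F := fun n ph th => (RtoC (sin th) * f n (sphere_point th ph))%C).
  assert (HGF : forall n ph th, Cmod (G ph th - F n ph th)%C <= eps n).
  { intros n ph th. unfold G, F.
    replace (_ - _)%C with (RtoC (sin th) * (g (sphere_point th ph) - f n (sphere_point th
        ph)))%C by ring.
    rewrite Cmod_mult, Cmod_R.
    specialize (Hg n (sphere_point th ph) (sphere_point_norm th ph)).
    assert (Rabs (sin th) <= 1) by (apply Rabs_le; apply SIN_bound).
    pose proof (Rabs_pos (sin th)).
    pose proof (Cmod_ge_0 (g (sphere_point th ph) - f n (sphere_point th ph))%C). nra. }
  pose proof PI_RGT_0 as Hpi.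
  assert (HI : forall n ph, is_CInt (F n ph) 0 PI (RInt (V := C_R_CompleteNormedModule) (F n ph)
      0 PI)).
  { intros n ph. destruct (Hf n) as (inner & Hi & _). eapply is_CInt_RInt, Hi. }
  assert (HG : forall ph, is_CInt (G ph) 0 PI (RInt (V := C_R_CompleteNormedModule) (G ph) 0 PI)).
  { intros ph.
    destruct (is_CInt_uniform_limit (fun n => F n ph) (G ph) _ 0 PI eps (fun n => HI n ph)) as
        [l Hl];
      [intros; apply HGF|easy|]. eapply is_CInt_RInt, Hl. }
  set (J := fun ph => RInt (V := C_R_CompleteNormedModule) (G ph) 0 PI) in *.
  set (JF := fun n ph => RInt (V := C_R_CompleteNormedModule) (F n ph) 0 PI) in *.
  assert (HJ : forall n ph, Cmod (J ph - JF n ph)%C <= PI * eps n).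
  { intros n ph. replace PI with (PI - 0) by ring.
    apply (is_CInt_bound (fun th => (G ph th - F n ph th)%C) 0 PI); [lra|intros; apply HGF|].
    apply is_CInt_minus; [apply HG|apply HI]. }
  assert (HO : forall n, is_CInt (JF n) 0 (2 * PI) v).
  { intros n. destruct (Hf n) as (inner & Hi & Ho). eapply is_CInt_ext; [|apply Ho].
    intros ph _. symmetry. exact (is_CInt_unique _ _ _ _ (Hi ph)). }
  assert (He' : is_lim_seq (fun n => PI * eps n) 0).
  { replace (Finite 0) with (Rbar_mult PI 0) by (simpl; f_equal; ring).
    now apply is_lim_seq_scal_l. }
  destruct (is_CInt_uniform_limit JF J (fun _ => v) 0 (2 * PI) _ HO HJ He') as [l Hl].
  exists J. split; [exact HG|].
  replace v with l; [exact Hl|].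
  apply Ceq_minus. apply (Cmod_le_lim _ _ (2 * PI) He'). intros n.
  replace (2 * PI) with (2 * PI - 0) at 1 by ring.
  apply (is_CInt_bound (fun ph => (J ph - JF n ph)%C) 0 (2 * PI)); [lra|intros; apply HJ|].
  now apply is_CInt_minus.
Qed.

Lemma is_CInt_cis (m : Z) :
  is_CInt (fun ph => cis (IZR m * ph)) 0 (2 * PI) (if Z.eqb m 0 then RtoC (2 * PI) else RtoC 0).
Proof.
  destruct (Z.eqb_spec m 0) as [->|Hm].
  - eapply is_CInt_ext; [|evar_last; [apply (is_RInt_const (V := C_R_NormedModule))|]].
    + intros ph _. rewrite Rmult_0_l. unfold cis. rewrite cos_0, sin_0. reflexivity.
    + rewrite scal_R_Cmult. apply C_ext; simpl; ring.
  - assert (Hm' : IZR m <> 0) by (intros H; apply Hm; now apply eq_IZR).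
    assert (Hc : cos (IZR m * (2 * PI)) = 1 /\ sin (IZR m * (2 * PI)) = 0).
    { assert (Hn : forall k, cos (INR k * (2 * PI)) = 1 /\ sin (INR k * (2 * PI)) = 0).
      { intros k. replace (INR k * (2 * PI)) with (0 + 2 * INR k * PI) by ring.
        rewrite cos_period, sin_period, cos_0, sin_0. easy. }
      destruct (Z_le_gt_dec 0 m) as [H|H].
      - rewrite <- (Z2Nat.id m H), <- INR_IZR_INZ. apply Hn.
      - replace m with (- (- m))%Z by lia. rewrite opp_IZR.
        rewrite <- (Z2Nat.id (- m)), <- INR_IZR_INZ by lia.
        rewrite Ropp_mult_distr_l_reverse, cos_neg, sin_neg.
        destruct (Hn (Z.to_nat (- m))) as [-> ->]. split; [easy|ring]. }
    destruct Hc as [Hc Hs].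
    apply is_CInt_pair; simpl.
    + apply (FTC (fun t => sin (IZR m * t) / IZR m)).
      * intros t. auto_derive; [easy|]. field; easy.
      * intros t. apply (ex_derive_continuous (V := R_NormedModule)). auto_derive; easy.
      * rewrite Hs, Rmult_0_r, sin_0. ring.
    + apply (FTC (fun t => - cos (IZR m * t) / IZR m)).
      * intros t. auto_derive; [easy|]. field; easy.
      * intros t. apply (ex_derive_continuous (V := R_NormedModule)). auto_derive; easy.
      * rewrite Hc, Rmult_0_r, cos_0. ring.
Qed.

Lemma polar_ortho n l m : (Z.abs m <= Z.of_nat n)%Z -> (Z.abs m <= Z.of_nat l)%Z ->
  is_RInt (fun th => sin th * (solid_const n m * polar_part n m th * (solid_const l m *
      polar_part l m th))) 0 PI
    (if Nat.eqb n l then / (2 * PI) else 0).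
Proof.
  intros Hn Hl. set (k := Z.abs_nat m).
  evar_last.
  - eapply is_RInt_ext; [|apply (is_RInt_scal (V := R_NormedModule) _ 0 PI
      (solid_const n m * solid_const l m * (-1) ^ k) _ (polar_integral_correct n l (Z.of_nat
          k)))].
    intros th _. change (scal ?a ?b) with (a * b). cbv beta.
    transitivity (sin th * (solid_const n m * solid_const l m * (polar_part n m th * polar_part
        l m th))).
    + rewrite polar_part_mult. fold k. real_eq. ring.
    + real_eq. ring.
  - change (solid_const n m * solid_const l m * (-1) ^ k * polar_integral n l (Z.of_nat k) =
      if Nat.eqb n l then / (2 * PI) else 0).
    destruct (Nat.eqb_spec n l) as [<-|Hnl].
    + pose proof (polar_normalised n k ltac:(lia)) as H.
      unfold solid_const. fold k. pose proof PI_RGT_0.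
      apply Rmult_eq_reg_l with (2 * PI); [|lra]. rewrite Rinv_r by lra. rewrite <- H.
      transitivity ((-1) ^ k * (-1) ^ k * (2 * PI *
        (sph_norm n k * (INR (fact (n + k)) / (2 ^ n * INR (fact n)))) ^ 2 *
        ((-1) ^ k * polar_integral n n (Z.of_nat k)))); [ring|rewrite sign_square; ring].
    + rewrite polar_integral_neq by (easy || lia). ring.
Qed.

(** The variables separate: the azimuthal integral vanishes for [m <> j], and
    for [m = j] the polar one vanishes for [n <> l]. *)
Lemma sph_harm_ortho n m l j :
  (Z.abs m <= Z.of_nat n)%Z -> (Z.abs j <= Z.of_nat l)%Z ->
  is_sphere_int (fun x => (sph_harm n m x * Cconj (sph_harm l j x))%C)
    (if andb (Nat.eqb n l) (Z.eqb m j) then RtoC 1 else RtoC 0).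
Proof.
  intros Hm Hj.
  apply (is_sphere_int_ext (fun x => (RtoC (solid_const n m) * hpoly n m x * Cconj (RtoC
      (solid_const l j) * hpoly l j x))%C)).
  { intros x Hx. now rewrite !sph_harm_hpoly. }
  assert (Hin : forall ph th, (RtoC (sin th) * (RtoC (solid_const n m) * hpoly n m (sphere_point
      th ph) * Cconj (RtoC (solid_const l j) * hpoly l j (sphere_point th ph))))%C
     = (cis (IZR (m - j) * ph) * RtoC (sin th * (solid_const n m * polar_part n m th *
         (solid_const l j * polar_part l j th))))%C).
  { intros ph th. rewrite !hpoly_sphere, !Cmult_conj.
    replace (IZR (m - j) * ph) with (IZR m * ph + - (IZR j * ph)) by (rewrite minus_IZR; ring).
    rewrite cis_plus, cis_opp, !RtoC_mult.
    replace (Cconj (RtoC (solid_const l j))) with (RtoC (solid_const l j)) by (apply C_ext;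
        simpl; ring).
    replace (Cconj (RtoC (polar_part l j th))) with (RtoC (polar_part l j th)) by (apply C_ext;
        simpl; ring).
    ring. }
  set (X := RInt (fun th => sin th * (solid_const n m * polar_part n m th * (solid_const l j *
      polar_part l j th))) 0 PI).
  assert (HX : is_RInt (fun th => sin th * (solid_const n m * polar_part n m th * (solid_const l
      j * polar_part l j th))) 0 PI X).
  { apply (RInt_correct (V := R_CompleteNormedModule)).
    apply (ex_RInt_continuous (V := R_CompleteNormedModule)). intros th _.
    assert (Hv : forall a b, continuous (fun t => polar_part a b t) th).
    { intros a b. destruct (Z_le_gt_dec 0 b) as [Hb|Hb].
      - rewrite <- (Z2Nat.id b Hb). eapply continuous_ext; [intros; symmetry; apply
          polar_part_nonneg|].
        apply continuous_Rmult; [apply continuous_Rpow, sin_continuous|apply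
            rodrigues_cos_continuous].
      - replace b with (- Z.of_nat (Z.to_nat (- b)))%Z by lia.
        eapply continuous_ext; [intros; symmetry; apply polar_part_neg|].
        apply continuous_Rmult; [apply continuous_const|].
        apply continuous_Rmult; [apply continuous_Rpow, sin_continuous|apply
            rodrigues_cos_continuous]. }
    apply continuous_Rmult; [apply sin_continuous|].
    apply continuous_Rmult; (apply continuous_Rmult; [apply continuous_const|apply Hv]). }
  exists (fun ph => (cis (IZR (m - j) * ph) * RtoC X)%C). split.
  - intros ph. eapply is_CInt_ext; [intros; symmetry; apply Hin|].
    apply is_CInt_scal. apply is_CInt_pair; simpl; [exact HX|].
    apply (is_CInt_Im _ _ _ _ (is_CInt_zero 0 PI)).
  - eapply is_CInt_ext; [intros; apply Cmult_comm|].
    evar_last; [apply is_CInt_scal, is_CInt_cis|].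
    destruct (Z.eqb_spec m j) as [<-|Hmj].
    + rewrite Z.sub_diag; simpl.
      pose proof (polar_ortho n l m Hm Hj) as H.
      assert (EX : X = if Nat.eqb n l then / (2 * PI) else 0) by apply (is_RInt_unique _ _ _ _ H).
      rewrite EX. pose proof PI_RGT_0.
      destruct (Nat.eqb n l); simpl; [|ring].
      rewrite <- RtoC_mult. f_equal. field; lra.
    + rewrite (proj2 (Z.eqb_neq (m - j) 0)) by lia. rewrite Bool.andb_false_r. ring.
Qed.

(** * Coefficients of uniformly convergent series of harmonics *)

Definition harm_sum (n : nat) (a : Z -> C) (x : R3) : C :=
  Csum (fun k => let m := (Z.of_nat k - Z.of_nat n)%Z in (a m * solid_R n m x)%C) (S (2 * n)).

Lemma harm_sum_ext n a b x :
  (forall m, (Z.abs m <= Z.of_nat n)%Z -> a m = b m) -> harm_sum n a x = harm_sum n b x.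
Proof. intros H. apply Csum_ext. intros k Hk. simpl. rewrite H by lia. easy. Qed.

Lemma harm_sum_scal n a c x :
  harm_sum n a (scal3 c x) = (RtoC (c ^ n) * harm_sum n a x)%C.
Proof.
  unfold harm_sum. rewrite <- Csum_scal. apply Csum_ext. intros k Hk. cbv zeta.
  rewrite !solid_R_hpoly, hpoly_scal by lia. ring.
Qed.

Lemma solid_R_sphere n m x : (Z.abs m <= Z.of_nat n)%Z -> norm3 x = 1 ->
  solid_R n m x = sph_harm n m x.
Proof. intros Hm Hx. now rewrite solid_R_hpoly, sph_harm_hpoly. Qed.

Lemma harm_sum_sphere_int n a l j : (Z.abs j <= Z.of_nat l)%Z ->
  is_sphere_int (fun x => (harm_sum n a x * Cconj (sph_harm l j x))%C)
    (if Nat.eqb n l then a j else RtoC 0).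
Proof.
  intros Hj.
  apply (is_sphere_int_ext (fun x => Csum (fun k => (a (Z.of_nat k - Z.of_nat n)%Z * (sph_harm n
      (Z.of_nat k - Z.of_nat n) x * Cconj (sph_harm l j x)))%C) (S (2 * n)))).
  { intros x Hx. unfold harm_sum. rewrite Cmult_comm, <- Csum_scal. apply Csum_ext. intros k Hk.
    cbv zeta. rewrite solid_R_sphere by (easy || lia). ring. }
  evar_last.
  - apply is_sphere_int_Csum. intros k Hk. apply is_sphere_int_scal, sph_harm_ortho; [lia|easy].
  - cbv beta. destruct (Nat.eqb_spec n l) as [<-|Hnl]; simpl andb.
    + rewrite (Csum_single _ _ (Z.to_nat (j + Z.of_nat n))).
      * replace (Z.of_nat (Z.to_nat (j + Z.of_nat n)) - Z.of_nat n)%Z with j by lia.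
        rewrite Z.eqb_refl. ring.
      * lia.
      * intros k Hk Hne. rewrite (proj2 (Z.eqb_neq _ j)) by lia. ring.
    + apply Csum_zero. intros; ring.
Qed.

(** [f (c + y)] is, uniformly on the sphere [|y| = rho], the sum of the series
    of harmonics with coefficients [a].  The error is bounded from some index
    on only, so that a harmonic polynomial has its own coefficients on every
    sphere with error 0. *)
Definition sphere_series (c : R3) (f : R3 -> C) (rho : R) (a : nat -> Z -> C) : Prop :=
  exists (eps : nat -> R) (N0 : nat), is_lim_seq eps 0 /\
    forall N y, (N0 <= N)%nat -> norm3 y = rho ->
      Cmod (f (add3 c y) - Csum (fun n => harm_sum n (a n) y) N)%C <= eps N.

Lemma tri_bound n m A B D : Cmod (tri n m A B D) <= (Cmod A + Cmod B + Cmod D) ^ n.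
Proof.
  pose proof (Cmod_ge_0 A); pose proof (Cmod_ge_0 B); pose proof (Cmod_ge_0 D).
  revert m; induction n as [|n IH]; intros m; cbn [tri].
  - destruct (Z.eqb m 0); rewrite ?Cmod_1, ?Cmod_0; simpl; lra.
  - eapply Rle_trans; [apply Cmod_triangle|].
    eapply Rle_trans; [apply Rplus_le_compat_r, Cmod_triangle|].
    rewrite !Cmod_mult. simpl.
    rewrite !Rmult_plus_distr_r.
    repeat apply Rplus_le_compat; apply Rmult_le_compat_l; auto.
Qed.

Lemma sph_harm_bound n m : (Z.abs m <= Z.of_nat n)%Z ->
  exists K, 0 <= K /\ forall x, norm3 x = 1 -> Cmod (sph_harm n m x) <= K.
Proof.
  intros Hm. exists (Rabs (solid_const n m) * 4 ^ n). split.
  { apply Rmult_le_pos; [apply Rabs_pos|apply pow_le; lra]. }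
  intros x Hx. rewrite sph_harm_hpoly, Cmod_mult, Cmod_R by easy.
  apply Rmult_le_compat_l; [apply Rabs_pos|]. unfold hpoly.
  eapply Rle_trans; [apply tri_bound|].
  pose proof (norm3_sqr x) as H2. rewrite Hx in H2.
  rewrite Cmod_opp, Cmod_conj, Cmod_R.
  assert (Hw : Cmod (planar x) <= 1).
  { apply Rle_trans with (sqrt 1); [|rewrite sqrt_1; lra].
    apply sqrt_le_1_alt. unfold planar; cbn [fst snd]. nra. }
  assert (Hz : Rabs (2 * crd3 x) <= 2) by (apply Rabs_le; nra).
  apply pow_incr. split; [|lra].
  pose proof (Cmod_ge_0 (planar x)); pose proof (Rabs_pos (2 * crd3 x)); lra.
Qed.

(** Uniform convergence allows integrating term by term against a spherical
    harmonic, and orthonormality retains one term. *)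
Lemma sphere_series_coeff c f rho a n m : 0 < rho -> sphere_series c f rho a -> (Z.abs m <=
    Z.of_nat n)%Z ->
  sphere_coeff c rho f n m = (RtoC (rho ^ n) * a n m)%C.
Proof.
  intros Hrho (eps & N0 & He & H) Hm. apply is_sphere_int_unique.
  destruct (sph_harm_bound n m Hm) as (K & HK & HY).
  apply (is_sphere_int_uniform_limit (fun N x =>
    Csum (fun l => (RtoC (rho ^ l) * (harm_sum l (a l) x * Cconj (sph_harm n m x)))%C)
      (N + (N0 + S n))) _ _ (fun N => K * eps (N + (N0 + S n))%nat)).
  - intros N. evar_last.
    + apply is_sphere_int_Csum. intros l Hl. apply is_sphere_int_scal, harm_sum_sphere_int, Hm.
    + cbv beta. rewrite (Csum_single _ _ n).
      * now rewrite Nat.eqb_refl.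
      * lia.
      * intros l Hl Hne. rewrite (proj2 (Nat.eqb_neq l n)) by easy. ring.
  - intros N x Hx.
    replace (Csum _ _) with (Csum (fun l => harm_sum l (a l) (scal3 rho x)) (N + (N0 + S n)) *
        Cconj (sph_harm n m x))%C.
    2:{ rewrite Cmult_comm, <- Csum_scal. apply Csum_ext. intros l _. rewrite harm_sum_scal.
        ring. }
    replace (_ - _)%C with ((f (add3 c (scal3 rho x)) - Csum (fun l => harm_sum l (a l) (scal3
        rho x)) (N + (N0 + S n))) * Cconj (sph_harm n m x))%C by ring.
    rewrite Cmod_mult, Cmod_conj, Rmult_comm.
    apply Rmult_le_compat; try apply Cmod_ge_0; [now apply HY|].
    apply H; [lia|]. rewrite norm3_scal, Hx, Rabs_pos_eq by lra. ring.
  - replace (Finite 0) with (Rbar_mult K 0) by (simpl; f_equal; ring).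
    apply is_lim_seq_scal_l. now apply -> (is_lim_seq_incr_n eps (N0 + S n)).
Qed.

Lemma degree_order_Csum p F :
  degree_order_sum p F =
  Csum (fun n => Csum (fun k => F n (Z.of_nat k - Z.of_nat n)%Z) (S (2 * n))) (S p).
Proof.
  unfold degree_order_sum. rewrite sum_n_Csum. apply Csum_ext. intros n _.
  now rewrite sum_n_Csum.
Qed.

(** The radius in the definition of the expansion is an unspecified admissible
    one; the hypothesis therefore asks for one series that is valid at every
    admissible radius. *)
Lemma local_expansion_sphere_series p c f a x :
  (exists rho, local_admissible c f rho) ->
  (forall rho, local_admissible c f rho -> sphere_series c f rho a) ->
  local_expansion p c f x = Csum (fun n => harm_sum n (a n) (sub3 x c)) (S p).
Proof.
  intros Hex HR. unfold local_expansion. rewrite degree_order_Csum.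
  apply Csum_ext. intros n _. apply Csum_ext. intros k Hk. cbv zeta.
  f_equal. unfold local_coeff.
  assert (Hadm : local_admissible c f (local_radius c f)).
  { unfold local_radius. apply ClassicalEpsilon.epsilon_spec, Hex. }
  pose proof (proj1 Hadm) as Hrho.
  rewrite (sphere_series_coeff c f _ a) by (auto; lia).
  rewrite Cmult_assoc, <- RtoC_mult, Rinv_l, Cmult_1_l; [easy|].
  apply pow_nonzero; lra.
Qed.

Lemma sphere_series_unique c f rho a b : 0 < rho -> sphere_series c f rho a -> sphere_series c f
    rho b -> forall n m, (Z.abs m <= Z.of_nat n)%Z -> a n m = b n m.
Proof.
  intros H2 Ha Hb n m Hm.
  pose proof (sphere_series_coeff c f rho a n m H2 Ha Hm) as Ea.
  rewrite (sphere_series_coeff c f rho b n m H2 Hb Hm) in Ea.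
  assert (Hp : RtoC (rho ^ n) <> RtoC 0).
  { intros H. apply RtoC_inj in H. revert H. apply pow_nonzero; lra. }
  assert (E : (/ RtoC (rho ^ n) * (RtoC (rho ^ n) * a n m))%C =
              (/ RtoC (rho ^ n) * (RtoC (rho ^ n) * b n m))%C) by now rewrite Ea.
  rewrite !Cmult_assoc, !Cinv_l, !Cmult_1_l in E by easy. exact E.
Qed.

(** * Powers of null linear forms are harmonic *)

Definition lin3 (z1 z2 z3 : C) (x : R3) : C :=
  (z1 * RtoC (crd1 x) + z2 * RtoC (crd2 x) + z3 * RtoC (crd3 x))%C.

(** The weights of [tri_scale] for the three terms of a null form in [w], [z]
    and [conj w]; nullity of the vector is the condition [l ^ 2 = p q]. *)
Definition null_coeff (z1 z2 z3 : C) (n : nat) (m : Z) : C :=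
  (RtoC (/ solid_const n m) * (null_weight n m (RtoC (/ 2) * (z1 - Ci * z2))
       (RtoC (/ 2) * z3)
       (RtoC (- / 2) * (z1 + Ci * z2))))%C.

(** Writing the form in terms of [w], [z] and [conj w], its power expands into
    trinomial coefficients, and these are multiples of [hpoly n m]. *)
Lemma null_power n z1 z2 z3 x :
  (z1 * z1 + z2 * z2 + z3 * z3)%C = RtoC 0 ->
  (lin3 z1 z2 z3 x ^ n)%C = harm_sum n (null_coeff z1 z2 z3 n) x.
Proof.
  intros Hnull.
  set (p := (RtoC (/ 2) * (z1 - Ci * z2))%C).
  set (l := (RtoC (/ 2) * z3)%C).
  set (q := (RtoC (- / 2) * (z1 + Ci * z2))%C).
  assert (Hl : (l * l)%C = (p * q)%C).
  { unfold l, p, q. apply Ceq_minus.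
    transitivity (RtoC (/ 2) * RtoC (/ 2) * (z1 * z1 + z2 * z2 + z3 * z3))%C.
    { destruct z1, z2, z3; apply C_ext; simpl; ring. }
    rewrite Hnull; ring. }
  replace (lin3 z1 z2 z3 x) with (p * planar x + l * RtoC (2 * crd3 x) + q * - Cconj (planar
      x))%C.
  2:{ unfold lin3, p, l, q, planar. destruct z1, z2, z3; apply C_ext; simpl; field. }
  rewrite tri_sum. unfold harm_sum. apply Csum_ext. intros k Hk. cbv zeta.
  rewrite tri_scale, solid_R_hpoly by (easy || lia).
  unfold null_coeff. fold p l q. fold (hpoly n (Z.of_nat k - Z.of_nat n) x).
  transitivity (RtoC (/ solid_const n (Z.of_nat k - Z.of_nat n) * solid_const n (Z.of_nat k -
      Z.of_nat n)) * (null_weight n (Z.of_nat k - Z.of_nat n) p l q * hpoly n (Z.of_nat k -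
      Z.of_nat n) x))%C.
  { rewrite Rinv_l by apply solid_const_neq0. ring. }
  rewrite RtoC_mult; ring.
Qed.

(** On the sphere of radius [rho] the functions [I_n^m] and [R_n^m] differ by
    the factor [rho ^ (- (2 n + 1))], which the hypothesis splits off so that
    the coefficients [b] do not depend on [rho]. *)
Lemma multipole_expansion_sphere_series p f b x :
  (exists rho, multipole_admissible zero3 f rho) ->
  (forall rho, multipole_admissible zero3 f rho ->
     sphere_series zero3 f rho (fun n m => (RtoC (/ rho ^ (2 * n + 1)) * b n m)%C)) ->
  multipole_expansion p zero3 f x =
  Csum (fun n => Csum (fun k => let m := (Z.of_nat k - Z.of_nat n)%Z in
    (b n m * solid_I n m x)%C) (S (2 * n))) (S p).
Proof.
  intros Hex HR. unfold multipole_expansion. rewrite degree_order_Csum.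
  apply Csum_ext. intros n _. apply Csum_ext. intros k Hk. cbv zeta.
  replace (sub3 x zero3) with x.
  2:{ unfold sub3, zero3; R3_ring. }
  f_equal. unfold multipole_coeff.
  assert (Hadm : multipole_admissible zero3 f (multipole_radius zero3 f)).
  { unfold multipole_radius. apply ClassicalEpsilon.epsilon_spec, Hex. }
  pose proof (proj1 Hadm) as Hrho.
  rewrite (sphere_series_coeff zero3 f _ _ n _ Hrho (HR _ Hadm)) by lia.
  rewrite !Cmult_assoc, <- !RtoC_mult.
  set (r := multipole_radius zero3 f) in *.
  replace (r ^ (n + 1) * r ^ n * / r ^ (2 * n + 1)) with 1; [ring|].
  rewrite <- pow_add. replace (n + 1 + n)%nat with (2 * n + 1)%nat by lia.
  rewrite Rinv_r; [easy|]. apply pow_nonzero; lra.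
Qed.

(** * Averages over a circle of null directions *)

Definition circle_avg (f : R -> C) : C :=
  (RtoC (/ (2 * PI)) * RInt (V := C_R_CompleteNormedModule) f 0 (2 * PI))%C.

Lemma circle_avg_is_CInt f l : is_CInt f 0 (2 * PI) l -> circle_avg f = (RtoC (/ (2 * PI)) * l)%C.
Proof. intros H. unfold circle_avg. now rewrite (is_CInt_unique _ _ _ _ H). Qed.

Lemma circle_avg_ext f g : (forall t, f t = g t) -> circle_avg f = circle_avg g.
Proof.
  intros H. unfold circle_avg. f_equal.
  apply (RInt_ext (V := C_R_CompleteNormedModule)). intros; apply H.
Qed.

Lemma circle_avg_Csum (f : nat -> R -> C) n :
  (forall i t, (i < n)%nat -> ccont (f i) t) ->
  circle_avg (fun t => Csum (fun i => f i t) n) = Csum (fun i => circle_avg (f i)) n.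
Proof.
  intros H. unfold circle_avg. rewrite Csum_scal. apply circle_avg_is_CInt, is_CInt_Csum.
  intros i Hi. apply is_CInt_ccont. intros; now apply H.
Qed.

Lemma circle_avg_scal c f : (forall t, ccont f t) -> circle_avg (fun t => (c * f t)%C) = (c *
    circle_avg f)%C.
Proof.
  intros H. unfold circle_avg at 2. rewrite (circle_avg_is_CInt _ _ (is_CInt_scal c _ _ _ _
      (is_CInt_ccont f _ _ H))). ring.
Qed.

Lemma circle_avg_minus f g : (forall t, ccont f t) -> (forall t, ccont g t) ->
  circle_avg (fun t => (f t - g t)%C) = (circle_avg f - circle_avg g)%C.
Proof.
  intros Hf Hg. unfold circle_avg at 2 3.
  rewrite (circle_avg_is_CInt _ _ (is_CInt_minus _ _ _ _ _ _ (is_CInt_ccont f _ _ Hf)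
      (is_CInt_ccont g _ _ Hg))). ring.
Qed.

Lemma circle_avg_bound f M : (forall t, ccont f t) -> (forall t, Cmod (f t) <= M) -> Cmod
    (circle_avg f) <= M.
Proof.
  intros Hf HM. unfold circle_avg. pose proof PI_RGT_0.
  assert (Hi : 0 < / (2 * PI)) by (apply Rinv_0_lt_compat; lra).
  rewrite Cmod_mult, Cmod_R, Rabs_pos_eq by lra.
  apply Rle_trans with (/ (2 * PI) * ((2 * PI - 0) * M)).
  - apply Rmult_le_compat_l; [lra|].
    apply (is_CInt_bound f); [lra|auto|now apply is_CInt_ccont].
  - right; field; lra.
Qed.

(** With [q = b cos t + b' sin t] and [S] the square root on the right, the
    real and the imaginary part of the integrand have the antiderivatives
    [(t + atan (q q' / (a (S + a) + q ^ 2))) / S] and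
    [ln ((S + q') / (S - q')) / (2 S)].  Unlike the textbook form with
    [tan t], these are smooth on the whole circle, and only the term [t / S]
    is not periodic. *)
Lemma circle_avg_inv a b b' : 0 < a ->
  circle_avg (fun t => (/ (a, (b * cos t + b' * sin t)%R))%C) = RtoC (/ sqrt (a ^ 2 + b ^ 2 + b'
      ^ 2)).
Proof.
  intros Ha.
  set (S := sqrt (a ^ 2 + b ^ 2 + b' ^ 2)).
  assert (HS2 : S ^ 2 = a ^ 2 + b ^ 2 + b' ^ 2) by (unfold S; rewrite pow2_sqrt; nra).
  assert (HS : 0 < S) by (apply sqrt_lt_R0; nra).
  set (q := fun t => b * cos t + b' * sin t).
  set (q' := fun t => b' * cos t - b * sin t).
  assert (Hq : forall t, is_derive q t (q' t)).
  { intros t. unfold q, q'. auto_derive; [easy|ring]. }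
  assert (Hq' : forall t, is_derive q' t (- q t)).
  { intros t. unfold q, q'. auto_derive; [easy|ring]. }
  assert (Hqq : forall t, q t ^ 2 + q' t ^ 2 = b ^ 2 + b' ^ 2).
  { intros t. unfold q, q'. pose proof (sin2_cos2 t) as E. unfold Rsqr in E.
    transitivity ((b ^ 2 + b' ^ 2) * (sin t * sin t + cos t * cos t)); [ring|rewrite E; ring]. }
  assert (Hd : forall t, 0 < a ^ 2 + q t ^ 2) by (intros; nra).
  assert (Hc : forall t, continuous q t).
  { intros t. apply (ex_derive_continuous (V := R_NormedModule)). eexists; apply Hq. }
  assert (Hper : q (2 * PI) = q 0 /\ q' (2 * PI) = q' 0).
  { unfold q, q'. rewrite cos_2PI, sin_2PI, cos_0, sin_0. easy. }
  destruct Hper as [P1 P2].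
  pose proof PI_RGT_0.
  rewrite (circle_avg_is_CInt _ (RtoC (2 * PI / S))).
  { rewrite <- RtoC_mult. f_equal. field. lra. }
  apply is_CInt_pair; simpl.
  - apply (FTC (fun t => / S * (t + atan (q t * q' t / (a * (S + a) + q t ^ 2))))
      (fun t => a / (a * (a * 1) + q t * (q t * 1)))).
    + intros t.
      assert (Hden : 0 < a * (S + a) + q t ^ 2) by nra.
      evar_last.
      * apply is_derive_scal. apply (is_derive_plus (V := R_NormedModule)).
        { apply (is_derive_id (K := R_AbsRing)). }
        apply (is_derive_comp (V := R_NormedModule) atan).
        { apply is_derive_atan. }
        apply (is_derive_div (fun t => q t * q' t)).
        { apply (is_derive_mult q q'); [apply Hq|apply Hq'|intros; apply Rmult_comm]. }
        { apply (is_derive_plus (V := R_NormedModule)); [apply (is_derive_const (V :=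
            R_NormedModule))|].
          apply (is_derive_pow q 2), Hq. }
        { lra. }
      * unfold plus, mult, scal, one, zero; simpl. unfold mult; simpl.
        pose proof (Hqq t) as E. pose proof (Hd t) as Hdt.
        set (u := q t) in *. set (v := q' t) in *.
        assert (Ev : v * v = S ^ 2 - a ^ 2 - u ^ 2) by nra.
        unfold Rsqr.
        assert (Hden2 : (a * (S + a) + u ^ 2) ^ 2 + (u * v) ^ 2 = (a ^ 2 + u ^ 2) * (S + a) ^ 2).
        { replace ((u * v) ^ 2) with (u ^ 2 * (v * v)) by ring. rewrite Ev. ring. }
        assert (Hg : 1 + u * v / (a * (S + a) + u * (u * 1)) * (u * v / (a * (S + a) + u * (u *
            1)))
            = (a ^ 2 + u ^ 2) * (S + a) ^ 2 / (a * (S + a) + u ^ 2) ^ 2).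
        { rewrite <- Hden2. field. nra. }
        rewrite Hg.
        assert (Hn : ((v * v + u * - u) * (a * (S + a) + u * (u * 1)) -
          u * v * (0 + (1 + 1) * v * (u * 1))) =
          (S + a) * (a * (S ^ 2 - a ^ 2) - u ^ 2 * (S + a))).
        { replace (u * v * (0 + (1 + 1) * v * (u * 1))) with (2 * u ^ 2 * (v * v)) by ring.
          rewrite Ev. ring. }
        assert (Hfin : 1 + ((S + a) * (a * (S ^ 2 - a ^ 2) - u ^ 2 * (S + a)))
             / ((a * (S + a) + u ^ 2) ^ 2)
          / ((a ^ 2 + u ^ 2) * (S + a) ^ 2 / (a * (S + a) + u ^ 2) ^ 2) = S * (a / (a ^ 2 + u ^
              2))).
        { field. repeat split; nra. }
        match goal with |- / S * (1 + ?X) = _ =>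
          replace X with (((S + a) * (a * (S ^ 2 - a ^ 2) - u ^ 2 * (S + a)))
             / ((a * (S + a) + u ^ 2) ^ 2)
          / ((a ^ 2 + u ^ 2) * (S + a) ^ 2 / (a * (S + a) + u ^ 2) ^ 2)) end.
        { rewrite Hfin. field. split; nra. }
        rewrite <- Hn. field. repeat split; nra.
    + intros t. unfold Rdiv. apply continuous_Rmult; [apply continuous_const|].
      specialize (Hd t). apply continuous_Rinv'; [nra|].
      apply continuous_Rplus; [apply continuous_const|]. now apply (continuous_Rpow q 2).
    + rewrite P1, P2. unfold Rdiv; ring.
  - apply (FTC (fun t => / (2 * S) * (ln (S + q' t) - ln (S - q' t)))
      (fun t => - (b * cos t + b' * sin t) / (a * (a * 1) + q t * (q t * 1)))).
    + intros t. fold (q t). pose proof (Hqq t) as E. pose proof (Hd t) as Hdt.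
      assert (H1 : 0 < S + q' t) by nra. assert (H2 : 0 < S - q' t) by nra.
      evar_last.
      * apply is_derive_scal. apply (is_derive_minus (V := R_NormedModule)).
        -- apply (is_derive_comp (V := R_NormedModule) ln); [now apply is_derive_ln|].
           apply (is_derive_plus (V := R_NormedModule)); [apply (is_derive_const (V :=
               R_NormedModule))|apply Hq'].
        -- apply (is_derive_comp (V := R_NormedModule) ln); [now apply is_derive_ln|].
           apply (is_derive_minus (V := R_NormedModule)); [apply (is_derive_const (V :=
               R_NormedModule))|apply Hq'].
      * unfold plus, minus, opp, scal, zero; simpl. unfold mult, plus, opp; simpl.
        replace (a * (a * 1) + q t * (q t * 1)) with ((S + q' t) * (S - q' t)) by nra.
        field. lra.
    + intros t. specialize (Hd t). apply continuous_Rmult; [apply continuous_Ropp, Hc|].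
      apply continuous_Rinv'; [nra|].
      apply continuous_Rplus; [apply continuous_const|]. now apply (continuous_Rpow q 2).
    + rewrite P2; ring.
Qed.

(** * Laplace's integral for the potential *)

(** With the pole [sphere_point al be], the vectors [frame1] and [frame2] form
    the orthonormal frame of spherical coordinates. *)
Definition frame1 (al be : R) : R3 := (cos al * cos be, cos al * sin be, - sin al).
Definition frame2 (be : R) : R3 := (- sin be, cos be, 0).

Lemma dot_frame al be x y : dot3 x y =
  dot3 x (sphere_point al be) * dot3 y (sphere_point al be)
  + dot3 x (frame1 al be) * dot3 y (frame1 al be) + dot3 x (frame2 be) * dot3 y (frame2 be).
Proof.
  unfold dot3, sphere_point, frame1, frame2, crd1, crd2, crd3; cbn [fst snd].
  pose proof (sin2_cos2 al) as Ha. pose proof (sin2_cos2 be) as Hb. unfold Rsqr in *.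
  destruct x as [[x1 x2] x3], y as [[y1 y2] y3]; cbn [fst snd].
  set (sa := sin al) in *. set (ca := cos al) in *. set (sb := sin be) in *. set (cb := cos be)
      in *.
  transitivity ((sa * sa + ca * ca) * ((x1 * cb + x2 * sb) * (y1 * cb + y2 * sb) + x3 * y3)
     + (x2 * cb - x1 * sb) * (y2 * cb - y1 * sb)); [|ring].
  rewrite Ha.
  transitivity ((sb * sb + cb * cb) * (x1 * y1 + x2 * y2) + x3 * y3); [rewrite Hb; ring|ring].
Qed.

(** The real part is the component along the pole, the imaginary part the one
    along an axis rotating in the orthogonal plane; the two axes being
    orthonormal, the vector of this form is null. *)
Definition null_form (al be : R) (y : R3) (t : R) : C :=
  (dot3 y (sphere_point al be),
   dot3 y (frame1 al be) * cos t + dot3 y (frame2 be) * sin t).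

Definition null_dir1 al be t : C := (crd1 (sphere_point al be), crd1 (frame1 al be) * cos t +
    crd1 (frame2 be) * sin t).
Definition null_dir2 al be t : C := (crd2 (sphere_point al be), crd2 (frame1 al be) * cos t +
    crd2 (frame2 be) * sin t).
Definition null_dir3 al be t : C := (crd3 (sphere_point al be), crd3 (frame1 al be) * cos t +
    crd3 (frame2 be) * sin t).

Lemma null_form_lin al be y t : null_form al be y t = lin3 (null_dir1 al be t) (null_dir2 al be
    t) (null_dir3 al be t) y.
Proof. apply C_ext; unfold null_form, lin3, null_dir1, null_dir2, null_dir3, dot3; simpl; ring.
    Qed.

Lemma null_dir_isotropic al be t :
  (null_dir1 al be t * null_dir1 al be t + null_dir2 al be t * null_dir2 al be t + null_dir3 al
      be t * null_dir3 al be t)%C = RtoC 0.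
Proof.
  unfold null_dir1, null_dir2, null_dir3, sphere_point, frame1, frame2, crd1, crd2, crd3.
  pose proof (sin2_cos2 al) as Ha. pose proof (sin2_cos2 be) as Hb. pose proof (sin2_cos2 t) as
      Ht.
  unfold Rsqr in *.
  set (sa := sin al) in *. set (ca := cos al) in *. set (sb := sin be) in *. set (cb := cos be)
      in *.
  set (st := sin t) in *. set (ct := cos t) in *.
  apply C_ext; simpl.
  - transitivity ((sa * sa) * (sb * sb + cb * cb) + ca * ca - (ct * ct) * ((ca * ca) * (sb * sb
      + cb * cb) + sa * sa)
      - (st * st) * (sb * sb + cb * cb)); [ring|].
    rewrite Hb, !Rmult_1_r.
    transitivity ((sa * sa + ca * ca) - (ct * ct) * (sa * sa + ca * ca) - st * st); [ring|].
    rewrite Ha. lra.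
  - transitivity (2 * sa * ca * ct * ((sb * sb + cb * cb) - 1)); [ring|]. rewrite Hb; ring.
Qed.

Lemma null_form_add al be x y t : null_form al be (add3 x y) t = (null_form al be x t +
    null_form al be y t)%C.
Proof. apply C_ext; unfold null_form, dot3, add3, crd1, crd2, crd3; simpl; ring. Qed.

Lemma null_form_sub al be x y t : null_form al be (sub3 x y) t = (null_form al be x t -
    null_form al be y t)%C.
Proof. apply C_ext; unfold null_form, dot3, sub3, crd1, crd2, crd3; simpl; ring. Qed.

Lemma null_form_scal al be a x t : null_form al be (scal3 a x) t = (RtoC a * null_form al be x
    t)%C.
Proof. apply C_ext; unfold null_form, dot3, scal3, crd1, crd2, crd3; simpl; ring. Qed.

(** The modulus squared is the sum of two squared components along orthonormal
    axes. *)
Lemma null_form_bound al be y t : Cmod (null_form al be y t) <= norm3 y.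
Proof.
  unfold Cmod, norm3. apply sqrt_le_1_alt.
  pose proof (dot_frame al be y y) as H. unfold dot3 at 1 in H.
  unfold null_form; cbn [fst snd].
  set (a := dot3 y (sphere_point al be)) in *. set (b := dot3 y (frame1 al be)) in *.
  set (b' := dot3 y (frame2 be)) in *.
  assert ((b * cos t + b' * sin t) ^ 2 <= b ^ 2 + b' ^ 2).
  { pose proof (sin2_cos2 t) as E. unfold Rsqr in E.
    assert (0 <= (b * sin t - b' * cos t) ^ 2) by apply pow2_ge_0.
    replace (b ^ 2 + b' ^ 2) with ((sin t * sin t + cos t * cos t) * (b ^ 2 + b' ^ 2)) by
        (rewrite E; ring).
    nra. }
  nra.
Qed.

Lemma trig_lin_continuous a b t : continuous (fun t => a * cos t + b * sin t) t.
Proof.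
  apply continuous_Rplus; (apply continuous_Rmult; [apply continuous_const|]);
    [apply cos_continuous|apply sin_continuous].
Qed.

Lemma null_form_ccont al be y t : ccont (null_form al be y) t.
Proof. split; simpl; [apply continuous_const|apply trig_lin_continuous]. Qed.
#[local] Hint Resolve null_form_ccont : ccont.

Lemma null_dir_ccont al be t : ccont (null_dir1 al be) t /\ ccont (null_dir2 al be) t /\ ccont
    (null_dir3 al be) t.
Proof. repeat split; simpl; (apply continuous_const || apply trig_lin_continuous). Qed.

Lemma null_coeff_ccont al be n m t :
  ccont (fun t => null_coeff (null_dir1 al be t) (null_dir2 al be t) (null_dir3 al be t) n m) t.
Proof.
  destruct (null_dir_ccont al be t) as (H1 & H2 & H3).
  unfold null_coeff, null_weight. ccont_auto.
Qed.
#[local] Hint Resolve null_coeff_ccont : ccont.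

Definition circle_avg_coeff (al be : R) (w : R -> C) (n : nat) (m : Z) : C :=
  circle_avg (fun t => (w t * null_coeff (null_dir1 al be t) (null_dir2 al be t) (null_dir3 al
      be t) n m)%C).

(** An average of harmonic polynomials of degree [n] is one: averaging acts on
    the coefficients. *)
Lemma circle_avg_null_power al be w n y : (forall t, ccont w t) ->
  circle_avg (fun t => (w t * null_form al be y t ^ n)%C) = harm_sum n (circle_avg_coeff al be w
      n) y.
Proof.
  intros Hw. unfold harm_sum, circle_avg_coeff.
  rewrite (circle_avg_ext _ (fun t => Csum (fun k => let m := (Z.of_nat k - Z.of_nat n)%Z in
     (solid_R n m y * (w t * null_coeff (null_dir1 al be t) (null_dir2 al be t) (null_dir3 al be
         t) n m))%C)
     (S (2 * n)))).
  - rewrite circle_avg_Csum.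
    + apply Csum_ext. intros k _. cbv zeta. rewrite circle_avg_scal; [apply Cmult_comm|].
      intros t. ccont_auto.
    + intros k t _. cbv zeta. ccont_auto.
  - intros t. rewrite null_form_lin, null_power by apply null_dir_isotropic. unfold harm_sum.
    rewrite <- Csum_scal. apply Csum_ext. intros k _. cbv zeta. ring.
Qed.

Lemma polar_form v : exists al be, v = scal3 (norm3 v) (sphere_point al be).
Proof.
  destruct (Req_dec (norm3 v) 0) as [H0|H0].
  - exists 0, 0. rewrite H0. rewrite (norm3_eq0 v H0).
    unfold scal3, zero3; R3_ring.
  - set (x := unit3 v). assert (Hx : norm3 x = 1) by now apply norm3_unit.
    exists (polar_angle x), (azimuth x). rewrite (unit3_scal v H0) at 1. f_equal. fold x.
    pose proof (cis_azimuth x) as Hw.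
    pose proof (norm3_sqr x) as H2. rewrite Hx in H2.
    assert (Hu : -1 <= crd3 x <= 1) by nra.
    assert (Hs : sin (polar_angle x) = sqrt (crd1 x ^ 2 + crd2 x ^ 2)).
    { unfold polar_angle. rewrite sin_acos by easy. f_equal. unfold Rsqr. lra. }
    apply R3_ext; unfold sphere_point; unfold crd1 at 2 || unfold crd2 at 2 || unfold crd3 at 2;
      cbn [fst snd].
    + change (crd1 (?a, ?b, ?c)) with a. rewrite Hs.
      apply (f_equal Re) in Hw. simpl in Hw. unfold planar in Hw. simpl in Hw. simpl. lra.
    + change (crd2 (?a, ?b, ?c)) with b. rewrite Hs.
      apply (f_equal Im) in Hw. simpl in Hw. unfold planar in Hw. simpl in Hw. simpl. lra.
    + change (crd3 (?a, ?b, ?c)) with c. unfold polar_angle. now rewrite cos_acos.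
Qed.

Lemma norm3_sub_sqr x y : norm3 (sub3 x y) ^ 2 = norm3 x ^ 2 - 2 * dot3 x y + norm3 y ^ 2.
Proof. rewrite !norm3_sqr. unfold dot3, sub3, crd1, crd2, crd3; simpl; ring. Qed.

Lemma norm3_sub_comm x y : norm3 (sub3 x y) = norm3 (sub3 y x).
Proof.
  unfold norm3. f_equal. unfold sub3, crd1, crd2, crd3; simpl; ring.
Qed.

(** In the frame, the sum of squares that [circle_avg_inv] produces is
    [|a e - v| ^ 2], where [e] is the pole. *)
Lemma circle_avg_pole al be (a : R) (v : R3) (d : R) :
  dot3 v (sphere_point al be) < a -> 0 <= d ->
  d ^ 2 = a ^ 2 - 2 * a * dot3 v (sphere_point al be) + norm3 v ^ 2 ->
  circle_avg (fun t => (/ (RtoC a - null_form al be v t))%C) = RtoC (/ d).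
Proof.
  intros Ha Hd Hd2.
  rewrite (circle_avg_ext _ (fun t => (/ ((a - dot3 v (sphere_point al be))%R,
    ((- dot3 v (frame1 al be)) * cos t + (- dot3 v (frame2 be)) * sin t)%R))%C)).
  - rewrite circle_avg_inv by lra. do 2 f_equal.
    rewrite <- (sqrt_pow2 d Hd). f_equal. rewrite Hd2, norm3_sqr.
    pose proof (dot_frame al be v v) as H. unfold dot3 at 1 in H. nra.
  - intros t. f_equal. apply C_ext; simpl; ring.
Qed.

(** Laplace's integral, the frame being attached to the point farther from the
    origin: this form is expanded in powers of [z] near 0. *)
Lemma circle_avg_far al be D z : norm3 z < D ->
  circle_avg (fun t => (/ (RtoC D - null_form al be z t))%C) =
  RtoC (/ norm3 (sub3 (scal3 D (sphere_point al be)) z)).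
Proof.
  intros Hz. pose proof (norm3_pos z).
  apply circle_avg_pole; [|apply norm3_pos|].
  - eapply Rle_lt_trans; [apply norm3_dot|]. rewrite sphere_point_norm; lra.
  - rewrite norm3_sub_sqr, norm3_scal, sphere_point_norm, Rmult_1_r, pow2_abs.
    unfold dot3, scal3, crd1, crd2, crd3; simpl; ring.
Qed.

(** The same integral with the frame attached to the nearer point
    [sg * pole].  The distance between [x] and this point is also that between
    [|x| * pole] and [(sg / |x|) x]; hence the factor [sg / |x|].  This form
    is expanded in harmonics of [x] outside a sphere. *)
Lemma circle_avg_near al be sg x : 0 <= sg -> sg < norm3 x ->
  circle_avg (fun t => (/ (RtoC (norm3 x) - RtoC (sg / norm3 x) * null_form al be x t))%C) =
  RtoC (/ norm3 (sub3 x (scal3 sg (sphere_point al be)))).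
Proof.
  intros Hs Hx.
  rewrite (circle_avg_ext _ (fun t => (/ (RtoC (norm3 x) - null_form al be (scal3 (sg / norm3 x)
      x) t))%C)).
  2:{ intros t. now rewrite null_form_scal. }
  set (k := sg / norm3 x).
  assert (Hk : k * norm3 x = sg) by (unfold k; field; lra).
  assert (Hk0 : 0 <= k) by (unfold k; apply Rmult_le_pos; [easy|left; apply Rinv_0_lt_compat;
      lra]).
  assert (Hn : norm3 (scal3 k x) = sg) by (rewrite norm3_scal, Rabs_pos_eq; easy).
  assert (Hdot : dot3 (scal3 k x) (sphere_point al be) = k * dot3 x (sphere_point al be)).
  { unfold dot3, scal3, crd1, crd2, crd3; simpl; ring. }
  apply circle_avg_pole; [|apply norm3_pos|].
  - eapply Rle_lt_trans; [apply norm3_dot|]. rewrite sphere_point_norm, Hn; lra.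
  - rewrite norm3_sub_sqr, norm3_scal, sphere_point_norm, Rmult_1_r, pow2_abs, Hn, Hdot.
    replace (dot3 x (scal3 sg (sphere_point al be))) with (sg * dot3 x (sphere_point al be)).
    2:{ unfold dot3, scal3, crd1, crd2, crd3; simpl; ring. }
    rewrite <- Hk. ring.
Qed.

(** * Taylor remainders of negative powers *)

(** The number [n + j] choose [j], the coefficient of [s ^ n] in
    [1 / (1 - s) ^ (j + 1)]. *)
Definition binom (n j : nat) : R := INR (fact (n + j)) / (INR (fact n) * INR (fact j)).

Lemma binom_sym n j : binom n j = binom j n.
Proof. unfold binom. rewrite (Nat.add_comm n j), (Rmult_comm (INR (fact n))). easy. Qed.

Lemma binom_0_l j : binom 0 j = 1.
Proof. unfold binom. simpl. field. apply INR_fact_neq_0. Qed.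

Lemma binom_0_r n : binom n 0 = 1.
Proof. rewrite binom_sym. apply binom_0_l. Qed.

Lemma binom_pos n j : 0 <= binom n j.
Proof.
  unfold binom. pose proof (INR_fact_pos n); pose proof (INR_fact_pos j); pose proof
      (INR_fact_pos (n + j)).
  apply Rmult_le_pos; [lra|]. left; apply Rinv_0_lt_compat; nra.
Qed.

Lemma binom_pascal n j : binom (S n) (S j) = binom n (S j) + binom (S n) j.
Proof.
  unfold binom. pose proof (INR_fact_pos n); pose proof (INR_fact_pos j); pose proof
      (INR_fact_pos (n + j)).
  replace (S n + S j)%nat with (S (S (n + j))) by lia.
  replace (n + S j)%nat with (S (n + j)) by lia.
  replace (S n + j)%nat with (S (n + j)) by lia.
  rewrite !fact_simpl, !mult_INR, !S_INR, plus_INR.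
  pose proof (pos_INR n); pose proof (pos_INR j). field. repeat split; lra.
Qed.

Lemma binom_trinomial n j i : binom n (i + j) * binom i j = binom n j * binom i (n + j).
Proof.
  unfold binom. pose proof (INR_fact_pos n); pose proof (INR_fact_pos j); pose proof
      (INR_fact_pos i);
  pose proof (INR_fact_pos (n + j)); pose proof (INR_fact_pos (i + j)).
  replace (n + (i + j))%nat with (i + (n + j))%nat by lia. field. repeat split; lra.
Qed.

(** What remains of [1 / (b - s) ^ (j + 1)] after the terms of degree less than
    [N] in [s]. *)
Definition taylor_rem (j N : nat) (b s : C) : C :=
  (/ (b - s) ^ S j - Csum (fun n => (RtoC (binom n j) * (s ^ n * / b ^ (n + j + 1)))) N)%C.

Definition taylor_remR (j N : nat) (b s : R) : R :=
  / (b - s) ^ S j - Rsum (fun n => binom n j * (s ^ n * / b ^ (n + j + 1))) N.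

Lemma RtoC_neq0 x : x <> 0 -> RtoC x <> RtoC 0.
Proof. intros H E. apply H. now apply RtoC_inj. Qed.

Lemma taylor_rem_RtoC j N b s : b <> 0 -> b - s <> 0 -> taylor_rem j N (RtoC b) (RtoC s) = RtoC
    (taylor_remR j N b s).
Proof.
  intros Hb Hs. unfold taylor_rem, taylor_remR. rewrite RtoC_minus, RtoC_Rsum. f_equal.
  - rewrite <- RtoC_minus, <- RtoC_pow, <- RtoC_inv; [easy|]. now apply pow_nonzero.
  - apply Csum_ext. intros n _. rewrite !RtoC_mult, RtoC_pow, RtoC_inv, RtoC_pow; [easy|].
    now apply pow_nonzero.
Qed.

(** The term left over at the end of the range when Pascal's rule telescopes. *)
Definition taylor_rem_edge (N j : nat) : R := match N with O => 0 | S k => binom k (S j) end.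

Lemma taylor_rem_edge_pos N j : 0 <= taylor_rem_edge N j.
Proof. destruct N; simpl; [lra|apply binom_pos]. Qed.

Lemma binom_edge N j : binom N (S j) = binom N j + taylor_rem_edge N j.
Proof.
  destruct N as [|N]; simpl; [rewrite !binom_0_l; ring|]. rewrite binom_pascal; ring.
Qed.

Lemma taylor_rem_0 N b s : b <> RtoC 0 -> (b - s)%C <> RtoC 0 ->
  taylor_rem 0 N b s = (/ (b - s) * (s ^ N * / b ^ N))%C.
Proof.
  intros Hb Hs. unfold taylor_rem. induction N as [|N IH]; cbn [Csum].
  - cbn [Cpow]. field. repeat split; (easy || apply C1_nz).
  - transitivity (/ (b - s) ^ 1 - Csum (fun n => (RtoC (binom n 0) * (s ^ n * / b ^ (n + 0 +
      1)))) N - RtoC (binom N 0) * (s ^ N * / b ^ (N + 0 + 1)))%C; [ring|].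
    rewrite IH, binom_0_r. replace (N + 0 + 1)%nat with (S N) by lia. rewrite !Cpow_S.
    field. repeat split; try easy. now apply Cpow_nz.
Qed.

(** Multiplying the partial sum for [j + 1] by [b - s] gives, by Pascal's rule,
    the one for [j] up to a term of degree [N].  All the bounds below are
    inductions along this recursion, whose coefficients are nonnegative. *)
Lemma taylor_rem_S j N b s : b <> RtoC 0 -> (b - s)%C <> RtoC 0 ->
  taylor_rem (S j) N b s = (/ (b - s) * (taylor_rem j N b s + RtoC (taylor_rem_edge N j) * (s ^
      N * / b ^ (N + j + 1))))%C.
Proof.
  intros Hb Hs.
  assert (H : ((b - s) * Csum (fun n => (RtoC (binom n (S j)) * (s ^ n * / b ^ (n + S j + 1))))
      N)%C =
     (Csum (fun n => (RtoC (binom n j) * (s ^ n * / b ^ (n + j + 1)))) N - RtoC (taylor_rem_edge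
         N j) * (s ^ N * / b ^ (N + j + 1)))%C).
  { induction N as [|N IH]; cbn [Csum]; [simpl; ring|].
    transitivity ((b - s) * Csum (fun n => (RtoC (binom n (S j)) * (s ^ n * / b ^ (n + S j +
        1)))) N + (b - s) * (RtoC (binom N (S j)) * (s ^ N * / b ^ (N + S j + 1))))%C  ; [ring|].
    rewrite IH. change (taylor_rem_edge (S N) j) with (binom N (S j)).
    rewrite binom_edge, RtoC_plus.
    replace (N + S j + 1)%nat with (S (N + j + 1)) by lia.
    replace (S N + j + 1)%nat with (S (N + j + 1)) by lia. rewrite !Cpow_S.
    field. split; [now apply Cpow_nz|easy]. }
  unfold taylor_rem.
  transitivity (/ (b - s) * (/ (b - s) ^ S j - (b - s) * Csum (fun n => (RtoC (binom n (S j)) *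
      (s ^ n * / b ^ (n + S j + 1)))) N))%C.
  - rewrite (Cpow_S _ (S j)).
    assert (Hp : ((b - s) ^ S j)%C <> RtoC 0) by now apply Cpow_nz.
    set (X := Csum _ _). set (Y := (_ ^ _)%C) in *. field. split; easy.
  - rewrite H. ring.
Qed.

Lemma taylor_remR_0 N b s : 0 < b -> s < b -> taylor_remR 0 N b s = / (b - s) * (s ^ N * / b ^ N).
Proof.
  intros Hb Hs. apply RtoC_inj. rewrite <- taylor_rem_RtoC by lra.
  rewrite taylor_rem_0; rewrite <- ?RtoC_minus; try (apply RtoC_neq0; lra).
  rewrite !RtoC_mult, RtoC_pow, !RtoC_inv, RtoC_pow; [easy| |lra].
  apply pow_nonzero; lra.
Qed.

Lemma taylor_remR_S j N b s : 0 < b -> s < b ->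
  taylor_remR (S j) N b s = / (b - s) * (taylor_remR j N b s + taylor_rem_edge N j * (s ^ N * /
      b ^ (N + j + 1))).
Proof.
  intros Hb Hs. apply RtoC_inj. rewrite <- taylor_rem_RtoC by lra.
  rewrite taylor_rem_S; rewrite <- ?RtoC_minus; try (apply RtoC_neq0; lra).
  rewrite taylor_rem_RtoC by lra.
  rewrite !RtoC_mult, RtoC_plus, !RtoC_mult, RtoC_pow, !RtoC_inv, RtoC_pow; [easy| |lra].
  apply pow_nonzero; lra.
Qed.

Lemma Cmod_pow (z : C) n : Cmod (z ^ n)%C = Cmod z ^ n.
Proof. induction n as [|n IH]; simpl; [apply Cmod_1|]. now rewrite Cmod_mult, IH. Qed.

Lemma Cmod_minus_ge (b s : C) : Cmod b - Cmod s <= Cmod (b - s)%C.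
Proof.
  pose proof (Cmod_triangle (b - s)%C s) as H.
  replace (b - s + s)%C with b in H by ring. lra.
Qed.

Lemma Cmod_neq0 z : 0 < Cmod z -> z <> RtoC 0.
Proof. intros H E. rewrite E, Cmod_0 in H. lra. Qed.

Lemma Rinv_le_pow a b n : 0 < a -> a <= b -> / b ^ n <= / a ^ n.
Proof. intros Ha Hab. apply Rinv_le_contravar; [now apply pow_lt|]. apply pow_incr; lra. Qed.

Lemma mono_bound (s b : C) (sg be : R) N k : 0 < be -> be <= Cmod b -> Cmod s <= sg ->
  Cmod (s ^ N * / b ^ k)%C <= sg ^ N * / be ^ k.
Proof.
  intros Hbe Hb Hs.
  assert (Hb0 : b <> RtoC 0) by (apply Cmod_neq0; lra).
  pose proof (Cmod_ge_0 s).
  rewrite Cmod_mult, Cmod_inv, !Cmod_pow by now apply Cpow_nz.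
  apply Rmult_le_compat.
  - apply pow_le; lra.
  - left; apply Rinv_0_lt_compat, pow_lt; lra.
  - apply pow_incr; lra.
  - now apply Rinv_le_pow.
Qed.

(** Every Taylor coefficient of [1 / (b - s) ^ (j + 1)] is positive, so the
    remainder at complex arguments is dominated by the one at the moduli. *)
Lemma taylor_rem_majorant j N b s be sg :
  0 <= sg -> sg < be -> be <= Cmod b -> Cmod s <= sg ->
  Cmod (taylor_rem j N b s) <= taylor_remR j N be sg.
Proof.
  intros Hsg Hlt Hb Hs.
  pose proof (Cmod_minus_ge b s) as Hbs.
  assert (Hb0 : b <> RtoC 0) by (apply Cmod_neq0; lra).
  assert (Hbs0 : (b - s)%C <> RtoC 0) by (apply Cmod_neq0; lra).
  assert (Hi : Cmod (/ (b - s))%C <= / (be - sg)).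
  { rewrite Cmod_inv by easy. apply Rinv_le_contravar; lra. }
  induction j as [|j IH].
  - rewrite taylor_rem_0, taylor_remR_0, Cmod_mult by (easy || lra).
    apply Rmult_le_compat; try apply Cmod_ge_0; [easy|]. apply mono_bound; lra.
  - rewrite taylor_rem_S, taylor_remR_S, Cmod_mult by (easy || lra).
    apply Rmult_le_compat; try apply Cmod_ge_0; [easy|].
    eapply Rle_trans; [apply Cmod_triangle|]. apply Rplus_le_compat; [easy|].
    rewrite Cmod_mult, Cmod_R, Rabs_pos_eq by apply taylor_rem_edge_pos.
    apply Rmult_le_compat_l; [apply taylor_rem_edge_pos|]. apply mono_bound; lra.
Qed.

Lemma taylor_remR_mono j N b s s' : 0 <= s -> s <= s' -> s' < b -> taylor_remR j N b s <=
    taylor_remR j N b s'.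
Proof.
  intros H0 H1 H2.
  eapply Rle_trans; [|apply (taylor_rem_majorant j N (RtoC b) (RtoC s) b s')]; try lra.
  - rewrite taylor_rem_RtoC, Cmod_R by lra. apply Rle_abs.
  - rewrite Cmod_R, Rabs_pos_eq; lra.
  - rewrite Cmod_R, Rabs_pos_eq; lra.
Qed.

Lemma taylor_remR_pos j N b s : 0 <= s -> s < b -> 0 <= taylor_remR j N b s.
Proof.
  intros H0 H1.
  eapply Rle_trans; [apply (Cmod_ge_0 (taylor_rem j N (RtoC b) (RtoC s)))|].
  apply taylor_rem_majorant; try lra; rewrite Cmod_R, Rabs_pos_eq; lra.
Qed.

(** The remainder is a power series in [s] that starts at degree [N]. *)
Lemma taylor_remR_shrink j N b s l : 0 <= s -> s < b -> 0 <= l <= 1 ->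
  taylor_remR j N b (l * s) <= l ^ N * taylor_remR j N b s.
Proof.
  intros H0 H1 Hl. assert (Hls : 0 <= l * s <= s) by nra.
  assert (Hi : / (b - l * s) <= / (b - s)) by (apply Rinv_le_contravar; lra).
  assert (Hi0 : 0 <= / (b - l * s)) by (left; apply Rinv_0_lt_compat; lra).
  assert (Hm : forall k, 0 <= s ^ N * / b ^ k).
  { intros k. apply Rmult_le_pos; [now apply pow_le|]. left; apply Rinv_0_lt_compat, pow_lt;
      lra. }
  assert (HlN : 0 <= l ^ N) by now apply pow_le.
  induction j as [|j IH].
  - rewrite !taylor_remR_0, Rpow_mult_distr by lra.
    specialize (Hm N).
    replace (/ (b - l * s) * (l ^ N * s ^ N * / b ^ N)) with (/ (b - l * s) * (l ^ N * (s ^ N *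
        / b ^ N))) by ring.
    replace (l ^ N * (/ (b - s) * (s ^ N * / b ^ N))) with (/ (b - s) * (l ^ N * (s ^ N * / b ^
        N))) by ring.
    apply Rmult_le_compat_r; [now apply Rmult_le_pos|easy].
  - rewrite !taylor_remR_S, Rpow_mult_distr by lra.
    specialize (Hm (N + j + 1)%nat). pose proof (taylor_rem_edge_pos N j) as He.
    pose proof (taylor_remR_pos j N b s H0 H1) as Hr.
    apply Rle_trans with (/ (b - s) * (l ^ N * (taylor_remR j N b s + taylor_rem_edge N j * (s ^
        N * / b ^ (N + j + 1))))).
    2:{ right; ring. }
    apply Rmult_le_compat; try easy.
    + apply Rplus_le_le_0_compat; [apply taylor_remR_pos; lra|].
      apply Rmult_le_pos; [easy|]. rewrite Rmult_assoc. now apply Rmult_le_pos.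
    + rewrite Rmult_plus_distr_l. apply Rplus_le_compat; [easy|]. right; ring.
Qed.

(** Comparison with a slightly larger argument gains a geometric factor. *)
Lemma taylor_remR_lim j b s : 0 <= s -> s < b -> is_lim_seq (fun N => taylor_remR j N b s) 0.
Proof.
  intros H0 H1.
  (* Any [s'] strictly between [s] and [b] will do. *)
  set (s' := (s + b) / 2). assert (Hs' : s < s' < b) by (unfold s'; lra).
  set (l := s / s').
  assert (Hl : 0 <= l < 1).
  { unfold l. split; [apply Rmult_le_pos; [lra|left; apply Rinv_0_lt_compat; lra]|].
    apply Rmult_lt_reg_r with s'; [lra|]. unfold Rdiv. rewrite Rmult_assoc, Rinv_l; lra. }
  apply (is_lim_seq_le_le (fun _ => 0) _ (fun N => l ^ N * / (b - s') ^ S j)).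
  - intros N. split; [now apply taylor_remR_pos|].
    replace s with (l * s') by (unfold l; field; lra).
    eapply Rle_trans; [apply taylor_remR_shrink; lra|].
    apply Rmult_le_compat_l; [apply pow_le; lra|].
    unfold taylor_remR. assert (0 <= Rsum (fun n => binom n j * (s' ^ n * / b ^ (n + j + 1)))
        N); [|lra].
    apply Rsum_pos. intros n _. apply Rmult_le_pos; [apply binom_pos|].
    apply Rmult_le_pos; [apply pow_le; lra|left; apply Rinv_0_lt_compat, pow_lt; lra].
  - apply is_lim_seq_const.
  - replace (Finite 0) with (Rbar_mult 0 (/ (b - s') ^ S j)) by (simpl; f_equal; ring).
    apply is_lim_seq_scal_r. apply is_lim_seq_geom. rewrite Rabs_pos_eq; lra.
Qed.

Lemma taylor_remR_0_expand N b s : / (b - s) = taylor_remR 0 N b s + Rsum (fun n => s ^ n * / b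
    ^ (S n)) N.
Proof.
  unfold taylor_remR. rewrite pow_1.
  rewrite (Rsum_ext (fun n => binom n 0 * _) (fun n => s ^ n * / b ^ S n)); [ring|].
  intros n _. rewrite binom_0_r, Rmult_1_l. do 3 f_equal. lia.
Qed.

(** The left-hand side is nondecreasing in [q], and its limit is the right-hand
    side: in the power series of [1 / (b - u - r)] in [u] and [r], both sides
    keep the terms of degree at least [P] in [r], the left one only those of
    degree less than [q] in [u].  The remainder that is added in [HL] measures
    the terms in [u] that are missing. *)
Lemma taylor_remR_sum q P b r u : 0 <= r -> 0 <= u -> u + r < b ->
  Rsum (fun j => u ^ j * taylor_remR j P b r) q <= taylor_remR 0 P (b - u) r.
Proof.
  intros Hr Hu Hb.
  set (L := fun q => Rsum (fun j => u ^ j * taylor_remR j P b r) q).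
  assert (HL : forall m, L m + taylor_remR 0 m (b - r) u =
    taylor_remR 0 P (b - u) r + Rsum (fun n => r ^ n * taylor_remR n m b u) P).
  { intros m.
    assert (H1 : L m = Rsum (fun j => u ^ j * / (b - r) ^ S j) m -
      Rsum (fun j => Rsum (fun n => binom n j * (u ^ j * r ^ n * / b ^ (n + j + 1))) P) m).
    { unfold L. rewrite <- Rsum_minus. apply Rsum_ext. intros j _. unfold taylor_remR.
      rewrite Rmult_minus_distr_l, <- Rsum_scal. f_equal. apply Rsum_ext. intros n _. ring. }
    assert (H2 : Rsum (fun n => r ^ n * taylor_remR n m b u) P = Rsum (fun n => r ^ n * / (b -
        u) ^ S n) P -
      Rsum (fun n => Rsum (fun j => binom n j * (u ^ j * r ^ n * / b ^ (n + j + 1))) m) P).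
    { rewrite <- Rsum_minus. apply Rsum_ext. intros n _. unfold taylor_remR.
      rewrite Rmult_minus_distr_l, <- Rsum_scal. f_equal. apply Rsum_ext. intros j _.
      rewrite (binom_sym j n), (Nat.add_comm j n). ring. }
    pose proof (taylor_remR_0_expand m (b - r) u) as E1. pose proof (taylor_remR_0_expand P (b -
        u) r) as E2.
    replace (b - r - u) with (b - u - r) in E1 by ring.
    rewrite H1, H2, (Rsum_swap (fun j n => binom n j * (u ^ j * r ^ n * / b ^ (n + j + 1)))).
        lra. }
  assert (Hmono : forall m, L q <= L (m + q)%nat).
  { intros m. apply Rsum_le_more; [lia|]. intros j. apply Rmult_le_pos; [now apply pow_le|].
    apply taylor_remR_pos; lra. }
  change (L q <= taylor_remR 0 P (b - u) r).
  apply (is_lim_seq_le (fun _ => L q)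
    (fun m => taylor_remR 0 P (b - u) r + Rsum (fun n => r ^ n * taylor_remR n (m + q) b u) P)
    (L q) (taylor_remR 0 P (b - u) r)).
  - intros m. specialize (HL (m + q)%nat). specialize (Hmono m).
    pose proof (taylor_remR_pos 0 (m + q) (b - r) u Hu ltac:(lra)). lra.
  - apply is_lim_seq_const.
  - replace (Finite (taylor_remR 0 P (b - u) r)) with (Finite (taylor_remR 0 P (b - u) r + 0))
      by (f_equal; ring).
    apply is_lim_seq_plus'; [apply is_lim_seq_const|].
    clear HL Hmono L. induction P as [|P IH]; simpl; [apply is_lim_seq_const|].
    replace (Finite 0) with (Finite (0 + r ^ P * 0)) by (f_equal; ring).
    apply is_lim_seq_plus'; [exact IH|].
    apply is_lim_seq_mult'; [apply is_lim_seq_const|].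
    apply (is_lim_seq_incr_n (fun m => taylor_remR P m b u) q). apply taylor_remR_lim; lra.
Qed.

Lemma Csum_triangle (f : nat -> nat -> C) P :
  Csum (fun k => Csum (fun j => f (k - j)%nat j) (S k)) P =
  Csum (fun j => Csum (fun i => f i j) (P - j)) P.
Proof.
  induction P as [|P IH]; [easy|].
  change (Csum ?g (S P)) with (Csum g P + g P)%C at 1. cbv beta. rewrite IH.
  change (Csum (fun j => Csum (fun i => f i j) (S P - j)) (S P)) with
   (Csum (fun j => Csum (fun i => f i j) (S P - j)) P + Csum (fun i => f i P) (S P - P))%C.
  replace (S P - P)%nat with 1%nat by lia.
  rewrite (Csum_ext (fun j => Csum (fun i => f i j) (S P - j))
    (fun j => (Csum (fun i => f i j) (P - j) + f (P - j)%nat j)%C) P).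
  - rewrite Csum_plus. simpl. rewrite Nat.sub_diag. ring.
  - intros j Hj. replace (S P - j)%nat with (S (P - j)) by lia. easy.
Qed.

Lemma Cbinomial (a z : C) k :
  ((a + z) ^ k)%C =
  Csum (fun j => (RtoC (binom (k - j) j) * (a ^ (k - j) * z ^ j))%C) (S k).
Proof.
  induction k as [|k IH].
  - simpl. rewrite binom_0_l. ring.
  - rewrite Cpow_S, IH.
    set (T := fun m j => (RtoC (binom (m - j) j) * (a ^ (m - j) * z ^ j))%C).
    (* Pascal's rule splits each inner term into its two predecessors. *)
    assert (HT : forall m, (m <= k)%nat ->
      Csum (T (S k)) (S m) = (a * Csum (T k) (S m) + z * Csum (T k) m)%C).
    { induction m as [|m IHm]; intros Hm.
      - simpl. unfold T. rewrite !Nat.sub_0_r, !binom_0_r. simpl. ring.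
      - change (Csum (T (S k)) (S (S m))) with (Csum (T (S k)) (S m) + T (S k) (S m))%C.
        rewrite IHm by lia.
        change (Csum (T k) (S (S m))) with (Csum (T k) (S m) + T k (S m))%C.
        change (Csum (T k) (S m)) with (Csum (T k) m + T k m)%C.
        unfold T. rewrite Nat.sub_succ.
        replace (k - m)%nat with (S (k - S m)) by lia.
        rewrite binom_pascal, RtoC_plus, !Cpow_S. ring. }
    change (Csum _ (S (S k))) with (Csum (T (S k)) (S k) + T (S k) (S k))%C.
    rewrite (HT k (le_n k)). change (Csum (T k) (S k)) with (Csum (T k) k + T k k)%C.
    unfold T. rewrite !Nat.sub_diag, !binom_0_l. rewrite Cpow_S. simpl. rewrite ?Nat.sub_diag,
        ?binom_0_l. simpl. ring.
Qed.

(** The binomial theorem, collected by powers of the second summand.  A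
    polynomial in [a + z] can then be truncated in [z] alone. *)
Lemma Csum_binomial (c : nat -> C) (a z : C) P :
  Csum (fun k => (c k * (a + z) ^ k)%C) P =
  Csum (fun j => (z ^ j * Csum (fun i => (RtoC (binom i j) * (c (i + j)%nat * a ^ i))) (P -
      j))%C) P.
Proof.
  set (F := fun i j => (z ^ j * (RtoC (binom i j) * (c (i + j)%nat * a ^ i)))%C).
  rewrite (Csum_ext _ (fun k => Csum (fun j => F (k - j)%nat j) (S k)) P).
  - rewrite (Csum_triangle F). apply Csum_ext. intros j _. apply Csum_scal.
  - intros k _. rewrite Cbinomial, <- Csum_scal. apply Csum_ext. intros j Hj. unfold F.
    replace (k - j + j)%nat with k by lia. ring.
Qed.

Lemma Rsum_binomial (c : nat -> R) (a z : R) P :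
  Rsum (fun k => c k * (a + z) ^ k) P =
  Rsum (fun j => z ^ j * Rsum (fun i => binom i j * (c (i + j)%nat * a ^ i)) (P - j)) P.
Proof.
  apply RtoC_inj. rewrite !RtoC_Rsum.
  rewrite (Csum_ext _ (fun k => (RtoC (c k) * (RtoC a + RtoC z) ^ k)%C)).
  - rewrite (Csum_binomial (fun k => RtoC (c k)) (RtoC a) (RtoC z)). apply Csum_ext. intros j _.
    rewrite RtoC_mult, RtoC_pow, RtoC_Rsum. f_equal. apply Csum_ext. intros i _.
    now rewrite !RtoC_mult, RtoC_pow.
  - intros k _. now rewrite RtoC_mult, RtoC_pow, RtoC_plus.
Qed.

(** Expand the remainder at [v + u] by powers of [u]: the terms of degree less
    than [Q] appear on the left, and all others are nonnegative. *)
Lemma taylor_remR_sum_trunc n Q P D u v : 0 <= u -> 0 <= v -> u + v < D ->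
  Rsum (fun j => binom n j * u ^ j * taylor_remR (n + j) (P - j) D v) Q <= taylor_remR n P D (v
      + u).
Proof.
  intros Hu Hv HD.
  set (f := fun j => binom n j * u ^ j * taylor_remR (n + j) (P - j) D v).
  assert (Hf : forall j, 0 <= f j).
  { intros j. apply Rmult_le_pos; [|apply taylor_remR_pos; lra].
    apply Rmult_le_pos; [apply binom_pos|now apply pow_le]. }
  apply Rle_trans with (Rsum f (P + Q)).
  { apply Rsum_le_more; [lia|easy]. }
  assert (HE : Rsum f (P + Q) + taylor_remR n (P + Q) (D - v) u = taylor_remR n P D (v + u));
      cycle 1.
  { pose proof (taylor_remR_pos n (P + Q) (D - v) u Hu ltac:(lra)). lra. }
  assert (H1 : Rsum f (P + Q) =
     Rsum (fun j => binom j n * (u ^ j * / (D - v) ^ (j + n + 1))) (P + Q)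
     - Rsum (fun k => binom k n * ((v + u) ^ k * / D ^ (k + n + 1))) P).
  { rewrite (Rsum_ext (fun k => binom k n * ((v + u) ^ k * / D ^ (k + n + 1))) (fun k => (binom
      k n * / D ^ (k + n + 1)) * (v + u) ^ k))
      by (intros; ring).
    rewrite (Rsum_binomial (fun k => binom k n * / D ^ (k + n + 1))).
    assert (Hext : forall m, Rsum (fun j => u ^ j * Rsum (fun i => binom i j *
       (binom (i + j) n * / D ^ (i + j + n + 1) * v ^ i)) (P - j)) P =
       Rsum (fun j => u ^ j * Rsum (fun i => binom i j *
       (binom (i + j) n * / D ^ (i + j + n + 1) * v ^ i)) (P - j)) (P + m)).
    { induction m as [|m IH]; [now rewrite Nat.add_0_r|].
      rewrite Nat.add_succ_r. simpl. rewrite <- IH.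
      replace (P - (P + m))%nat with O by lia. simpl; ring. }
    rewrite (Hext Q), <- Rsum_minus. apply Rsum_ext. intros j _. unfold f, taylor_remR.
    rewrite Rmult_minus_distr_l. f_equal.
    - rewrite (binom_sym j n). replace (j + n + 1)%nat with (S (n + j)) by lia. ring.
    - rewrite <- !Rsum_scal. apply Rsum_ext. intros i _.
      rewrite (binom_sym (i + j) n).
      replace (i + j + n + 1)%nat with (i + (n + j) + 1)%nat by lia.
      transitivity (binom n j * binom i (n + j) * (u ^ j * (v ^ i * / D ^ (i + (n + j) + 1))));
          [ring|].
      rewrite <- binom_trinomial. ring. }
  rewrite H1. unfold taylor_remR. replace (D - v - u) with (D - (v + u)) by ring. ring.
Qed.

(** * The error bound for the integrand *)

(** The coefficient of [z ^ j] in the double Taylor polynomial of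
    [1 / (D - sg - (al + z))], of degree less than [P] both in [sg] and in
    [al + z]. *)
Definition shift_coeff (P : nat) (D : R) (sg al : C) (j : nat) : C :=
  Csum (fun n => Csum (fun i => (RtoC (binom i j * binom n (i + j) * / D ^ (n + (i + j) + 1)) *
      (sg ^ n * al ^ i))%C) (P - j)) P.

(** The error is split along the two truncations.  The terms of degree at least
    [P] in [sg] give the first sum of remainders; among the others, those of
    degree at least [P] in [al + z] give the second.  Both are majorised at
    the moduli, where truncation in [z] only removes nonnegative terms, so the
    number [q] of retained powers of [z] disappears from the bound. *)
Lemma pointwise_error (q P : nat) (D r r' : R) (sg al z : C) :
  0 < r -> 0 < r' -> r + r' < D ->
  Cmod sg <= r -> Cmod al + Cmod z <= r' ->
  Cmod (Csum (fun j => ((/ (RtoC D - (al + sg)) ^ S j - shift_coeff P D sg al j) * z ^ j)%C) q) <=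
  1 / (D - r' - r) * (r / (D - r')) ^ P + 1 / (D - r - r') * (r' / (D - r)) ^ P.
Proof.
  intros Hr Hr' HD Hsg Haz.
  set (u := Cmod z) in *. set (v := Cmod al) in *.
  assert (Hu : 0 <= u) by apply Cmod_ge_0. assert (Hv : 0 <= v) by apply Cmod_ge_0.
  assert (Hdb : D - v <= Cmod (RtoC D - al)%C).
  { pose proof (Cmod_minus_ge (RtoC D) al) as H. rewrite Cmod_R, Rabs_pos_eq in H by lra. easy. }
  assert (Hsplit : Csum (fun j => ((/ (RtoC D - (al + sg)) ^ S j - shift_coeff P D sg al j) * z
      ^ j)%C) q =
    (Csum (fun j => (z ^ j * taylor_rem j P (RtoC D - al) sg)) q + Csum (fun n => (sg ^ n * Csum
        (fun j => (RtoC (binom n j) * (z ^ j * taylor_rem (n + j) (P - j) (RtoC D) al))) q))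
        P)%C).
  { rewrite (Csum_ext (fun n => (sg ^ n * _)%C) (fun n => Csum (fun j => (sg ^ n * (RtoC (binom
      n j) * (z ^ j * taylor_rem (n + j) (P - j) (RtoC D) al)))%C) q))
      by (intros; now rewrite Csum_scal).
    rewrite Csum_swap, <- Csum_plus. apply Csum_ext. intros j _.
    unfold taylor_rem at 1.
    replace (RtoC D - al - sg)%C with (RtoC D - (al + sg))%C by ring.
    assert (Hk : shift_coeff P D sg al j = (Csum (fun n => (RtoC (binom n j) * (sg ^ n * / (RtoC
        D - al) ^ (n + j + 1)))) P - Csum (fun n => (sg ^ n * (RtoC (binom n j) * taylor_rem (n
        + j) (P - j) (RtoC D) al))) P)%C).
    { rewrite <- Csum_minus. apply Csum_ext. intros n _. unfold taylor_rem.
      replace (n + j + 1)%nat with (S (n + j)) by lia.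
      match goal with |- _ = (?a * (?b * ?c) - ?b * (?a * (?c - ?d)))%C =>
        transitivity (b * a * d)%C; [|ring] end.
      rewrite <- Csum_scal. apply Csum_ext. intros i _.
      replace (binom i j * binom n (i + j)) with (binom n j * binom i (n + j))
        by (rewrite <- binom_trinomial; ring).
      replace (n + (i + j) + 1)%nat with (i + (n + j) + 1)%nat by lia.
      rewrite !RtoC_mult, RtoC_inv, RtoC_pow by (apply pow_nonzero; lra). ring. }
    rewrite Hk.
    rewrite (Csum_ext (fun n => (sg ^ n * (RtoC (binom n j) * (z ^ j * _)))%C)
      (fun n => (z ^ j * (sg ^ n * (RtoC (binom n j) * taylor_rem (n + j) (P - j) (RtoC D)
          al)))%C)) by (intros; ring).
    rewrite Csum_scal. ring. }
  rewrite Hsplit. eapply Rle_trans; [apply Cmod_triangle|]. apply Rplus_le_compat.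
  - (* Truncation in [sg]. *)
    apply Rle_trans with (Rsum (fun j => u ^ j * taylor_remR j P (D - v) r) q).
    { apply Cmod_Csum. intros j _. rewrite Cmod_mult, Cmod_pow.
      apply Rmult_le_compat_l; [now apply pow_le|]. apply taylor_rem_majorant; lra. }
    eapply Rle_trans; [apply taylor_remR_sum; lra|].
    rewrite taylor_remR_0 by lra. unfold Rdiv. rewrite Rmult_1_l, Rpow_mult_distr, pow_inv.
    apply Rmult_le_compat.
    + left; apply Rinv_0_lt_compat; lra.
    + apply Rmult_le_pos; [apply pow_le; lra|left; apply Rinv_0_lt_compat, pow_lt; lra].
    + apply Rinv_le_contravar; lra.
    + apply Rmult_le_compat_l; [apply pow_le; lra|]. apply Rinv_le_pow; lra.
  - (* Truncation in [al + z]. *)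
    apply Rle_trans with (Rsum (fun n => r ^ n * taylor_remR n P D r') P).
    { apply Cmod_Csum. intros n _. rewrite Cmod_mult, Cmod_pow.
      apply Rmult_le_compat; try apply Cmod_ge_0; [apply pow_le, Cmod_ge_0| |].
      - apply pow_incr. split; [apply Cmod_ge_0|easy].
      - apply Rle_trans with (taylor_remR n P D (v + u)); [|apply taylor_remR_mono; lra].
        eapply Rle_trans; [|apply (taylor_remR_sum_trunc n q P D u v); lra].
        apply Cmod_Csum. intros j _. rewrite !Cmod_mult, Cmod_R, Rabs_pos_eq, Cmod_pow by apply
            binom_pos.
        rewrite <- Rmult_assoc. apply Rmult_le_compat_l.
        + apply Rmult_le_pos; [apply binom_pos|now apply pow_le].
        + apply taylor_rem_majorant; try lra; [|unfold v; lra]. rewrite Cmod_R, Rabs_pos_eq;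
            lra. }
    eapply Rle_trans; [apply taylor_remR_sum; lra|].
    rewrite taylor_remR_0 by lra. unfold Rdiv. rewrite Rmult_1_l, Rpow_mult_distr, pow_inv. lra.
Qed.

(** * Harmonic functions with explicit partial derivatives *)

Lemma crd_continuous (x : R3) :
  continuous (crd1 : R3 -> R) x /\ continuous (crd2 : R3 -> R) x /\ continuous (crd3 : R3 -> R) x.
Proof.
  repeat split; unfold crd1, crd2, crd3.
  - apply (continuous_comp (fst : R3 -> R * R) fst); apply continuous_fst.
  - apply (continuous_comp (fst : R3 -> R * R) snd); [apply continuous_fst|apply continuous_snd].
  - apply continuous_snd.
Qed.

Lemma continuous_pair {U A B : UniformSpace} (f : U -> A) (g : U -> B) (x : U) :
  continuous f x -> continuous g x -> continuous (fun t => (f t, g t)) x.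
Proof.
  intros Hf Hg. apply (continuous_comp_2 f g pair); [easy|easy|].
  apply (continuous_ext (fun p => p)); [now intros [? ?]|apply continuous_id].
Qed.

Lemma continuous_R3 {U : UniformSpace} (f : U -> R3) (x : U) :
  continuous (fun t => crd1 (f t)) x -> continuous (fun t => crd2 (f t)) x ->
  continuous (fun t => crd3 (f t)) x -> continuous f x.
Proof.
  intros H1 H2 H3.
  apply (continuous_ext (fun t => (crd1 (f t), crd2 (f t), crd3 (f t)))).
  { intros t. now destruct (f t) as [[? ?] ?]. }
  apply continuous_pair; [now apply continuous_pair|easy].
Qed.

Lemma continuous_sqrt_comp {U : UniformSpace} (f : U -> R) (x : U) :
  continuous f x -> continuous (fun t => sqrt (f t)) x.
Proof.
  intros H. apply (continuous_comp f sqrt); [easy|].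
  apply continuous_sqrt.
Qed.

Lemma norm3_continuous (x : R3) : continuous (norm3 : R3 -> R) x.
Proof.
  destruct (crd_continuous x) as (H1 & H2 & H3).
  apply (continuous_sqrt_comp (fun x : R3 => crd1 x ^ 2 + crd2 x ^ 2 + crd3 x ^ 2)).
  apply continuous_Rplus; [apply continuous_Rplus|]; now apply continuous_Rpow.
Qed.

Lemma sub3_continuous (c x : R3) : continuous (fun x : R3 => sub3 x c : R3) x.
Proof.
  destruct (crd_continuous x) as (H1 & H2 & H3).
  apply continuous_R3; (apply continuous_Rminus; [easy|apply continuous_const]).
Qed.

Lemma norm3_sub_continuous c (x : R3) : continuous (fun x : R3 => norm3 (sub3 x c)) x.
Proof. apply (continuous_comp (fun x : R3 => sub3 x c : R3) norm3);
  [apply sub3_continuous|apply norm3_continuous]. Qed.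

Lemma open_ball3 c rho : open (fun x : R3 => norm3 (sub3 x c) < rho).
Proof.
  apply (open_comp (fun x : R3 => norm3 (sub3 x c)) (fun y => y < rho)).
  - intros x _. apply norm3_sub_continuous.
  - apply open_lt.
Qed.

Lemma open_coball3 c rho : open (fun x : R3 => rho < norm3 (sub3 x c)).
Proof.
  apply (open_comp (fun x : R3 => norm3 (sub3 x c)) (fun y => rho < y)).
  - intros x _. apply norm3_sub_continuous.
  - apply open_gt.
Qed.

(** The curves along which [partial] differentiates. *)
Definition move (i : axis) (x : R3) (h : R) : R3 := add3 x (scal3 h (basis3 i)).

Lemma move_0 i x : move i x 0 = x.
Proof.
  destruct x as [[? ?] ?], i; unfold move, add3, scal3, basis3; apply R3_ext;
    unfold crd1, crd2, crd3; simpl; ring.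
Qed.

Lemma move_continuous i x h : continuous (move i x : R -> R3) h.
Proof.
  apply continuous_R3; unfold move, add3, scal3; simpl;
    (apply continuous_Rplus; [apply continuous_const|]);
    (apply continuous_Rmult; [apply continuous_id|apply continuous_const]).
Qed.

Lemma move_locally i (D : R3 -> Prop) x : open D -> D x -> locally 0 (fun h => D (move i x h)).
Proof.
  intros HD Hx. apply (move_continuous i x 0 D). rewrite move_0. now apply HD.
Qed.

Section RealJet.
Variables (D : R3 -> Prop) (u : R3 -> R) (g : axis -> R3 -> R) (h : axis -> axis -> R3 -> R).
Hypothesis HD : open D.
Hypothesis Hg : forall i x, D x -> is_derive (fun t => u (move i x t)) 0 (g i x).
Hypothesis Hh : forall i j x, D x -> is_derive (fun t => g i (move j x t)) 0 (h i j x).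
Hypothesis Cg : forall i x, D x -> continuous (g i) x.
Hypothesis Ch : forall i j x, D x -> continuous (h i j) x.

Lemma partial_jet i x : D x -> partial i u x = g i x.
Proof. intros Hx. apply is_derive_unique. now apply Hg. Qed.

Lemma partial2_is_derive i j x : D x -> is_derive (slice j (partial i u) x) 0 (h i j x).
Proof.
  intros Hx. apply (is_derive_ext_loc (fun t => g i (move j x t))); [|now apply Hh].
  generalize (move_locally j D x HD Hx). apply filter_imp. intros t Ht.
  symmetry. now apply partial_jet.
Qed.

(** The iterated partial derivatives are total functions that are known only on
    [D]; openness of [D] makes them agree with [g] and [h] near each point,
    which is what differentiating again requires. *)
Lemma real_jet_harmonic :
  (forall x, D x -> h ax1 ax1 x + h ax2 ax2 x + h ax3 ax3 x = 0) -> real_harmonic_on D u.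
Proof.
  intros HL.
  assert (P2 : forall i j x, D x -> partial j (partial i u) x = h i j x).
  { intros i j x Hx. apply is_derive_unique. now apply partial2_is_derive. }
  split; [split|].
  - intros i x Hx. split; [eexists; now apply Hg|].
    apply (continuous_ext_loc _ (g i)); [|now apply Cg].
    generalize (HD x Hx). apply filter_imp. intros y Hy. symmetry. now apply partial_jet.
  - intros i j x Hx. split; [eexists; now apply partial2_is_derive|].
    apply (continuous_ext_loc _ (h i j)); [|now apply Ch].
    generalize (HD x Hx). apply filter_imp. intros y Hy. symmetry. now apply P2.
  - intros x Hx. unfold laplacian. rewrite !P2 by easy. now apply HL.
Qed.
End RealJet.

Definition is_cderive (f : R -> C) (x : R) (l : C) : Prop :=
  is_derive (fun t => Re (f t)) x (Re l) /\ is_derive (fun t => Im (f t)) x (Im l).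

Lemma is_cderive_const a x : is_cderive (fun _ => a) x (RtoC 0).
Proof. split; apply (is_derive_const (V := R_NormedModule)). Qed.

Lemma is_cderive_plus f g x a b : is_cderive f x a -> is_cderive g x b ->
  is_cderive (fun t => (f t + g t)%C) x (a + b)%C.
Proof. intros [? ?] [? ?]; split; simpl; now apply (is_derive_plus (V := R_NormedModule)). Qed.

Lemma is_cderive_mult f g x a b : is_cderive f x a -> is_cderive g x b ->
  is_cderive (fun t => (f t * g t)%C) x (a * g x + f x * b)%C.
Proof.
  assert (HM : forall (p q : R -> R) (p' q' : R), is_derive p x p' -> is_derive q x q' ->
    is_derive (fun t => p t * q t) x (p' * q x + p x * q')).
  { intros p q p' q' Hp Hq. apply (is_derive_mult p q); [easy|easy|intros; apply Rmult_comm]. }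
  intros [Hr Hi] [Kr Ki]; split; simpl.
  - evar_last; [apply (is_derive_minus (V := R_NormedModule)); apply HM; eassumption|].
    change (minus ?x ?y) with (x - y). unfold Re, Im; simpl.
    real_eq. ring.
  - evar_last; [apply (is_derive_plus (V := R_NormedModule)); apply HM; eassumption|].
    change (plus ?x ?y) with (x + y). unfold Re, Im; simpl.
    real_eq. ring.
Qed.

Lemma is_cderive_eq f x a b : is_cderive f x a -> a = b -> is_cderive f x b.
Proof. now intros H <-. Qed.

Definition pderiv (i : axis) (f : R3 -> C) (x : R3) (l : C) : Prop := is_cderive (fun h => f
    (move i x h)) 0 l.

Lemma pderiv_const i a x : pderiv i (fun _ => a) x (RtoC 0).
Proof. apply is_cderive_const. Qed.

Lemma pderiv_plus i f g x a b : pderiv i f x a -> pderiv i g x b ->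
  pderiv i (fun y => (f y + g y)%C) x (a + b)%C.
Proof. apply is_cderive_plus. Qed.

Lemma pderiv_mult i f g x a b : pderiv i f x a -> pderiv i g x b ->
  pderiv i (fun y => (f y * g y)%C) x (a * g x + f x * b)%C.
Proof.
  intros Hf Hg. pose proof (is_cderive_mult _ _ _ _ _ Hf Hg) as H. simpl in H.
  rewrite move_0 in H. exact H.
Qed.

Lemma pderiv_scal i f x a c : pderiv i f x a -> pderiv i (fun y => (c * f y)%C) x (c * a)%C.
Proof.
  intros Hf. apply (is_cderive_eq _ _ (RtoC 0 * f x + c * a)%C); [|ring].
  exact (pderiv_mult i (fun _ => c) f x _ _ (pderiv_const i c x) Hf).
Qed.

Lemma pderiv_ext_loc (D : R3 -> Prop) i f g x a : open D -> D x -> (forall y, D y -> f y = g y) ->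
  pderiv i f x a -> pderiv i g x a.
Proof.
  intros HD Hx Heq [Hr Hi].
  pose proof (move_locally i D x HD Hx) as HL.
  split; [apply (is_derive_ext_loc (fun t => Re (f (move i x t))))|
          apply (is_derive_ext_loc (fun t => Im (f (move i x t))))]; try easy;
    generalize HL; apply filter_imp; intros t Ht; now rewrite Heq.
Qed.

(** [g] and [h] are the first and second partial derivatives of [f] on [D], all
    of them continuous. *)
Definition jet2 (D : R3 -> Prop) (f : R3 -> C) (g : axis -> R3 -> C) (h : axis -> axis -> R3 -> C)
  : Prop :=
  forall x, D x ->
    ccont f x /\
    (forall i, pderiv i f x (g i x) /\ ccont (g i) x) /\
    (forall i j, pderiv j (g i) x (h i j x) /\ ccont (h i j) x).

Definition lap (h : axis -> axis -> R3 -> C) (x : R3) : C :=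
  (h ax1 ax1 x + h ax2 ax2 x + h ax3 ax3 x)%C.

(** A sufficient condition for [harmonic_on] that treats the real and imaginary
    parts together and is closed under the operations used below. *)
Definition charmonic (D : R3 -> Prop) (f : R3 -> C) : Prop :=
  exists g h, jet2 D f g h /\ forall x, D x -> lap h x = RtoC 0.

Lemma charmonic_harmonic_on D f : open D -> charmonic D f -> harmonic_on D f.
Proof.
  intros HD (g & h & HJ & HL). split.
  - apply (real_jet_harmonic D _ (fun i x => Re (g i x)) (fun i j x => Re (h i j x)) HD).
    + intros i x Hx. apply (proj1 (proj2 (HJ x Hx)) i).
    + intros i j x Hx. apply (proj2 (proj2 (HJ x Hx)) i j).
    + intros i x Hx. apply (proj1 (proj2 (HJ x Hx)) i).
    + intros i j x Hx. apply (proj2 (proj2 (HJ x Hx)) i j).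
    + intros x Hx. apply (f_equal Re (HL x Hx)).
  - apply (real_jet_harmonic D _ (fun i x => Im (g i x)) (fun i j x => Im (h i j x)) HD).
    + intros i x Hx. apply (proj1 (proj2 (HJ x Hx)) i).
    + intros i j x Hx. apply (proj2 (proj2 (HJ x Hx)) i j).
    + intros i x Hx. apply (proj1 (proj2 (HJ x Hx)) i).
    + intros i j x Hx. apply (proj2 (proj2 (HJ x Hx)) i j).
    + intros x Hx. apply (f_equal Im (HL x Hx)).
Qed.

Lemma ccont_continuous (f : R3 -> C) x : ccont f x -> continuous f x.
Proof.
  intros [Hr Hi]. apply (continuous_ext (fun t => (Re (f t), Im (f t)))).
  { intros t. now destruct (f t). }
  now apply continuous_pair.
Qed.

Lemma charmonic_continuous D f x : charmonic D f -> D x -> continuous f x.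
Proof. intros (g & h & HJ & _) Hx. exact (ccont_continuous f x (proj1 (HJ x Hx))). Qed.

Lemma charmonic_sub (D D' : R3 -> Prop) f : (forall x, D' x -> D x) -> charmonic D f ->
    charmonic D' f.
Proof. intros H (g & h & HJ & HL). exists g, h. split; intros x Hx; [apply HJ|apply HL]; auto.
    Qed.

Lemma charmonic_zero D : charmonic D (fun _ => RtoC 0).
Proof.
  exists (fun _ _ => RtoC 0), (fun _ _ _ => RtoC 0). split.
  - intros x _. split; [apply ccont_const|].
    split; intros; (split; [apply pderiv_const|apply ccont_const]).
  - intros x _. unfold lap. ring.
Qed.

Lemma charmonic_plus D f f' : charmonic D f -> charmonic D f' -> charmonic D (fun x => (f x + f'
    x)%C).
Proof.
  intros (g & h & HJ & HL) (g' & h' & HJ' & HL').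
  exists (fun i x => (g i x + g' i x)%C), (fun i j x => (h i j x + h' i j x)%C). split.
  - intros x Hx. destruct (HJ x Hx) as (A & B & Cc). destruct (HJ' x Hx) as (A' & B' & C').
    split; [now apply ccont_plus|]. split.
    + intros i. destruct (B i), (B' i). split; [now apply pderiv_plus|now apply ccont_plus].
    + intros i j. destruct (Cc i j), (C' i j). split; [now apply pderiv_plus|now apply
        ccont_plus].
  - intros x Hx. specialize (HL x Hx). specialize (HL' x Hx). unfold lap in *.
    transitivity (RtoC 0 + RtoC 0)%C; [rewrite <- HL at 1; rewrite <- HL'; ring|ring].
Qed.

Lemma charmonic_scal D f a : charmonic D f -> charmonic D (fun x => (a * f x)%C).
Proof.
  intros (g & h & HJ & HL).
  exists (fun i x => (a * g i x)%C), (fun i j x => (a * h i j x)%C). split.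
  - intros x Hx. destruct (HJ x Hx) as (A & B & Cc).
    assert (HS : forall k, ccont k x -> ccont (fun y => (a * k y)%C) x).
    { intros k Hk. apply ccont_mult; [apply ccont_const|easy]. }
    split; [now apply HS|]. split.
    + intros i. destruct (B i). split; [now apply pderiv_scal|now apply HS].
    + intros i j. destruct (Cc i j). split; [now apply pderiv_scal|now apply HS].
  - intros x Hx. specialize (HL x Hx). unfold lap in *.
    transitivity (a * RtoC 0)%C; [rewrite <- HL; ring|ring].
Qed.

Lemma charmonic_Csum D (f : nat -> R3 -> C) n :
  (forall i, (i < n)%nat -> charmonic D (f i)) -> charmonic D (fun x => Csum (fun i => f i x) n).
Proof.
  induction n as [|n IH]; intros H; simpl; [apply charmonic_zero|].
  apply charmonic_plus; [apply IH; intros; apply H|apply H]; lia.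
Qed.

Lemma charmonic_ext D f f' : open D -> (forall x, D x -> f x = f' x) -> charmonic D f ->
    charmonic D f'.
Proof.
  intros HD Heq (g & h & HJ & HL). exists g, h. split; [|easy].
  intros x Hx. destruct (HJ x Hx) as (A & B & Cc). split; [|split; [|easy]].
  - destruct A as [Ar Ai]. split;
    [apply (continuous_ext_loc _ (fun t => Re (f t)))|apply (continuous_ext_loc _ (fun t => Im
        (f t)))];
    try easy; generalize (HD x Hx); apply filter_imp; intros y Hy; now rewrite Heq.
  - intros i. destruct (B i). split; [|easy]. now apply (pderiv_ext_loc D i f f').
Qed.

Lemma charmonic_translate (D : R3 -> Prop) f c : charmonic D f ->
  charmonic (fun x => D (sub3 x c)) (fun x => f (sub3 x c)).
Proof.
  intros (g & h & HJ & HL).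
  exists (fun i x => g i (sub3 x c)), (fun i j x => h i j (sub3 x c)).
  assert (HP : forall i k x l, pderiv i k (sub3 x c) l -> pderiv i (fun y => k (sub3 y c)) x l).
  { intros i k x l [Hr Hi]. unfold pderiv, is_cderive.
    assert (E : forall t, sub3 (move i x t) c = move i (sub3 x c) t).
    { intros t. destruct i; apply R3_ext; unfold move, sub3, add3, scal3, basis3, crd1, crd2,
        crd3;
        simpl; ring. }
    split; (eapply is_derive_ext; [intros t; rewrite E; reflexivity|easy]). }
  assert (HC : forall k x, ccont k (sub3 x c) -> ccont (fun y : R3 => k (sub3 y c)) x).
  { intros k x [Hr Hi]. split;
    [apply (continuous_comp (fun x : R3 => sub3 x c : R3) (fun y => Re (k y)))|
     apply (continuous_comp (fun x : R3 => sub3 x c : R3) (fun y => Im (k y)))]; try easy;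
    apply sub3_continuous. }
  split.
  - intros x Hx. destruct (HJ _ Hx) as (A & B & Cc). split; [now apply HC|]. split.
    + intros i. destruct (B i). split; [now apply HP|now apply HC].
    + intros i j. destruct (Cc i j). split; [now apply HP|now apply HC].
  - intros x Hx. apply (HL _ Hx).
Qed.

(** * The solid harmonics are harmonic *)

(** The operator that differentiation along an axis performs on the family
    [hpoly n]: multiplication of generating functions by the derivative of
    [w h + 2 z - conj w / h], acting by shifts of the index. *)
Definition hpoly_shift (i : axis) (F : Z -> C) (m : Z) : C :=
  match i with
  | ax1 => (F (m - 1)%Z - F (m + 1)%Z)%C
  | ax2 => (Ci * (F (m - 1)%Z + F (m + 1)%Z))%C
  | ax3 => (RtoC 2 * F m)%C
  end.

Definition grad_hpoly (i : axis) (n : nat) (m : Z) (x : R3) : C :=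
  match n with
  | O => RtoC 0
  | S k => (RtoC (INR (S k)) * hpoly_shift i (fun m => hpoly k m x) m)%C
  end.

Definition hess_hpoly (i j : axis) (n : nat) (m : Z) (x : R3) : C :=
  match n with
  | O => RtoC 0
  | S k => (RtoC (INR (S k)) * hpoly_shift i (fun m => grad_hpoly j k m x) m)%C
  end.

Lemma hpoly_S n m x : hpoly (S n) m x =
  (planar x * hpoly n (m - 1) x + RtoC (2 * crd3 x) * hpoly n m x + - Cconj (planar x) * hpoly n
      (m + 1) x)%C.
Proof. reflexivity. Qed.

Lemma crd_derive i x : pderiv i planar x (match i with ax1 => RtoC 1 | ax2 => Ci | ax3 => RtoC 0
    end)
  /\ pderiv i (fun x => RtoC (2 * crd3 x)) x (match i with ax3 => RtoC 2 | _ => RtoC 0 end)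
  /\ pderiv i (fun x => (- Cconj (planar x))%C) x
      (match i with ax1 => (- RtoC 1)%C | ax2 => Ci | ax3 => RtoC 0 end).
Proof.
  destruct i, x as [[x1 x2] x3]; unfold pderiv, is_cderive, move, planar, add3, scal3, basis3,
      crd1, crd2, crd3;
    simpl; (split; [|split]); split; (auto_derive; [easy|simpl; ring]).
Qed.

Lemma hpoly_shift_pderiv i j (F : Z -> R3 -> C) (G : Z -> C) m x :
  (forall m, pderiv j (F m) x (G m)) -> pderiv j (fun y => hpoly_shift i (fun m => F m y) m) x
      (hpoly_shift i G m).
Proof.
  intros H. destruct i; simpl.
  - replace (G (m - 1)%Z - G (m + 1)%Z)%C with
      (G (m - 1)%Z + - RtoC 1 * G (m + 1)%Z)%C by ring.
    pose proof (pderiv_plus j _ _ x _ _ (H (m - 1)%Z) (pderiv_scal j _ x _ (- RtoC 1)%C (H (m +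
        1)%Z))) as HP.
    destruct HP as [Hr Hi].
    split; [eapply is_derive_ext; [|exact Hr]|eapply is_derive_ext; [|exact Hi]];
      intros t; simpl; real_eq; ring.
  - apply pderiv_scal, pderiv_plus; apply H.
  - apply pderiv_scal, H.
Qed.

(** The power rule for the [n]-th power of [w h + 2 z - conj w / h], read off
    coefficient by coefficient. *)
Lemma hpoly_pderiv i n m x : pderiv i (hpoly n m) x (grad_hpoly i n m x).
Proof.
  revert m; induction n as [|n IH]; intros m.
  - exact (pderiv_const i (tri 0 m (RtoC 0) (RtoC 0) (RtoC 0)) x).
  - destruct (crd_derive i x) as (Dw & Dz & Dc).
    pose proof (pderiv_plus i _ _ x _ _ (pderiv_plus i _ _ x _ _
      (pderiv_mult i _ _ x _ _ Dw (IH (m - 1)%Z)) (pderiv_mult i _ _ x _ _ Dz (IH m)))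
      (pderiv_mult i _ _ x _ _ Dc (IH (m + 1)%Z))) as HP.
    apply (is_cderive_eq _ _ _ _ HP).
    unfold grad_hpoly at 4. rewrite S_INR, RtoC_plus.
    assert (HG : (planar x * grad_hpoly i n (m - 1) x + RtoC (2 * crd3 x) * grad_hpoly i n m x +
        - Cconj (planar x) * grad_hpoly i n (m + 1) x)%C
        = (RtoC (INR n) * hpoly_shift i (fun m => hpoly n m x) m)%C).
    { destruct n as [|n].
      - simpl. ring.
      - unfold grad_hpoly. destruct i; unfold hpoly_shift; rewrite !hpoly_S;
          replace (m - 1 + 1)%Z with m by lia; replace (m + 1 - 1)%Z with m by lia; ring. }
    rewrite Cmult_plus_distr_r, <- HG.
    destruct i; unfold hpoly_shift; ring.
Qed.

Lemma grad_hpoly_pderiv i j n m x : pderiv j (grad_hpoly i n m) x (hess_hpoly i j n m x).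
Proof.
  destruct n as [|n]; [exact (pderiv_const j (RtoC 0) x)|].
  exact (pderiv_scal j _ x _ _ (hpoly_shift_pderiv i j (hpoly n) (fun k => grad_hpoly j n k x) m
      x (fun k => hpoly_pderiv j n k x))).
Qed.

(** The identity [(h - 1 / h) ^ 2 - (h + 1 / h) ^ 2 + 4 = 0], which says that
    the gradient of [w h + 2 z - conj w / h] is a null vector. *)
Lemma shift_lap (a b c : C) k l :
  (k * (l * (a - b) - l * (b - c)) + k * (Ci * (l * (Ci * (a + b)) + l * (Ci * (b + c)))) + k *
      (RtoC 2 * (l * (RtoC 2 * b))))%C = RtoC 0.
Proof.
  transitivity (k * l * (a - b - (b - c) + RtoC 4 * b) + Ci * Ci * (k * l * (a + b + (b +
      c))))%C; [ring|].
  replace (Ci * Ci)%C with (- RtoC 1)%C by (apply C_ext; simpl; ring). ring.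
Qed.

Lemma lap_hpoly n m x : lap (fun i j y => hess_hpoly i j n m y) x = RtoC 0.
Proof.
  unfold lap, hess_hpoly. destruct n as [|[|n]].
  - ring.
  - unfold grad_hpoly, hpoly_shift. ring.
  - unfold grad_hpoly, hpoly_shift.
    replace (m - 1 + 1)%Z with m by lia. replace (m + 1 - 1)%Z with m by lia.
    apply shift_lap.
Qed.

(** Euler's identity for a homogeneous polynomial. *)
Lemma euler_hpoly n m x :
  (RtoC (crd1 x) * grad_hpoly ax1 n m x + RtoC (crd2 x) * grad_hpoly ax2 n m x + RtoC (crd3 x) *
      grad_hpoly ax3 n m x)%C = (RtoC (INR n) * hpoly n m x)%C.
Proof.
  destruct n as [|n]; [simpl; ring|].
  rewrite hpoly_S. unfold grad_hpoly, hpoly_shift.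
  replace (planar x) with (RtoC (crd1 x) + Ci * RtoC (crd2 x))%C
    by (apply C_ext; unfold planar; simpl; ring).
  replace (- Cconj _)%C with (- RtoC (crd1 x) + Ci * RtoC (crd2 x))%C
    by (apply C_ext; simpl; ring).
  rewrite RtoC_mult. ring.
Qed.

Lemma hpoly_ccont n m (x : R3) : ccont (hpoly n m) x.
Proof.
  destruct (crd_continuous x) as (H1 & H2 & H3).
  revert m; induction n as [|n IH]; intros m.
  - apply ccont_const.
  - apply (ccont_ext _ _ x (fun y => eq_sym (hpoly_S n m y))).
    apply ccont_plus; [apply ccont_plus|]; (apply ccont_mult; [|apply IH]).
    + now apply ccont_pair.
    + apply ccont_real. apply continuous_Rmult; [apply continuous_const|easy].
    + apply ccont_opp. apply (ccont_pair (fun x : R3 => crd1 x) (fun x : R3 => - crd2 x));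
        [easy|now apply continuous_Ropp].
Qed.

Lemma hpoly_shift_ccont i (F : Z -> R3 -> C) m (x : R3) :
  (forall m, ccont (F m) x) -> ccont (fun y => hpoly_shift i (fun m => F m y) m) x.
Proof.
  intros H. destruct i; simpl; [now apply ccont_minus| |];
    (apply ccont_mult; [apply ccont_const|]); [now apply ccont_plus|easy].
Qed.

Lemma grad_hpoly_ccont i n m (x : R3) : ccont (grad_hpoly i n m) x.
Proof.
  destruct n as [|n]; [exact (ccont_const (RtoC 0) x)|].
  exact (ccont_mult _ _ x (ccont_const _ x) (hpoly_shift_ccont i (hpoly n) m x (fun k =>
      hpoly_ccont n k x))).
Qed.

Lemma hess_hpoly_ccont i j n m (x : R3) : ccont (hess_hpoly i j n m) x.
Proof.
  destruct n as [|n]; [exact (ccont_const (RtoC 0) x)|].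
  exact (ccont_mult _ _ x (ccont_const _ x) (hpoly_shift_ccont i (grad_hpoly j n) m x (fun k =>
      grad_hpoly_ccont j n k x))).
Qed.

Lemma charmonic_hpoly D n m : charmonic D (hpoly n m).
Proof.
  exists (fun i => grad_hpoly i n m), (fun i j => hess_hpoly i j n m). split.
  - intros x _. split; [apply hpoly_ccont|]. split.
    + intros i. split; [apply hpoly_pderiv|apply grad_hpoly_ccont].
    + intros i j. split; [apply grad_hpoly_pderiv|apply hess_hpoly_ccont].
  - intros x _. apply lap_hpoly.
Qed.

(** * Kelvin transforms of the solid harmonics *)

Definition crd (i : axis) (x : R3) : R :=
  match i with ax1 => crd1 x | ax2 => crd2 x | ax3 => crd3 x end.

Definition kron (i j : axis) : R :=
  match i, j with ax1, ax1 | ax2, ax2 | ax3, ax3 => 1 | _, _ => 0 end.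

Definition inv_norm (a : nat) (x : R3) : C := RtoC (/ norm3 x ^ a).

Definition grad_inv_norm (a : nat) (i : axis) (x : R3) : C :=
  (RtoC (- INR a) * (RtoC (crd i x) * inv_norm (a + 2) x))%C.

Definition hess_inv_norm (a : nat) (i j : axis) (x : R3) : C :=
  (RtoC (- INR a) * (RtoC (kron i j) * inv_norm (a + 2) x + RtoC (crd i x) * grad_inv_norm (a +
      2) j x))%C.

Lemma crd_pderiv i j x : pderiv j (fun y => RtoC (crd i y)) x (RtoC (kron i j)).
Proof.
  destruct i, j, x as [[x1 x2] x3];
  unfold pderiv, is_cderive, move, add3, scal3, basis3, crd, crd1, crd2, crd3, kron;
    simpl; split; auto_derive; try easy; simpl; ring.
Qed.

Lemma norm3_derive i x : norm3 x <> 0 ->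
  is_derive (fun t => norm3 (move i x t)) 0 (crd i x / norm3 x).
Proof.
  intros H. pose proof (norm3_pos x) as Hp. pose proof (norm3_sqr x) as H2.
  assert (Hs : 0 < crd1 x ^ 2 + crd2 x ^ 2 + crd3 x ^ 2) by (rewrite <- H2; nra).
  assert (E : norm3 x = sqrt (crd1 x ^ 2 + crd2 x ^ 2 + crd3 x ^ 2)) by easy.
  apply (is_derive_ext (fun t => sqrt (crd1 x ^ 2 + crd2 x ^ 2 + crd3 x ^ 2 + 2 * t * crd i x +
      t ^ 2))).
  { intros t. unfold norm3. f_equal.
    destruct i; unfold move, add3, scal3, basis3, crd, crd1, crd2, crd3; simpl;
    real_eq; ring. }
  auto_derive.
  - replace (_ + _) with (crd1 x ^ 2 + crd2 x ^ 2 + crd3 x ^ 2) by ring. easy.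
  - replace (crd1 x * (crd1 x * 1) + crd2 x * (crd2 x * 1) + crd3 x * (crd3 x * 1) +
       2 * 0 * crd i x + 0 * (0 * 1)) with (crd1 x ^ 2 + crd2 x ^ 2 + crd3 x ^ 2) by ring.
    rewrite <- E. field. easy.
Qed.

Lemma inv_norm_pderiv a i x : norm3 x <> 0 -> pderiv i (inv_norm a) x (grad_inv_norm a i x).
Proof.
  intros H. unfold pderiv, is_cderive, inv_norm; simpl. split.
  - pose proof (norm3_derive i x H) as Hd.
    evar_last.
    + apply (is_derive_inv (fun t => norm3 (move i x t) ^ a)).
      * apply is_derive_pow, Hd.
      * rewrite move_0. now apply pow_nonzero.
    + transitivity (- INR a * (crd i x * / norm3 x ^ (a + 2))).
      2:{ unfold grad_inv_norm, inv_norm, Re; cbn [fst snd RtoC Cmult]. ring. }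
      rewrite move_0. replace (a + 2)%nat with (S (S a)) by lia.
      real_eq.
      destruct a as [|a].
      * simpl. field. easy.
      * assert (norm3 x ^ a <> 0) by now apply pow_nonzero.
        cbn [pred]. rewrite <- !tech_pow_Rmult. field. easy.
  - evar_last; [apply (is_derive_const (V := R_NormedModule))|].
    unfold grad_inv_norm, inv_norm; simpl. real_eq.
    change zero with 0. ring.
Qed.

Lemma grad_inv_norm_pderiv a i j x : norm3 x <> 0 -> pderiv j (grad_inv_norm a i) x
    (hess_inv_norm a i j x).
Proof.
  intros H. apply pderiv_scal.
  apply (pderiv_mult j (fun y => RtoC (crd i y)) (inv_norm (a + 2))); [apply crd_pderiv|now
      apply inv_norm_pderiv].
Qed.

Lemma inv_norm_ccont a (x : R3) : norm3 x <> 0 -> ccont (inv_norm a) x.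
Proof.
  intros H. apply (ccont_real (fun y : R3 => / norm3 y ^ a)). apply continuous_Rinv'.
  - now apply pow_nonzero.
  - apply (continuous_Rpow (norm3 : R3 -> R)), norm3_continuous.
Qed.

Lemma crd_ccont i (x : R3) : ccont (fun y : R3 => RtoC (crd i y)) x.
Proof. apply (ccont_real (fun y : R3 => crd i y)). destruct i; apply (crd_continuous x). Qed.

Lemma grad_inv_norm_ccont a i (x : R3) : norm3 x <> 0 -> ccont (grad_inv_norm a i) x.
Proof.
  intros H. apply ccont_mult; [apply ccont_const|].
  apply ccont_mult; [apply crd_ccont|now apply inv_norm_ccont].
Qed.

Lemma hess_inv_norm_ccont a i j (x : R3) : norm3 x <> 0 -> ccont (hess_inv_norm a i j) x.
Proof.
  intros H. apply ccont_mult; [apply ccont_const|].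
  apply ccont_plus; apply ccont_mult;
    [apply ccont_const|now apply inv_norm_ccont|apply crd_ccont|now apply grad_inv_norm_ccont].
Qed.

Lemma jet2_mult D f f' g g' h h' : jet2 D f g h -> jet2 D f' g' h' ->
  jet2 D (fun x => (f x * f' x)%C)
    (fun i x => (g i x * f' x + f x * g' i x)%C)
    (fun i j x => (h i j x * f' x + g i x * g' j x + (g j x * g' i x + f x * h' i j x))%C).
Proof.
  intros HJ HJ' x Hx. destruct (HJ x Hx) as (A & B & Cc). destruct (HJ' x Hx) as (A' & B' & C').
  split; [now apply ccont_mult|]. split.
  - intros i. destruct (B i), (B' i). split; [now apply pderiv_mult|].
    apply ccont_plus; now apply ccont_mult.
  - intros i j. destruct (B i), (B' i), (B j), (B' j), (Cc i j), (C' i j). split.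
    + apply (pderiv_plus j (fun y => (g i y * f' y)%C) (fun y => (f y * g' i y)%C));
        now apply pderiv_mult.
    + apply ccont_plus; apply ccont_plus; apply ccont_mult; assumption.
Qed.

Lemma jet2_hpoly D n m : jet2 D (hpoly n m) (fun i => grad_hpoly i n m) (fun i j => hess_hpoly i
    j n m).
Proof.
  intros x _. split; [apply hpoly_ccont|]. split.
  - intros i. split; [apply hpoly_pderiv|apply grad_hpoly_ccont].
  - intros i j. split; [apply grad_hpoly_pderiv|apply hess_hpoly_ccont].
Qed.

Lemma jet2_inv_norm a : jet2 (fun x => norm3 x <> 0) (inv_norm a) (grad_inv_norm a)
    (hess_inv_norm a).
Proof.
  intros x Hx. split; [now apply inv_norm_ccont|]. split.
  - intros i. split; [now apply inv_norm_pderiv|now apply grad_inv_norm_ccont].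
  - intros i j. split; [now apply grad_inv_norm_pderiv|now apply hess_inv_norm_ccont].
Qed.

(** By Euler's identity the Laplacian of the product with [|x| ^ (- a)] is a
    multiple of [2 n + 1 - a]. *)
Lemma charmonic_Kelvin n m : charmonic (fun x => norm3 x <> 0) (fun x => (hpoly n m x * inv_norm
    (2 * n + 1) x)%C).
Proof.
  eexists _, _. split; [apply jet2_mult; [apply (jet2_hpoly _ n m)|apply jet2_inv_norm]|].
  intros x Hx. unfold lap. set (a := (2 * n + 1)%nat).
  pose proof (lap_hpoly n m x) as HL. unfold lap in HL.
  pose proof (euler_hpoly n m x) as HE.
  unfold hess_inv_norm, grad_inv_norm, kron, crd.
  assert (HN : inv_norm (a + 2) x = (RtoC (crd1 x ^ 2 + crd2 x ^ 2 + crd3 x ^ 2) * inv_norm (a +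
      2 + 2) x)%C).
  { unfold inv_norm. rewrite <- norm3_sqr, <- RtoC_mult. f_equal.
    rewrite (pow_add _ (a + 2) 2). field. split; [easy|now apply pow_nonzero]. }
  rewrite !plus_INR.
  set (P4 := inv_norm (a + 2 + 2) x) in *. set (P2 := inv_norm (a + 2) x) in *.
  set (h11 := hess_hpoly ax1 ax1 n m x) in *. set (h22 := hess_hpoly ax2 ax2 n m x) in *. set
      (h33 := hess_hpoly ax3 ax3 n m x) in *.
  set (g1 := grad_hpoly ax1 n m x) in *. set (g2 := grad_hpoly ax2 n m x) in *. set (g3 :=
      grad_hpoly ax3 n m x) in *.
  set (v := hpoly n m x) in *. set (P := inv_norm a x).
  rewrite !RtoC_plus, ?RtoC_pow in HN.
  transitivity ((h11 + h22 + h33) * P + RtoC (- INR a) * (RtoC 2 * (RtoC (crd1 x) * g1 + RtoC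
      (crd2 x) * g2 + RtoC (crd3 x) * g3) * P2 + v * (RtoC 3 * P2 - RtoC (INR a + 2) * ((RtoC
      (crd1 x) ^ 2 + RtoC (crd2 x) ^ 2 + RtoC (crd3 x) ^ 2) * P4))))%C.
  { rewrite !RtoC_opp, !RtoC_plus. simpl (INR 2). rewrite !RtoC_plus. simpl Cpow. ring. }
  rewrite HL, HE, <- HN. unfold a. rewrite plus_INR, mult_INR. simpl (INR 2). simpl (INR 1).
  rewrite !RtoC_opp, !RtoC_plus, !RtoC_mult, !RtoC_plus. ring.
Qed.

(** * Series of harmonics from circle averages *)

Lemma harm_sum_plus n a b x : harm_sum n (fun m => (a m + b m)%C) x = (harm_sum n a x + harm_sum
    n b x)%C.
Proof. unfold harm_sum. rewrite <- Csum_plus. apply Csum_ext. intros k _. cbv zeta. ring. Qed.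

Lemma harm_sum_zero n x : harm_sum n (fun _ => RtoC 0) x = RtoC 0.
Proof. unfold harm_sum. apply Csum_zero. intros; cbv zeta; ring. Qed.

Lemma harm_sum_Csum n (a : nat -> Z -> C) P x :
  harm_sum n (fun m => Csum (fun i => a i m) P) x = Csum (fun i => harm_sum n (a i) x) P.
Proof.
  induction P as [|P IH]; simpl; [apply harm_sum_zero|]. now rewrite harm_sum_plus, IH.
Qed.

Lemma sphere_series_ext c f rho a b :
  (forall n m, (Z.abs m <= Z.of_nat n)%Z -> a n m = b n m) -> sphere_series c f rho a ->
      sphere_series c f rho b.
Proof.
  intros H (eps & N0 & He & HR). exists eps, N0. split; [easy|]. intros N y HN Hy.
  rewrite <- (Csum_ext (fun n => harm_sum n (a n) y) (fun n => harm_sum n (b n) y)); [now apply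
      HR|].
  intros n _. apply harm_sum_ext. intros; now apply H.
Qed.

Lemma sphere_series_ext_f c f g rho a :
  (forall y, norm3 y = rho -> f (add3 c y) = g (add3 c y)) -> sphere_series c f rho a ->
      sphere_series c g rho a.
Proof.
  intros H (eps & N0 & He & HR). exists eps, N0. split; [easy|]. intros N y HN Hy.
  rewrite <- H by easy. now apply HR.
Qed.

Lemma sphere_series_zero c rho : sphere_series c (fun _ => RtoC 0) rho (fun _ _ => RtoC 0).
Proof.
  exists (fun _ => 0), O. split; [apply is_lim_seq_const|]. intros N y _ _.
  rewrite Csum_zero by (intros; apply harm_sum_zero).
  replace (_ - _)%C with (RtoC 0) by ring. rewrite Cmod_0; lra.
Qed.

Lemma sphere_series_plus c f g rho a b : sphere_series c f rho a -> sphere_series c g rho b ->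
  sphere_series c (fun x => (f x + g x)%C) rho (fun n m => (a n m + b n m)%C).
Proof.
  intros (e1 & N1 & He1 & H1) (e2 & N2 & He2 & H2).
  exists (fun N => e1 N + e2 N), (Nat.max N1 N2). split.
  - replace (Finite 0) with (Finite (0 + 0)) by (f_equal; ring). now apply is_lim_seq_plus'.
  - intros N y HN Hy. rewrite (Csum_ext _ (fun n => (harm_sum n (a n) y + harm_sum n (b n) y)%C))
      by (intros; apply harm_sum_plus).
    rewrite Csum_plus.
    replace (_ - _)%C with (f (add3 c y) - Csum (fun n => harm_sum n (a n) y) N + (g (add3 c y)
        - Csum (fun n => harm_sum n (b n) y) N))%C by ring.
    eapply Rle_trans; [apply Cmod_triangle|].
    apply Rplus_le_compat; [apply H1|apply H2]; (easy || lia).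
Qed.

Lemma sphere_series_Csum c (f : nat -> R3 -> C) rho (a : nat -> nat -> Z -> C) P :
  (forall i, (i < P)%nat -> sphere_series c (f i) rho (a i)) ->
  sphere_series c (fun x => Csum (fun i => f i x) P) rho (fun n m => Csum (fun i => a i n m) P).
Proof.
  induction P as [|P IH]; intros H; simpl; [apply sphere_series_zero|].
  apply sphere_series_plus; [apply IH; intros; apply H|apply H]; lia.
Qed.

Lemma sphere_series_polynomial c f rho a P :
  (forall y, f (add3 c y) = Csum (fun n => harm_sum n (a n) y) P) ->
  (forall n m, (P <= n)%nat -> a n m = RtoC 0) -> sphere_series c f rho a.
Proof.
  intros Hf Ha. exists (fun _ => 0), P. split; [apply is_lim_seq_const|]. intros N y HN _.
  rewrite Hf.
  replace (Csum _ N) with (Csum (fun n => harm_sum n (a n) y) P).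
  - replace (_ - _)%C with (RtoC 0) by ring. rewrite Cmod_0; lra.
  - induction HN as [|N HN IH]; [easy|]. simpl. rewrite <- IH.
    rewrite (harm_sum_ext N (a N) (fun _ => RtoC 0)) by (intros; now apply Ha).
    rewrite harm_sum_zero. ring.
Qed.

Lemma Csum_taylor_rem j N b s :
  Csum (fun n => (RtoC (binom n j) * / b ^ (n + j + 1) * s ^ n)%C) N =
  (/ (b - s) ^ S j - taylor_rem j N b s)%C.
Proof.
  unfold taylor_rem. rewrite (Csum_ext _ (fun n => (RtoC (binom n j) * (s ^ n * / b ^ (n + j +
      1)))%C)) by (intros; ring). ring.
Qed.

(** Averaging the expansion of [1 / (bs - u) ^ (j + 1)] in powers of [u]. *)
Lemma circle_avg_taylor_rem (j N : nat) (w bs u : R -> C) (W b0 s0 : R) :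
  (forall t, ccont w t) -> (forall t, ccont bs t) -> (forall t, ccont u t) ->
  (forall t, Cmod (w t) <= W) -> (forall t, b0 <= Cmod (bs t)) -> (forall t, Cmod (u t) <= s0) ->
  0 <= s0 -> s0 < b0 ->
  Cmod (circle_avg (fun t => (w t * / (bs t - u t) ^ S j)) - Csum (fun n => circle_avg (fun t =>
      (w t * (RtoC (binom n j) * / bs t ^ (n + j + 1) * u t ^ n)))) N)%C
  <= W * taylor_remR j N b0 s0.
Proof.
  intros Cw Cbs Cu HW Hb0 Hs0 Hs Hlt.
  assert (Hbnz : forall t, bs t <> RtoC 0) by (intros t; apply Cmod_neq0; specialize (Hb0 t);
      lra).
  assert (Hnz : forall t, (bs t - u t)%C <> RtoC 0).
  { intros t. apply Cmod_neq0. pose proof (Cmod_minus_ge (bs t) (u t)).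
    specialize (Hs0 t); specialize (Hb0 t). lra. }
  assert (Hcf : forall t, ccont (fun t => (w t * / (bs t - u t) ^ S j)%C) t).
  { intros t. ccont_auto. }
  assert (Hct : forall n t, ccont (fun t => (w t * (RtoC (binom n j) * / bs t ^ (n + j + 1) * u
      t ^ n))%C) t).
  { intros n t. ccont_auto. }
  rewrite <- circle_avg_Csum by (intros; apply Hct).
  rewrite <- circle_avg_minus; [|exact Hcf|intros t; ccont_auto].
  apply circle_avg_bound; [intros t; ccont_auto|].
  intros t. rewrite Csum_scal, Csum_taylor_rem.
  replace (_ - _)%C with (w t * taylor_rem j N (bs t) (u t))%C by ring.
  rewrite Cmod_mult. apply Rmult_le_compat; try apply Cmod_ge_0; [apply HW|].
  apply taylor_rem_majorant; [lra|lra|apply Hb0|apply Hs0].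
Qed.

(** The case [j = 0] along a ray [l u]: the error is of order [l ^ N], as
    [taylor_unique] requires. *)
Lemma circle_avg_geometric (N : nat) (bs u : R -> C) (l b0 s0 : R) :
  (forall t, ccont bs t) -> (forall t, ccont u t) ->
  (forall t, b0 <= Cmod (bs t)) -> (forall t, Cmod (u t) <= s0) ->
  0 <= s0 -> s0 < b0 -> 0 < l <= 1 ->
  Cmod (circle_avg (fun t => / (bs t - RtoC l * u t)) -
    Csum (fun n => (RtoC (l ^ n) * circle_avg (fun t => (/ bs t ^ S n * u t ^ n)))) N)%C
  <= l ^ N * taylor_remR 0 N b0 s0.
Proof.
  intros Cbs Cu Hb Hu Hs Hlt Hl.
  assert (Hbnz : forall t, bs t <> RtoC 0) by (intros t; apply Cmod_neq0; specialize (Hb t); lra).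
  assert (Hls : 0 <= l * s0 <= s0) by nra.
  eapply Rle_trans; [|apply taylor_remR_shrink; lra].
  rewrite <- (Rmult_1_l (taylor_remR _ _ _ _)).
  rewrite (circle_avg_ext _ (fun t => (RtoC 1 * / (bs t - RtoC l * u t) ^ 1)%C))
    by (intros t; simpl (_ ^ 1)%C; now rewrite Cmult_1_l, Cmult_1_r).
  rewrite (Csum_ext _ (fun n => circle_avg (fun t => (RtoC 1 *
    (RtoC (binom n 0) * / bs t ^ (n + 0 + 1) * (RtoC l * u t) ^ n))%C))).
  - apply (circle_avg_taylor_rem 0 N (fun _ => RtoC 1) bs (fun t => (RtoC l * u t)%C)); try
      easy; try lra.
    + intros; apply ccont_const.
    + intros; ccont_auto.
    + intros; rewrite Cmod_1; lra.
    + intros t. rewrite Cmod_mult, Cmod_R, Rabs_pos_eq by lra.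
      apply Rmult_le_compat_l; [lra|easy].
  - intros n _. rewrite <- circle_avg_scal by (intros; ccont_auto).
    apply circle_avg_ext. intros t. rewrite binom_0_r, Cpow_mult_l, RtoC_pow.
    replace (n + 0 + 1)%nat with (S n) by lia. ring.
Qed.

(** The terms of the expanded integrand are powers of a null form, hence their
    averages are harmonic polynomials.  Every series of harmonics below is an
    instance. *)
Lemma circle_avg_sphere_series al be c f rho (j : nat) (w bs : R -> C) (k W b0 : R) :
  (forall t, ccont w t) -> (forall t, ccont bs t) ->
  (forall t, Cmod (w t) <= W) -> (forall t, b0 <= Cmod (bs t)) ->
  0 < rho -> Rabs k * rho < b0 ->
  (forall y, norm3 y = rho -> f (add3 c y) =
     circle_avg (fun t => (w t * / (bs t - RtoC k * null_form al be y t) ^ S j)%C)) ->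
  sphere_series c f rho (fun n => circle_avg_coeff al be (fun t =>
     (w t * RtoC (k ^ n) * (RtoC (binom n j) * / bs t ^ (n + j + 1)))%C) n).
Proof.
  intros Hw Hbs HW Hb0 Hrho Hlt Hf.
  assert (Hk : 0 <= Rabs k * rho) by (apply Rmult_le_pos; [apply Rabs_pos|lra]).
  assert (Hbnz : forall t, bs t <> RtoC 0) by (intros t; apply Cmod_neq0; specialize (Hb0 t);
      lra).
  exists (fun N => W * taylor_remR j N b0 (Rabs k * rho)), O. split.
  { replace (Finite 0) with (Rbar_mult W 0) by (simpl; f_equal; ring).
    apply is_lim_seq_scal_l, taylor_remR_lim; lra. }
  intros N y _ Hy. rewrite Hf by easy.
  rewrite (Csum_ext (fun n => harm_sum n _ y) (fun n => circle_avg (fun t => (w t * (RtoC (binom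
      n j) * / bs t ^ (n + j + 1) * (RtoC k * null_form al be y t) ^ n))%C))).
  - apply circle_avg_taylor_rem; try easy.
    + intros t. ccont_auto.
    + intros t. rewrite Cmod_mult, Cmod_R, <- Hy.
      apply Rmult_le_compat_l; [apply Rabs_pos|apply null_form_bound].
  - intros n _. rewrite <- circle_avg_null_power.
    + apply circle_avg_ext. intros t. rewrite Cpow_mult_l, RtoC_pow. ring.
    + intros t. ccont_auto.
Qed.

(** * Behaviour at a pole *)

Lemma continuous_on_of (D E : R3 -> Prop) (f : R3 -> C) :
  charmonic D f -> (forall x, E x -> D x) -> continuous_on E f.
Proof.
  intros HH HE x Hx. apply (filterlim_filter_le_1 (F := locally x)).
  - apply filter_le_within.
  - exact (charmonic_continuous D f x HH (HE x Hx)).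
Qed.

Lemma Cmod_le_abs z : Cmod z <= Rabs (Re z) + Rabs (Im z).
Proof.
  replace z with (RtoC (Re z) + Ci * RtoC (Im z))%C at 1.
  - eapply Rle_trans; [apply Cmod_triangle|].
    rewrite Cmod_mult, !Cmod_R. replace (Cmod Ci) with 1; [lra|].
    unfold Cmod, Ci; simpl. replace (0 * (0 * 1) + 1 * (1 * 1)) with 1 by ring. now rewrite
        sqrt_1.
  - apply C_ext; simpl; ring.
Qed.

(** A function continuous on a set stays bounded along a segment of it, up to
    the end point, even where only the segment is in the set. *)
Lemma continuous_on_ray (D : R3 -> Prop) (f : R3 -> C) p0 v :
  continuous_on D f -> D p0 -> (forall t, 0 < t <= 1 -> D (add3 p0 (scal3 t v))) ->
  exists del K, 0 < del /\ forall t, 0 < t < del -> t <= 1 -> Cmod (f (add3 p0 (scal3 t v))) <= K.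
Proof.
  intros Hf Hp HD.
  assert (HP : locally (f p0) (fun z => Cmod z <= Cmod (f p0) + 2)).
  { exists (mkposreal 1 Rlt_0_1). intros z [H1 H2]. change C in (type of z).
    pose proof (Cmod_triangle (z - f p0)%C (f p0)) as HT.
    replace (z - f p0 + f p0)%C with z in HT by ring.
    pose proof (Cmod_le_abs (z - f p0)%C) as HA.
    change (Rabs (fst z - fst (f p0)) < 1) in H1. change (Rabs (snd z - snd (f p0)) < 1) in H2.
    change (Re (z - f p0)%C) with (fst z - fst (f p0)) in HA.
    change (Im (z - f p0)%C) with (snd z - snd (f p0)) in HA. lra. }
  pose proof (Hf p0 Hp _ HP) as HL. unfold filtermap, within in HL.
  assert (Hc : continuous (fun t : R => add3 p0 (scal3 t v) : R3) 0).
  { apply continuous_R3; unfold add3, scal3; simpl;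
    (apply continuous_Rplus; [apply continuous_const|]);
    (apply continuous_Rmult; [apply continuous_id|apply continuous_const]). }
  assert (E0 : add3 p0 (scal3 0 v) = p0).
  { R3_ring. }
  unfold continuous in Hc. rewrite E0 in Hc.
  destruct (Hc _ HL) as [del Hdel].
  exists del, (Cmod (f p0) + 2). split; [apply cond_pos|]. intros t Ht Ht1.
  apply (Hdel t); [|apply HD; lra].
  change (Rabs (t - 0) < del). rewrite Rminus_0_r, Rabs_pos_eq; lra.
Qed.

(** A polynomial in [1 / t] without constant term that stays bounded as [t]
    tends to 0 vanishes: compare its leading term with the others. *)
Lemma pole_bounded (a : nat -> C) P del K : 0 < del ->
  (forall t, 0 < t < del -> t <= 1 -> Cmod (Csum (fun n => (RtoC (/ t ^ (n + 1)) * a n)%C) P) <=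
      K) ->
  forall n, (n < P)%nat -> a n = RtoC 0.
Proof.
  intros Hdel. revert K. induction P as [|P IH]; intros K H n Hn; [lia|].
  assert (HP : a P = RtoC 0).
  { set (S0 := Rsum (fun n => Cmod (a n)) P).
    assert (HS0 : 0 <= S0) by (apply Rsum_pos; intros; apply Cmod_ge_0).
    assert (HK : 0 <= K).
    { eapply Rle_trans; [apply Cmod_ge_0|apply (H (Rmin (del / 2) 1))].
      - pose proof (Rmin_l (del / 2) 1). split; [|lra]. apply Rmin_glb_lt; lra.
      - apply Rmin_r. }
    assert (Hb : forall t, 0 < t < del -> t <= 1 -> Cmod (a P) <= (K + S0) * t).
    { intros t Ht Ht1. specialize (H t Ht Ht1). simpl Csum in H.
      assert (Htp : forall k, 0 < t ^ k) by (intros; apply pow_lt; lra).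
      assert (Hs : Cmod (Csum (fun n => (RtoC (/ t ^ (n + 1)) * a n)%C) P) <= / t ^ P * S0).
      { unfold S0. rewrite <- Rsum_scal. apply Cmod_Csum. intros i Hi.
        rewrite Cmod_mult, Cmod_R, Rabs_pos_eq by (left; apply Rinv_0_lt_compat, Htp).
        apply Rmult_le_compat_r; [apply Cmod_ge_0|].
        apply Rinv_le_contravar; [apply Htp|].
        replace P with ((i + 1) + (P - (i + 1)))%nat by lia. rewrite pow_add.
        rewrite <- (Rmult_1_r (t ^ (i + 1))) at 2.
        apply Rmult_le_compat_l; [left; apply Htp|].
        rewrite <- (pow1 (P - (i + 1))). apply pow_incr; lra. }
      set (X := Csum (fun n => (RtoC (/ t ^ (n + 1)) * a n)%C) P) in *.
      assert (HT : Cmod (RtoC (/ t ^ (P + 1)) * a P)%C <= K + / t ^ P * S0).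
      { replace (RtoC (/ t ^ (P + 1)) * a P)%C with
          (X + RtoC (/ t ^ (P + 1)) * a P + - X)%C by ring.
        eapply Rle_trans; [apply Cmod_triangle|]. rewrite Cmod_opp. lra. }
      rewrite Cmod_mult, Cmod_R, Rabs_pos_eq in HT by (left; apply Rinv_0_lt_compat, Htp).
      apply (Rmult_le_compat_l (t ^ (P + 1))) in HT; [|left; apply Htp].
      rewrite <- Rmult_assoc, Rinv_r, Rmult_1_l in HT by (apply Rgt_not_eq, Htp).
      eapply Rle_trans; [exact HT|]. rewrite Rmult_plus_distr_l.
      replace (t ^ (P + 1) * (/ t ^ P * S0)) with (S0 * t).
      2:{ rewrite pow_add, pow_1. field. apply Rgt_not_eq, Htp. }
      assert (t ^ (P + 1) <= t).
      { rewrite pow_add, pow_1. rewrite <- (Rmult_1_l t) at 3.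
        apply Rmult_le_compat_r; [lra|]. rewrite <- (pow1 P). apply pow_incr; lra. }
      nra. }
    apply Cmod_eq_0. apply Rle_antisym; [|apply Cmod_ge_0].
    apply Rnot_lt_le. intros Hpos.
    (* Small enough for the bound [(K + S0) t] to be less than [|a P|]. *)
    set (t := Rmin (Rmin (del / 2) 1) (Cmod (a P) / (2 * (K + S0 + 1)))).
    assert (Hq : 0 < Cmod (a P) / (2 * (K + S0 + 1))).
    { apply Rmult_lt_0_compat; [easy|]. apply Rinv_0_lt_compat; lra. }
    assert (Ht0 : 0 < t) by (apply Rmin_glb_lt; [apply Rmin_glb_lt; lra|easy]).
    assert (Ht1 : t <= Rmin (del / 2) 1) by apply Rmin_l.
    assert (Ht2 : t <= Cmod (a P) / (2 * (K + S0 + 1))) by apply Rmin_r.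
    pose proof (Rmin_l (del / 2) 1). pose proof (Rmin_r (del / 2) 1).
    specialize (Hb t ltac:(lra) ltac:(lra)).
    assert ((K + S0 + 1) * t <= Cmod (a P) / 2).
    { apply (Rmult_le_compat_l (K + S0 + 1)) in Ht2; [|lra].
      replace ((K + S0 + 1) * (Cmod (a P) / (2 * (K + S0 + 1)))) with (Cmod (a P) / 2) in Ht2
        by (field; lra). easy. }
    nra. }
  destruct (Nat.eq_dec n P) as [->|Hne]; [easy|].
  apply (IH K); [|lia]. intros t Ht Ht1. specialize (H t Ht Ht1). simpl Csum in H.
  rewrite HP in H. rewrite Cmult_0_r, Cplus_0_r in H. exact H.
Qed.

(** Taylor coefficients are determined one after the other by letting [l] tend
    to 0 in the estimate of the next order. *)
Lemma taylor_unique (a b : nat -> C) :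
  (forall N, exists K, forall l, 0 < l <= 1 ->
     Cmod (Csum (fun n => (RtoC (l ^ n) * (a n - b n))%C) N) <= K * l ^ N) ->
  forall n, a n = b n.
Proof.
  intros H n. induction n as [n IH] using (well_founded_induction lt_wf).
  destruct (H (S n)) as [K HK].
  apply Ceq_minus. apply Cmod_eq_0. apply Rle_antisym; [|apply Cmod_ge_0].
  assert (Hb : forall l, 0 < l <= 1 -> Cmod (a n - b n)%C <= K * l).
  { intros l Hl. specialize (HK l Hl). simpl Csum in HK.
    rewrite Csum_zero, Cplus_0_l in HK.
    - assert (Hp : 0 < l ^ n) by (apply pow_lt; lra).
      rewrite Cmod_mult, Cmod_R, Rabs_pos_eq in HK by lra.
      apply Rmult_le_reg_l with (l ^ n); [easy|]. simpl in HK. lra.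
    - intros i Hi. rewrite (IH i Hi). ring. }
  apply Rnot_lt_le. intros Hpos.
  assert (HK0 : 0 < K) by (specialize (Hb 1 ltac:(lra)); lra).
  set (l := Rmin 1 (Cmod (a n - b n)%C / (2 * K))).
  assert (Hq : 0 < Cmod (a n - b n)%C / (2 * K)).
  { apply Rmult_lt_0_compat; [easy|]. apply Rinv_0_lt_compat; lra. }
  assert (Hl0 : 0 < l) by (apply Rmin_glb_lt; lra).
  assert (Hl1 : l <= 1) by apply Rmin_l.
  assert (Hl2 : l <= Cmod (a n - b n)%C / (2 * K)) by apply Rmin_r.
  specialize (Hb l ltac:(lra)).
  apply (Rmult_le_compat_l K) in Hl2; [|lra].
  replace (K * (Cmod (a n - b n)%C / (2 * K))) with (Cmod (a n - b n)%C / 2) in Hl2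
    by (field; lra). lra.
Qed.

(** * Translations and the norm *)

Lemma add_zero3 x : add3 zero3 x = x.
Proof. R3_ring. Qed.

Lemma sub_zero3 x : sub3 x zero3 = x.
Proof. R3_ring. Qed.

Lemma add_sub3 c x : add3 c (sub3 x c) = x.
Proof. R3_ring. Qed.

Lemma sub_add3 c y : sub3 (add3 c y) c = y.
Proof. R3_ring. Qed.

Lemma norm3_add_ge x y : norm3 x - norm3 y <= norm3 (add3 x y).
Proof.
  pose proof (norm3_triangle (add3 x y) (scal3 (-1) y)) as H.
  replace (add3 (add3 x y) (scal3 (-1) y)) with x in H.
  - rewrite norm3_scal in H. replace (Rabs (-1)) with 1 in H by (rewrite Rabs_left; lra). lra.
  - R3_ring.
Qed.

Lemma norm3_sub_ge x y : norm3 x - norm3 y <= norm3 (sub3 x y).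
Proof.
  replace (sub3 x y) with (add3 x (scal3 (-1) y)).
  - eapply Rle_trans; [|apply norm3_add_ge]. rewrite norm3_scal.
    replace (Rabs (-1)) with 1 by (rewrite Rabs_left; lra). lra.
  - R3_ring.
Qed.

Lemma norm3_sub_le x y : norm3 (sub3 x y) <= norm3 x + norm3 y.
Proof.
  replace (sub3 x y) with (add3 x (scal3 (-1) y)).
  - eapply Rle_trans; [apply norm3_triangle|]. rewrite norm3_scal.
    replace (Rabs (-1)) with 1 by (rewrite Rabs_left; lra). lra.
  - R3_ring.
Qed.

(** * Admissible radii of the point potential *)

Lemma charmonic_point s : charmonic (fun x => norm3 (sub3 x s) <> 0) (point_potential s).
Proof.
  apply (charmonic_ext _ (fun x => (hpoly 0 0 (sub3 x s) * inv_norm (2 * 0 + 1) (sub3 x s))%C)).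
  - apply (open_comp (fun x : R3 => norm3 (sub3 x s)) (fun y => y <> 0));
      [intros; apply norm3_sub_continuous|apply open_neq].
  - intros x _. unfold point_potential, inv_norm, hpoly. simpl. rewrite Cmult_1_l, Rmult_1_r.
      easy.
  - apply (charmonic_translate (fun x => norm3 x <> 0) (fun x => (hpoly 0 0 x * inv_norm (2 * 0
      + 1) x)%C) s).
    apply charmonic_Kelvin.
Qed.

Lemma point_multipole_admissible s : multipole_admissible zero3 (point_potential s) (norm3 s + 1).
Proof.
  pose proof (norm3_pos s) as Hs.
  assert (Hsub : forall x, norm3 s + 1 <= norm3 (sub3 x zero3) -> norm3 (sub3 x s) <> 0).
  { intros x Hx. rewrite sub_zero3 in Hx. pose proof (norm3_sub_ge x s). lra. }
  split; [lra|]. split; [|split].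
  - apply charmonic_harmonic_on; [apply open_coball3|].
    apply (charmonic_sub (fun x => norm3 (sub3 x s) <> 0)); [|apply charmonic_point].
    intros x Hx. apply Hsub. lra.
  - eapply continuous_on_of; [apply charmonic_point|exact Hsub].
  - intros eps Heps. exists (norm3 s + / eps). intros x Hx.
    pose proof (norm3_sub_ge x s). pose proof (Rinv_0_lt_compat _ Heps).
    unfold point_potential. rewrite Cmod_R, Rabs_pos_eq by (left; apply Rinv_0_lt_compat; lra).
    rewrite <- (Rinv_inv eps). apply Rinv_lt_contravar; [|lra].
    apply Rmult_lt_0_compat; lra.
Qed.

Lemma point_local_admissible s c : 0 < norm3 (sub3 c s) ->
  local_admissible c (point_potential s) (norm3 (sub3 c s) / 2).
Proof.
  intros Hd.
  assert (Hsub : forall x, norm3 (sub3 x c) <= norm3 (sub3 c s) / 2 -> norm3 (sub3 x s) <> 0).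
  { intros x Hx. pose proof (norm3_add_ge (sub3 c s) (sub3 x c)) as H.
    replace (add3 (sub3 c s) (sub3 x c)) with (sub3 x s) in H; [lra|].
    R3_ring. }
  split; [lra|]. split.
  - apply charmonic_harmonic_on; [apply open_ball3|].
    apply (charmonic_sub (fun x => norm3 (sub3 x s) <> 0)); [|apply charmonic_point].
    intros x Hx. apply Hsub. lra.
  - eapply continuous_on_of; [apply charmonic_point|exact Hsub].
Qed.

(** On a segment that ends at the charge the potential has a simple pole. *)
Lemma point_not_continuous s v (D : R3 -> Prop) : norm3 v <> 0 ->
  D s -> (forall t, 0 < t <= 1 -> D (add3 s (scal3 t v))) -> ~ continuous_on D (point_potential
      s).
Proof.
  intros Hv Hs HD Hc.
  destruct (continuous_on_ray D _ s v Hc Hs HD) as (del & K & Hdel & HK).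
  assert (H : RtoC (/ norm3 v) = RtoC 0).
  { apply (pole_bounded (fun _ => RtoC (/ norm3 v)) 1 del K Hdel) with (n := O); [|lia].
    intros t Ht Ht1. simpl Csum. rewrite Cplus_0_l.
    specialize (HK t Ht Ht1). unfold point_potential in HK.
    replace (norm3 (sub3 (add3 s (scal3 t v)) s)) with (t * norm3 v) in HK.
    2:{ rewrite sub_add3, norm3_scal, Rabs_pos_eq by lra. easy. }
    rewrite <- RtoC_mult. replace (/ (t * 1) * / norm3 v) with (/ (t * norm3 v)); [exact HK|].
    field. lra. }
  apply RtoC_inj in H. revert H. now apply Rinv_neq_0_compat.
Qed.

(** If the charge were on or outside the sphere, the ray from it away from the
    origin would stay in the set of continuity. *)
Lemma point_multipole_radius s rho :
  multipole_admissible zero3 (point_potential s) rho -> norm3 s < rho.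
Proof.
  intros (Hrho & _ & Hc & _). apply Rnot_le_lt. intros Hle.
  apply (point_not_continuous s s _) in Hc; [easy|lra| |].
  - now rewrite sub_zero3.
  - intros t Ht. rewrite sub_zero3.
    replace (add3 s (scal3 t s)) with (scal3 (1 + t) s).
    + rewrite norm3_scal, Rabs_pos_eq by lra. nra.
    + R3_ring.
Qed.

(** The segment from a point of a closed ball to its centre stays inside. *)
Lemma local_segment c p0 rho : 0 < rho -> norm3 (sub3 p0 c) <= rho ->
  forall t, 0 < t <= 1 -> norm3 (sub3 (add3 p0 (scal3 t (sub3 c p0))) c) <= rho.
Proof.
  intros Hrho Hle t Ht.
  replace (sub3 (add3 p0 (scal3 t (sub3 c p0))) c) with (scal3 (1 - t) (sub3 p0 c)).
  - rewrite norm3_scal, Rabs_pos_eq by lra. pose proof (norm3_pos (sub3 p0 c)). nra.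
  - R3_ring.
Qed.

Lemma point_local_radius s c rho : 0 < norm3 (sub3 c s) ->
  local_admissible c (point_potential s) rho -> rho < norm3 (sub3 c s).
Proof.
  intros Hd (Hrho & _ & Hc). apply Rnot_le_lt. intros Hle.
  apply (point_not_continuous s (sub3 c s) _) in Hc; [easy|lra| |].
  - now rewrite norm3_sub_comm.
  - apply local_segment; [easy|]. now rewrite norm3_sub_comm.
Qed.

(** * The multipole expansion of the point potential *)

(** The term of degree [n] in [s] of the multipole series of [1 / |x - s|],
    for [s] equal to [sg] times the pole. *)
Definition multipole_term (al be sg : R) (n : nat) (x : R3) : C :=
  (RtoC (/ norm3 x ^ (2 * n + 1)) * circle_avg (fun t => (RtoC (sg ^ n) * null_form al be x t ^
      n)))%C.

(** Expansion of [circle_avg_near] in powers of [sg / rho], where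
    [|x| = rho]. *)
Lemma multipole_point_sphere_series al be sg rho : 0 <= sg -> sg < rho ->
  sphere_series zero3 (point_potential (scal3 sg (sphere_point al be))) rho
    (fun n m => (RtoC (/ rho ^ (2 * n + 1)) * circle_avg_coeff al be (fun _ => RtoC (sg ^ n)) n
        m)%C).
Proof.
  intros Hsg Hlt.
  assert (Hrho : 0 < rho) by lra.
  assert (HR : sphere_series zero3 (point_potential (scal3 sg (sphere_point al be))) rho
    (fun n => circle_avg_coeff al be (fun t =>
     (RtoC 1 * RtoC ((sg / rho) ^ n) * (RtoC (binom n 0) * / RtoC rho ^ (n + 0 + 1)))%C) n)).
  { apply (circle_avg_sphere_series al be zero3 _ rho 0 (fun _ => RtoC 1) (fun _ => RtoC rho)
      (sg / rho) 1 rho).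
    - intros; apply ccont_const.
    - intros; apply ccont_const.
    - intros; rewrite Cmod_1; lra.
    - intros; rewrite Cmod_R, Rabs_pos_eq; lra.
    - easy.
    - rewrite Rabs_pos_eq.
      + unfold Rdiv. rewrite Rmult_assoc, Rinv_l; lra.
      + apply Rmult_le_pos; [easy|]. left; now apply Rinv_0_lt_compat.
    - intros y Hy. unfold point_potential. rewrite add_zero3, <- circle_avg_near, Hy by lra.
      apply circle_avg_ext. intros t. simpl Cpow. now rewrite Cmult_1_l, Cmult_1_r. }
  eapply sphere_series_ext; [|exact HR]. intros n m _. cbv beta. unfold circle_avg_coeff.
  rewrite <- circle_avg_scal.
  - apply circle_avg_ext. intros t. rewrite !Cmult_assoc. f_equal.
    rewrite binom_0_r, Cmult_1_l, Cmult_1_r, <- RtoC_pow, <- RtoC_inv, <- !RtoC_mult.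
    + f_equal. unfold Rdiv. rewrite Rpow_mult_distr, pow_inv.
      replace (2 * n + 1)%nat with (n + (n + 0 + 1))%nat by lia. rewrite (pow_add rho n).
      field. split; apply pow_nonzero; lra.
    + apply pow_nonzero; lra.
  - intros t. ccont_auto.
Qed.

Lemma multipole_point_value al be sg p x : 0 <= sg -> norm3 x <> 0 ->
  multipole_expansion p zero3 (point_potential (scal3 sg (sphere_point al be))) x =
  Csum (fun n => multipole_term al be sg n x) (S p).
Proof.
  intros Hsg Hx. set (s := scal3 sg (sphere_point al be)).
  assert (Hs : norm3 s = sg) by (unfold s; rewrite norm3_scal, sphere_point_norm, Rabs_pos_eq;
      lra).
  rewrite (multipole_expansion_sphere_series p _ (fun n m => circle_avg_coeff al be (fun _ =>
      RtoC (sg ^ n)) n m)).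
  - apply Csum_ext. intros n _. unfold multipole_term.
    rewrite (circle_avg_null_power al be (fun _ : R => RtoC (sg ^ n)) n x) by (intros; apply
        ccont_const).
    unfold harm_sum. rewrite <- Csum_scal. apply Csum_ext. intros k Hk. cbv zeta.
    rewrite solid_I_hpoly, solid_R_hpoly by (easy || lia). unfold Rdiv. rewrite RtoC_mult. ring.
  - eexists. apply point_multipole_admissible.
  - intros rho Hadm. apply multipole_point_sphere_series; [easy|].
    apply point_multipole_radius in Hadm. fold s in Hadm. lra.
Qed.

Lemma multipole_point_charmonic s p :
  charmonic (fun x => norm3 x <> 0) (multipole_expansion p zero3 (point_potential s)).
Proof.
  assert (HO : open (fun x : R3 => norm3 x <> 0)).
  { apply (open_comp (norm3 : R3 -> R) (fun y => y <> 0)); [intros; apply norm3_continuous|apply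
      open_neq]. }
  apply (charmonic_ext _ (fun x => Csum (fun n => Csum (fun k => let m := (Z.of_nat k - Z.of_nat
      n)%Z in
    (multipole_coeff zero3 (point_potential s) n m * RtoC (solid_const n m) * (hpoly n m x *
        inv_norm (2 * n + 1) x))%C) (S (2 * n))) (S p))); [easy| |].
  - intros x Hx. unfold multipole_expansion. rewrite degree_order_Csum.
    apply Csum_ext. intros n _. apply Csum_ext. intros k Hk. cbv zeta.
    rewrite sub_zero3, solid_I_hpoly by (easy || lia). unfold inv_norm, Rdiv. rewrite RtoC_mult.
        ring.
  - apply charmonic_Csum. intros n _. apply charmonic_Csum. intros k _. cbv zeta.
    apply charmonic_scal, charmonic_Kelvin.
Qed.

Lemma local_expansion_charmonic p c f : charmonic (fun _ => True) (local_expansion p c f).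
Proof.
  apply (charmonic_ext _ (fun x => Csum (fun n => Csum (fun k => let m := (Z.of_nat k - Z.of_nat
      n)%Z in
    (local_coeff c f n m * RtoC (solid_const n m) * hpoly n m (sub3 x c))%C) (S (2 * n))) (S p))).
  - apply open_true.
  - intros x _. unfold local_expansion. rewrite degree_order_Csum.
    apply Csum_ext. intros n _. apply Csum_ext. intros k Hk. cbv zeta.
    rewrite solid_R_hpoly by lia. ring.
  - apply charmonic_Csum. intros n _. apply charmonic_Csum. intros k _. cbv zeta.
    apply charmonic_scal. apply (charmonic_translate (fun _ => True)). apply charmonic_hpoly.
Qed.

Lemma local_expansion_admissible p c f c' : local_admissible c' (local_expansion p c f) 1.
Proof.
  split; [lra|]. split.
  - apply charmonic_harmonic_on; [apply open_ball3|].
    apply (charmonic_sub (fun _ => True)); [easy|apply local_expansion_charmonic].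
  - eapply continuous_on_of; [apply local_expansion_charmonic|easy].
Qed.

Lemma multipole_local_admissible s p c : 0 < norm3 c ->
  local_admissible c (multipole_expansion p zero3 (point_potential s)) (norm3 c / 2).
Proof.
  intros Hc.
  assert (Hsub : forall x, norm3 (sub3 x c) <= norm3 c / 2 -> norm3 x <> 0).
  { intros x Hx. pose proof (norm3_add_ge c (sub3 x c)) as H. rewrite add_sub3 in H. lra. }
  split; [lra|]. split.
  - apply charmonic_harmonic_on; [apply open_ball3|].
    apply (charmonic_sub (fun x => norm3 x <> 0)); [|apply multipole_point_charmonic].
    intros x Hx. apply Hsub. lra.
  - eapply continuous_on_of; [apply multipole_point_charmonic|exact Hsub].
Qed.

(** The multipole expansion is a polynomial in [1 / |x|] along a ray from its
    centre, and its monopole coefficient, the total charge, is not 0: no ball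
    on which the expansion is continuous contains that centre. *)
Lemma multipole_local_radius al be sg p c rho : 0 <= sg -> 0 < norm3 c ->
  local_admissible c (multipole_expansion p zero3 (point_potential (scal3 sg (sphere_point al
      be)))) rho ->
  rho < norm3 c.
Proof.
  intros Hsg Hc0 (Hrho & _ & Hc). apply Rnot_le_lt. intros Hle.
  assert (Hz : norm3 (sub3 zero3 c) <= rho) by (rewrite norm3_sub_comm, sub_zero3; easy).
  destruct (continuous_on_ray _ _ zero3 (sub3 c zero3) Hc Hz (local_segment c zero3 rho Hrho Hz))
    as (del & K & Hdel & HK).
  assert (H : multipole_term al be sg 0 c = RtoC 0).
  { apply (pole_bounded (fun n => multipole_term al be sg n c) (S p) del K Hdel) with (n := O);
      [|lia].
    intros t Ht Ht1. specialize (HK t Ht Ht1).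
    rewrite add_zero3, sub_zero3 in HK.
    assert (Hn : norm3 (scal3 t c) = t * norm3 c) by (rewrite norm3_scal, Rabs_pos_eq; lra).
    rewrite multipole_point_value in HK; [|easy|rewrite Hn; nra].
    rewrite (Csum_ext _ (fun n => multipole_term al be sg n (scal3 t c))); [easy|].
    intros n _. unfold multipole_term. rewrite Hn.
    rewrite (circle_avg_ext (fun u => (RtoC (sg ^ n) * null_form al be (scal3 t c) u ^ n)%C)
      (fun u => (RtoC (t ^ n) * (RtoC (sg ^ n) * null_form al be c u ^ n))%C)).
    - rewrite (circle_avg_scal (RtoC (t ^ n))).
      + rewrite !Cmult_assoc, <- !RtoC_mult. f_equal. f_equal.
        rewrite Rpow_mult_distr. replace (2 * n + 1)%nat with (n + (n + 1))%nat by lia.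
        rewrite (pow_add t n (n + 1)). field. repeat split; apply pow_nonzero; lra.
      + intros u. ccont_auto.
    - intros u. rewrite null_form_scal, Cpow_mult_l, <- RtoC_pow. ring. }
  (* The term of degree 0 is [1 / |c|]. *)
  unfold multipole_term in H. simpl in H.
  rewrite (circle_avg_is_CInt _ (RtoC (2 * PI))) in H.
  - pose proof PI_RGT_0. rewrite <- !RtoC_mult in H. apply RtoC_inj in H.
    rewrite (Rinv_l (2 * PI)), !Rmult_1_r in H by lra.
    revert H. apply Rinv_neq_0_compat. lra.
  - pose proof (is_CInt_cis 0) as H0. simpl in H0. eapply is_CInt_ext; [|exact H0].
    intros u _. cbv beta. rewrite Rmult_0_l. unfold cis. rewrite cos_0, sin_0.
    apply C_ext; simpl; ring.
Qed.

(** * Re-expansion about a distant centre *)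

(** Here [c] is at distance [D] from the origin in the direction of the pole;
    the frame at [c] serves for all expansions that follow. *)
Section Far.
Variables (al be D : R) (s : R3).
Hypothesis HD : 0 < D.
Let c : R3 := scal3 D (sphere_point al be).

Lemma far_norm : norm3 c = D.
Proof. unfold c. rewrite norm3_scal, sphere_point_norm, Rabs_pos_eq; lra. Qed.

Lemma far_base y t : norm3 y < D -> D - norm3 y <= Cmod (RtoC D - RtoC (-1) * null_form al be y
    t)%C.
Proof.
  intros Hy. pose proof (Cmod_minus_ge (RtoC D) (RtoC (-1) * null_form al be y t)%C) as H.
  rewrite Cmod_mult, !Cmod_R, (Rabs_pos_eq D) in H by lra.
  replace (Rabs (-1)) with 1 in H by (rewrite Rabs_left; lra).
  pose proof (null_form_bound al be y t). lra.
Qed.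

Lemma far_base_ccont y t : ccont (fun t => (RtoC D - RtoC (-1) * null_form al be y t)%C) t.
Proof. ccont_auto. Qed.
#[local] Hint Resolve far_base_ccont : ccont.

(** The coefficient of [l ^ n] in Laplace's integral, in the frame at [c], for
    [1 / |c + y - l s|]. *)
Definition far_term (n : nat) (y : R3) : C :=
  circle_avg (fun t => (null_form al be s t ^ n * / (RtoC D - RtoC (-1) * null_form al be y t) ^
      S n)%C).

(** Both sides are the Taylor coefficients at [l = 0] of [1 / |c + y - l s|],
    the left-hand side in the frame at [s] and the right-hand side in the
    frame at [c]. *)
Lemma multipole_term_far al' be' sg n y :
  0 <= sg -> s = scal3 sg (sphere_point al' be') -> norm3 y < D ->
  multipole_term al' be' sg n (add3 c y) = far_term n y.
Proof.
  intros Hsg Hs Hy. pose proof (norm3_pos y) as Hy0.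
  set (x := add3 c y). set (m := D - norm3 y).
  assert (Hm : 0 < m) by (unfold m; lra).
  assert (Hx : m <= norm3 x).
  { unfold x, m. rewrite <- far_norm. apply norm3_add_ge. }
  (* The charge is moved to [t0 s] so that both expansions in [l] converge for
     all [l <= 1]; the coefficient of [l ^ n] is multiplied by [t0 ^ n]. *)
  set (t0 := m / (2 * (sg + 1))).
  assert (Ht0 : 0 < t0) by (apply Rmult_lt_0_compat; [easy|apply Rinv_0_lt_compat; lra]).
  assert (Ht0s : t0 * sg < m).
  { unfold t0. replace (m / (2 * (sg + 1)) * sg) with (m * (sg / (2 * (sg + 1)))) by (field; lra).
    rewrite <- (Rmult_1_r m) at 2. apply Rmult_lt_compat_l; [easy|].
    apply Rmult_lt_reg_r with (2 * (sg + 1)); [lra|].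
    replace (sg / (2 * (sg + 1)) * (2 * (sg + 1))) with sg by (field; lra). lra. }
  assert (Hs0 : 0 <= t0 * sg) by (apply Rmult_le_pos; lra).
  assert (Heq : forall k, (RtoC (t0 ^ k) * multipole_term al' be' sg k x)%C =
                          (RtoC (t0 ^ k) * far_term k y)%C).
  2:{ specialize (Heq n). assert (Hp : RtoC (t0 ^ n) <> RtoC 0) by (apply RtoC_neq0,
      pow_nonzero; lra).
      transitivity (/ RtoC (t0 ^ n) * (RtoC (t0 ^ n) * multipole_term al' be' sg n x))%C.
      - rewrite Cmult_assoc, Cinv_l by easy. now rewrite Cmult_1_l.
      - rewrite Heq, Cmult_assoc, Cinv_l by easy. now rewrite Cmult_1_l. }
  apply taylor_unique. intros N.
  exists (taylor_remR 0 N (norm3 x) (t0 * sg) + taylor_remR 0 N m (t0 * sg)). intros l Hl.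
  assert (Hls : 0 <= l * t0 * sg <= t0 * sg) by nra.
  assert (Hk : norm3 (scal3 (l * t0) s) = l * t0 * sg).
  { rewrite Hs, !norm3_scal, sphere_point_norm, !Rabs_pos_eq by nra. ring. }
  set (F := RtoC (/ norm3 (sub3 x (scal3 (l * t0) s)))).
  assert (EA : Cmod (F - Csum (fun k => (RtoC (l ^ k) *
      (RtoC (t0 ^ k) * multipole_term al' be' sg k x))) N)%C
      <= l ^ N * taylor_remR 0 N (norm3 x) (t0 * sg)).
  { replace F with (circle_avg (fun t => (/ (RtoC (norm3 x) - RtoC l *
      (RtoC (t0 * sg / norm3 x) * null_form al' be' x t)))%C)).
    2:{ unfold F. rewrite Hs.
        replace (scal3 (l * t0) (scal3 sg (sphere_point al' be'))) with
          (scal3 (l * t0 * sg) (sphere_point al' be')) by R3_ring.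
        rewrite <- circle_avg_near by lra. apply circle_avg_ext. intros t.
        rewrite Cmult_assoc, <- RtoC_mult. do 4 f_equal. unfold Rdiv; ring. }
    rewrite (Csum_ext _ (fun k => (RtoC (l ^ k) * circle_avg (fun t => (/ RtoC (norm3 x) ^ S k *
      (RtoC (t0 * sg / norm3 x) * null_form al' be' x t) ^ k)))%C)).
    - apply (circle_avg_geometric N (fun _ => RtoC (norm3 x))); try lra.
      + intros; ccont_auto.
      + intros; ccont_auto.
      + intros; rewrite Cmod_R, Rabs_pos_eq; lra.
      + intros t. assert (0 <= t0 * sg / norm3 x).
        { apply Rmult_le_pos; [lra|left; apply Rinv_0_lt_compat; lra]. }
        rewrite Cmod_mult, Cmod_R, Rabs_pos_eq by easy.
        replace (t0 * sg) with (t0 * sg / norm3 x * norm3 x) at 2 by (field; lra).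
        apply Rmult_le_compat_l; [easy|apply null_form_bound].
    - intros k _. unfold multipole_term. f_equal.
      rewrite Cmult_assoc, <- RtoC_mult, <- circle_avg_scal by (intros; ccont_auto).
      apply circle_avg_ext. intros t.
      rewrite Cpow_mult_l, <- !RtoC_pow, <- RtoC_inv by (apply pow_nonzero; lra).
      rewrite !Cmult_assoc, <- !RtoC_mult. do 2 f_equal. unfold Rdiv.
      rewrite !Rpow_mult_distr, pow_inv.
      replace (2 * k + 1)%nat with (k + S k)%nat by lia.
      rewrite (pow_add (norm3 x) k). field. split; apply pow_nonzero; lra. }
  assert (EB : Cmod (F - Csum (fun k => (RtoC (l ^ k) * (RtoC (t0 ^ k) * far_term k y))) N)%C
      <= l ^ N * taylor_remR 0 N m (t0 * sg)).
  { replace F with (circle_avg (fun t => (/ ((RtoC D - RtoC (-1) * null_form al be y t) -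
      RtoC l * null_form al be (scal3 t0 s) t))%C)).
    2:{ unfold F. replace (sub3 x (scal3 (l * t0) s)) with (sub3 c (sub3 (scal3 (l * t0) s) y))
          by (unfold x; R3_ring).
        unfold c at 1. rewrite <- circle_avg_far.
        - apply circle_avg_ext. intros t. f_equal.
          rewrite null_form_sub, !null_form_scal. apply C_ext; simpl; ring.
        - eapply Rle_lt_trans; [apply norm3_sub_le|]. rewrite Hk. unfold m in *. lra. }
    rewrite (Csum_ext _ (fun k => (RtoC (l ^ k) * circle_avg (fun t =>
      (/ (RtoC D - RtoC (-1) * null_form al be y t) ^ S k * null_form al be (scal3 t0 s) t ^
          k)))%C)).
    - apply (circle_avg_geometric N (fun t => (RtoC D - RtoC (-1) * null_form al be y t)%C));
        try lra.
      + intros; ccont_auto.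
      + intros; ccont_auto.
      + intros; now apply far_base.
      + intros t. eapply Rle_trans; [apply null_form_bound|].
        rewrite Hs, !norm3_scal, sphere_point_norm, !Rabs_pos_eq; lra.
    - intros k _. unfold far_term. f_equal. rewrite <- circle_avg_scal.
      + apply circle_avg_ext. intros t. rewrite null_form_scal, Cpow_mult_l, RtoC_pow. ring.
      + intros t. apply ccont_mult; [ccont_auto|]. apply ccont_inv; [|ccont_auto].
        apply Cpow_nz, Cmod_neq0. pose proof (far_base y t Hy). fold m in H. lra. }
  rewrite (Csum_ext _ (fun k => (RtoC (l ^ k) * (RtoC (t0 ^ k) * multipole_term al' be' sg k x) -
      RtoC (l ^ k) * (RtoC (t0 ^ k) * far_term k y))%C)) by (intros; ring).
  rewrite Csum_minus.
  match type of EA with context [Cminus F ?X] => set (A := X) in * end.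
  match type of EB with context [Cminus F ?X] => set (B := X) in * end.
  replace (A - B)%C with ((F - B) + - (F - A))%C by ring.
  eapply Rle_trans; [apply Cmod_triangle|]. rewrite Cmod_opp. lra.
Qed.

(** Coefficients of degree [k] in [y] of the sum of [far_term n y] over
    [n < P], obtained by expanding the integrand in powers of the null form
    of [y]. *)
Definition far_coeff (P : nat) (k : nat) (m : Z) : C :=
  Csum (fun n => circle_avg_coeff al be (fun t => (null_form al be s t ^ n * RtoC ((-1) ^ k) *
      (RtoC (binom k n) * / RtoC D ^ (k + n + 1)))%C) k m) P.

Lemma null_form_pow_bound v n t : Cmod (null_form al be v t ^ n)%C <= norm3 v ^ n.
Proof. rewrite Cmod_pow. apply pow_incr. split; [apply Cmod_ge_0|apply null_form_bound]. Qed.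

(** The expansion in the frame at [c] converges up to the centre of the
    multipole expansion, hence for every radius less than [D]. *)
Lemma multipole_far_sphere_series p rho : 0 < rho -> rho < D ->
  sphere_series c (multipole_expansion p zero3 (point_potential s)) rho (far_coeff (S p)).
Proof.
  intros Hrho Hlt.
  destruct (polar_form s) as (al' & be' & Hs).
  apply (sphere_series_ext_f c (fun x => Csum (fun n => multipole_term al' be' (norm3 s) n x) (S
      p))).
  { intros y Hy. replace (point_potential s) with
      (point_potential (scal3 (norm3 s) (sphere_point al' be'))) by now rewrite <- Hs.
    rewrite multipole_point_value; [easy|apply norm3_pos|].
    pose proof (norm3_add_ge c y) as H. rewrite far_norm in H. lra. }
  unfold far_coeff. apply sphere_series_Csum. intros n _.
  apply (circle_avg_sphere_series al be c _ rho n (fun t => (null_form al be s t ^ n)%C) (fun _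
      => RtoC D) (-1)
    (norm3 s ^ n) D).
  - intros; apply ccont_pow, null_form_ccont.
  - intros; apply ccont_const.
  - intros; apply null_form_pow_bound.
  - intros; rewrite Cmod_R, Rabs_pos_eq; lra.
  - easy.
  - rewrite Rabs_left; lra.
  - intros y Hy. apply multipole_term_far; [apply norm3_pos|easy|lra].
Qed.

Lemma local_multipole_value p x :
  local_expansion p c (multipole_expansion p zero3 (point_potential s)) x =
  Csum (fun k => harm_sum k (far_coeff (S p) k) (sub3 x c)) (S p).
Proof.
  apply local_expansion_sphere_series.
  - eexists. apply multipole_local_admissible. rewrite far_norm; easy.
  - intros rho Hadm. pose proof (proj1 Hadm) as Hrho.
    apply multipole_far_sphere_series; [easy|].
    destruct (polar_form s) as (al' & be' & Hs). rewrite Hs in Hadm.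
    rewrite <- far_norm. eapply multipole_local_radius; [apply norm3_pos| |exact Hadm].
    now rewrite far_norm.
Qed.

(** ** The second change of centre *)

Variable c' : R3.
Let sgt (t : R) : C := null_form al be s t.
Let alt (t : R) : C := null_form al be (sub3 c c') t.

Lemma shift_coeff_ccont P j t : ccont (fun t => shift_coeff P D (sgt t) (alt t) j) t.
Proof.
  unfold shift_coeff, sgt, alt. ccont_auto.
Qed.
#[local] Hint Resolve shift_coeff_ccont : ccont.

(** With [y = c' - c + z] the null form of [y] is a sum, and the binomial
    theorem collects the powers of the null form of [z]. *)
Lemma local_multipole_shift p z :
  local_expansion p c (multipole_expansion p zero3 (point_potential s)) (add3 c' z) =
  Csum (fun j => harm_sum j (circle_avg_coeff al be (fun t =>
    (shift_coeff (S p) D (sgt t) (alt t) j * RtoC ((-1) ^ j))%C) j) z) (S p).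
Proof.
  set (P := S p). rewrite local_multipole_value. fold P.
  set (y := sub3 (add3 c' z) c).
  assert (Hy : forall t, (RtoC (-1) * null_form al be y t)%C =
     (alt t + RtoC (-1) * null_form al be z t)%C).
  { intros t. unfold y, alt. rewrite !null_form_sub, null_form_add. apply C_ext; simpl; ring. }
  assert (Hw : forall k n t, ccont (fun t => (null_form al be s t ^ n * RtoC ((-1) ^ k) * (RtoC
      (binom k n) * / RtoC D ^ (k + n + 1)))%C) t).
  { intros k n t. ccont_auto. }
  set (ck := fun t k => Csum (fun n => (sgt t ^ n * (RtoC (binom k n) * / RtoC D ^ (k + n +
      1)))%C) P).
  transitivity (circle_avg (fun t => Csum (fun k => (ck t k * (RtoC (-1) * null_form al be y t)
      ^ k)%C) P)).
  { rewrite circle_avg_Csum.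
    - apply Csum_ext. intros k _. unfold far_coeff. rewrite harm_sum_Csum.
      rewrite (Csum_ext _ (fun n => circle_avg (fun t => (null_form al be s t ^ n * RtoC ((-1) ^
          k) * (RtoC (binom k n) * / RtoC D ^ (k + n + 1)) * null_form al be y t ^ k)%C))).
      2:{ intros n _. symmetry. apply circle_avg_null_power. intros; apply Hw. }
      rewrite <- circle_avg_Csum.
      + apply circle_avg_ext. intros t. unfold ck.
        rewrite (Cmult_comm (Csum _ _)), <- Csum_scal. apply Csum_ext. intros n _.
        rewrite Cpow_mult_l, (RtoC_pow (-1)). unfold sgt. ring.
      + intros n t _. ccont_auto.
    - intros k t _. unfold ck, sgt. ccont_auto. }
  rewrite (circle_avg_ext _ (fun t => Csum (fun j => (shift_coeff P D (sgt t) (alt t) j * RtoC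
      ((-1) ^ j) * null_form al be z t ^ j)%C) P)).
  - rewrite circle_avg_Csum.
    + apply Csum_ext. intros j _. apply circle_avg_null_power. intros t.
      ccont_auto.
    + intros j t _. ccont_auto.
  - intros t. rewrite Hy, Csum_binomial. apply Csum_ext. intros j _.
    rewrite Cpow_mult_l, <- RtoC_pow.
    assert (E : Csum (fun i => (RtoC (binom i j) * (ck t (i + j)%nat * alt t ^ i))%C) (P - j)
      = shift_coeff P D (sgt t) (alt t) j).
    { unfold shift_coeff. rewrite Csum_swap. apply Csum_ext. intros i _. unfold ck.
      transitivity (RtoC (binom i j) * alt t ^ i * Csum (fun n => (sgt t ^ n * (RtoC (binom (i +
          j) n) * / RtoC D ^ (i + j + n + 1)))) P)%C; [ring|].
      rewrite <- Csum_scal. apply Csum_ext. intros n _.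
      rewrite (binom_sym (i + j) n). replace (i + j + n + 1)%nat with (n + (i + j) + 1)%nat by
          lia.
      rewrite !RtoC_mult, RtoC_inv, RtoC_pow by (apply pow_nonzero; lra). ring. }
    rewrite E. ring.
Qed.

(** The function expanded at [c'] is a polynomial, so every radius is
    admissible and it has its own coefficients; for [j > p] the coefficient
    [shift_coeff] is an empty sum, so one formula covers all [q]. *)
Lemma local_local_value p q x :
  local_expansion q c' (local_expansion p c (multipole_expansion p zero3 (point_potential s))) x =
  circle_avg (fun t => Csum (fun j => (shift_coeff (S p) D (sgt t) (alt t) j * (RtoC (-1) *
      null_form al be (sub3 x c') t) ^ j)%C) (S q)).
Proof.
  assert (Hcc : forall j t, ccont (fun t => (shift_coeff (S p) D (sgt t) (alt t) j * RtoC ((-1)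
      ^ j))%C) t).
  { intros j t. ccont_auto. }
  rewrite (local_expansion_sphere_series q c' _ (fun j => circle_avg_coeff al be (fun t =>
    (shift_coeff (S p) D (sgt t) (alt t) j * RtoC ((-1) ^ j))%C) j)).
  - rewrite circle_avg_Csum.
    + apply Csum_ext. intros j _. rewrite <- circle_avg_null_power by apply Hcc.
      apply circle_avg_ext. intros t. rewrite Cpow_mult_l, <- RtoC_pow. ring.
    + intros j t _. ccont_auto.
  - exists 1. apply local_expansion_admissible.
  - intros rho _. apply (sphere_series_polynomial c' _ rho _ (S p)).
    + intros y. apply local_multipole_shift.
    + intros j m Hj. unfold circle_avg_coeff.
      rewrite (circle_avg_ext _ (fun _ => RtoC 0)).
      * rewrite (circle_avg_is_CInt _ _ (is_CInt_zero 0 (2 * PI))). ring.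
      * intros t. unfold shift_coeff. replace (S p - j)%nat with O by lia.
        rewrite Csum_zero by easy. ring.
Qed.

(** The admissible radii reach up to [|c' - s|], farther than the expansion in
    the frame at [c] converges.  A frame at [s - c'] covers them all, and on a
    small sphere both expansions hold, so their coefficients agree. *)
Lemma local_point_value q x : norm3 (sub3 c c') + norm3 s < D ->
  local_expansion q c' (point_potential s) x =
  circle_avg (fun t => Csum (fun j => (/ (RtoC D - (alt t + sgt t)) ^ S j * (RtoC (-1) *
      null_form al be (sub3 x c') t) ^ j)%C) (S q)).
Proof.
  intros Hfar.
  set (bs := fun t => (RtoC D - (alt t + sgt t))%C).
  set (b0 := D - norm3 (sub3 c c') - norm3 s).
  assert (Hb0 : 0 < b0) by (unfold b0; lra).
  assert (Hbs : forall t, b0 <= Cmod (bs t)).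
  { intros t. unfold bs. pose proof (Cmod_minus_ge (RtoC D) (alt t + sgt t)%C) as H.
    rewrite Cmod_R, Rabs_pos_eq in H by lra.
    pose proof (Cmod_triangle (alt t) (sgt t)). unfold alt, sgt, b0 in *.
    pose proof (null_form_bound al be (sub3 c c') t). pose proof (null_form_bound al be s t).
        lra. }
  assert (Cbs : forall t, ccont bs t).
  { intros t. unfold bs, alt, sgt. ccont_auto. }
  assert (Hbnz : forall t, bs t <> RtoC 0) by (intros t; apply Cmod_neq0; specialize (Hbs t);
      lra).
  set (a := fun j => circle_avg_coeff al be (fun t => (RtoC 1 * RtoC ((-1) ^ j) * (RtoC (binom j
      0) * / bs t ^ (j + 0 + 1)))%C) j).
  assert (Hdist : b0 <= norm3 (sub3 c' s)).
  { pose proof (norm3_add_ge c (sub3 (sub3 c' c) s)) as H. rewrite far_norm in H.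
    pose proof (norm3_sub_le (sub3 c' c) s) as H1. rewrite (norm3_sub_comm c' c) in H1.
    replace (add3 c (sub3 (sub3 c' c) s)) with (sub3 c' s) in H.
    - unfold b0; lra.
    - R3_ring. }
  assert (Hnear : sphere_series c' (point_potential s) (b0 / 2) a).
  { apply (circle_avg_sphere_series al be c' _ (b0 / 2) 0 (fun _ => RtoC 1) bs (-1) 1 b0).
    - intros; apply ccont_const.
    - exact Cbs.
    - intros; rewrite Cmod_1; lra.
    - exact Hbs.
    - lra.
    - rewrite Rabs_left; lra.
    - intros y Hy. unfold point_potential.
      replace (sub3 (add3 c' y) s) with (sub3 c (sub3 (add3 (sub3 c c') s) y)).
      + unfold c at 1. rewrite <- circle_avg_far.
        * apply circle_avg_ext. intros t. unfold bs, alt, sgt. simpl Cpow.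
          rewrite Cmult_1_l, Cmult_1_r, !null_form_sub, null_form_add, null_form_sub. f_equal.
              apply C_ext; simpl; ring.
        * eapply Rle_lt_trans; [apply norm3_sub_le|].
          pose proof (norm3_triangle (sub3 c c') s). unfold b0 in *. lra.
      + R3_ring. }
  assert (Hall : forall rho, 0 < rho -> rho < norm3 (sub3 c' s) -> sphere_series c'
      (point_potential s) rho a).
  { intros rho Hrho Hlt.
    destruct (polar_form (sub3 s c')) as (al2 & be2 & Hd).
    set (d := norm3 (sub3 s c')) in *.
    assert (Hdd : d = norm3 (sub3 c' s)) by apply norm3_sub_comm.
    set (a2 := fun j => circle_avg_coeff al2 be2 (fun t => (RtoC 1 * RtoC (1 ^ j) * (RtoC (binom
        j 0) * / RtoC d ^ (j + 0 + 1)))%C) j).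
    assert (H2 : forall r, 0 < r -> r < d -> sphere_series c' (point_potential s) r a2).
    { intros r Hr Hrd.
      apply (circle_avg_sphere_series al2 be2 c' _ r 0 (fun _ => RtoC 1) (fun _ => RtoC d) 1 1 d).
      - intros; apply ccont_const.
      - intros; apply ccont_const.
      - intros; rewrite Cmod_1; lra.
      - intros; rewrite Cmod_R, Rabs_pos_eq; lra.
      - easy.
      - rewrite Rabs_pos_eq; lra.
      - intros y Hy. unfold point_potential.
        replace (sub3 (add3 c' y) s) with (sub3 y (sub3 s c')).
        + rewrite norm3_sub_comm, Hd, <- circle_avg_far by lra.
          apply circle_avg_ext. intros t. simpl Cpow. now rewrite !Cmult_1_l, Cmult_1_r.
        + R3_ring. }
    apply (sphere_series_ext c' _ rho a2); [|apply H2; lra].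
    intros n m Hm. apply (sphere_series_unique c' (point_potential s) (b0 / 2)); [lra| |exact
        Hnear|exact Hm].
    apply H2; lra. }
  rewrite (local_expansion_sphere_series q c' _ a).
  - rewrite circle_avg_Csum.
    + apply Csum_ext. intros j _. unfold a. rewrite <- circle_avg_null_power.
      * apply circle_avg_ext. intros t. fold (bs t). rewrite binom_0_r, Cpow_mult_l, <- RtoC_pow.
        replace (j + 0 + 1)%nat with (S j) by lia. ring.
      * intros t. ccont_auto.
    + intros j t _. fold (bs t). apply ccont_mult; [|ccont_auto].
      apply ccont_inv; [apply Cpow_nz, Hbnz|]. apply ccont_pow, Cbs.
  - eexists. apply point_local_admissible. lra.
  - intros rho Hadm. apply Hall; [apply Hadm|]. apply point_local_radius; [lra|easy].
Qed.

End Far.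

Theorem theorem3p9 :
  forall (RR r RR' r' : R) (p q : nat) (s c c' t : R3),
    0 < r -> r < RR ->
    0 < r' -> r' < RR' ->
    norm3 s <= r ->
    norm3 c = RR' + r ->
    RR' + r = RR + r' ->
    norm3 (sub3 t c') <= r' - norm3 (sub3 c c') ->
    Cmod (Cminus
            (local_expansion q c' (point_potential s) t)
            (local_expansion q c'
               (local_expansion p c
                  (multipole_expansion p zero3 (point_potential s))) t))
    <= 1 / (RR - r) * (r / RR) ^ (p + 1)
       + 1 / (RR' - r') * (r' / RR') ^ (p + 1).
Proof.
  intros RR r RR' r' p q s c c' x Hr HR Hr' HR' Hs Hc Hsum Hx.
  set (D := RR' + r) in *.
  destruct (polar_form c) as (al & be & Hpol). rewrite Hc in Hpol.
  assert (HD : 0 < D) by (unfold D; lra).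
  pose proof (norm3_pos (sub3 x c')) as Hx0.
  rewrite Hpol in *. clear Hpol.
  set (c0 := scal3 D (sphere_point al be)) in *.
  assert (Hfar : norm3 (sub3 c0 c') + norm3 s < D) by (unfold D in *; lra).
  unfold c0.
  rewrite (local_point_value al be D s HD c' q x Hfar).
  rewrite (local_local_value al be D s HD c' p q x). fold c0.
  set (Z := fun t => (RtoC (-1) * null_form al be (sub3 x c') t)%C).
  set (sg := fun t => null_form al be s t). set (at' := fun t => null_form al be (sub3 c0 c') t).
  assert (Hnz : forall t, (RtoC D - (at' t + sg t))%C <> RtoC 0).
  { intros t. apply Cmod_neq0.
    pose proof (Cmod_minus_ge (RtoC D) (at' t + sg t)%C) as H.
    rewrite Cmod_R, Rabs_pos_eq in H by lra.
    pose proof (Cmod_triangle (at' t) (sg t)). unfold at', sg in *.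
    pose proof (null_form_bound al be (sub3 c0 c') t). pose proof (null_form_bound al be s t).
        lra. }
  assert (CZ : forall j t, ccont (fun t => (Z t ^ j)%C) t).
  { intros j t. apply ccont_pow, ccont_mult; [apply ccont_const|apply null_form_ccont]. }
  set (f1 := fun t : R => Csum (fun j => (/ (RtoC D - (at' t + sg t)) ^ S j * Z t ^ j)%C) (S q)).
  set (f2 := fun t : R => Csum (fun j => (shift_coeff (S p) D (sg t) (at' t) j * Z t ^ j)%C) (S
      q)).
  assert (C1 : forall t, ccont f1 t).
  { intros t. apply ccont_Csum. intros j _. apply ccont_mult; [|apply CZ].
    apply ccont_inv; [apply Cpow_nz, Hnz|]. apply ccont_pow, ccont_minus; [apply ccont_const|].
    apply ccont_plus; apply null_form_ccont. }
  assert (C2 : forall t, ccont f2 t).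
  { intros t. apply ccont_Csum. intros j _. apply ccont_mult; [|apply CZ].
    apply shift_coeff_ccont. }
  change (Cmod (circle_avg f1 - circle_avg f2)%C <=
    1 / (RR - r) * (r / RR) ^ (p + 1) + 1 / (RR' - r') * (r' / RR') ^ (p + 1)).
  rewrite <- (circle_avg_minus f1 f2 C1 C2).
  apply circle_avg_bound; [intros t; apply ccont_minus; [apply C1|apply C2]|].
  intros t. unfold f1, f2. rewrite <- Csum_minus.
  rewrite (Csum_ext _ (fun j => ((/ (RtoC D - (at' t + sg t)) ^ S j - shift_coeff (S p) D (sg t)
      (at' t) j) * Z t ^ j)%C)) by (intros; ring).
  replace (p + 1)%nat with (S p) by lia.
  (* The two equations for [|c|] say that [D = RR + r' = RR' + r]. *)
  replace RR with (D - r') by lra. replace RR' with (D - r) by (unfold D; lra).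
  apply pointwise_error; try lra.
  - eapply Rle_trans; [apply null_form_bound|easy].
  - unfold Z, at'. rewrite Cmod_mult, Cmod_R. replace (Rabs (-1)) with 1 by (rewrite Rabs_left;
      lra).
    pose proof (null_form_bound al be (sub3 c0 c') t). pose proof (null_form_bound al be (sub3 x
        c') t). lra.
Qed.
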